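(* Let $\Lambda=KQ/I$ be a path algebra modulo relations, let $e$ be the sum of the primitive idempotents corresponding to the precyclic vertices of $Q$, and let $e'$ be the sum of the primitive idempotents corresponding to the critical vertices. If $\operatorname{l.findim}e\Lambda e=0$ and $\mathcal{P}^{<\infty}(\text{mod-}e'\Lambda e')$ is contravariantly finite in $\text{mod-}e'\Lambda e'$, then $\Lambda\text{-mod}$ allows for unlimited iteration of strong tilting.
   Context: A path algebra modulo relations is $\Lambda=KQ/I$ with $K$ a field, $Q$ a finite quiver and $I$ an admissible ideal of $KQ$ (so $\Lambda$ is a basic finite dimensional algebra). Paths are composed from right to left, so that $\Lambda e_i$ is spanned by the paths starting in the vertex $e_i$; vertices are identified with primitive idempotents of $\Lambda$. A vertex $e_i$ is precyclic if there is a path of length $\ge0$ which starts in $e_i$ and ends on an oriented cycle; it is postcyclic if there is a path of length $\ge0$ which starts on an oriented cycle and ends in $e_i$; it is critical if it is both precyclic and postcyclic. For an Artin algebra $A$, $A\text{-mod}$ (resp. $\text{mod-}A$) is the category of finitely generated left (resp. right) $A$-modules, $\mathcal{P}^{<\infty}(A\text{-mod})$ (resp. $\mathcal{P}^{<\infty}(\text{mod-}A)$) its full subcategory of modules of finite projective dimension, and $\operatorname{l.findim}A$ the supremum of the projective dimensions of objects of $\mathcal{P}^{<\infty}(A\text{-mod})$. $\mathcal{P}^{<\infty}(\text{mod-}A)$ is contravariantly finite in $\text{mod-}A$ if for each $M\in\text{mod-}A$ there is a map $\phi:X\to M$ with $X\in\mathcal{P}^{<\infty}(\text{mod-}A)$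 through which every homomorphism from an object of $\mathcal{P}^{<\infty}(\text{mod-}A)$ to $M$ factors. A module is basic if it has no indecomposable direct summand of multiplicity $>1$. $T\in A\text{-mod}$ is a tilting module if (1) $T\in\mathcal{P}^{<\infty}(A\text{-mod})$, (2) $\operatorname{Ext}^i_A(T,T)=0$ for $i\ge1$, (3) there is an exact sequence $0\to A\to T_0\to\cdots\to T_s\to0$ with all $T_j\in\operatorname{add}(T)$. It is strong if, in addition, $\operatorname{Ext}^i_A(M,T)=0$ for all $M\in\mathcal{P}^{<\infty}(A\text{-mod})$ and $i\ge1$. Similarly for right modules. If $A\text{-mod}$ has a strong tilting module, the basic one is unique up to isomorphism. For basic Artin algebras $A,B$: $\text{mod-}B$ results from $A\text{-mod}$ via strong tilting if $A\text{-mod}$ has a basic strong tilting module $T$ and $B\cong\operatorname{End}_A(T)^{\mathrm{op}}$; $B\text{-mod}$ results from $\text{mod-}A$ via strong tilting if $\text{mod-}A$ has a basic strong tilting module $T$ and $B\cong\operatorname{End}_A(T)$. The category $\Lambda\text{-mod}$ allows for unlimited iteration of strong tilting if there is an infinite sequence of basic algebras $(\Lambda_i)_{i\ge0}$ with $\Lambda_0=\Lambda$ such that $\text{mod-}\Lambda_{i+1}$ results from $\Lambda_i\text{-mod}$ via strong tilting for $i$ even, and $\Lambda_{i+1}\text{-mod}$ results from $\text{mod-}\Lambda_i$ via strong tilting for $i$ odd. *)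

(* Defs.v *)
From HB Require Import structures.
From mathcomp Require Import all_boot all_order all_algebra.
From mathcomp Require Import finmap monalg.

Set Implicit Arguments.
Unset Strict Implicit.
Unset Printing Implicit Defensive.

Import GRing.Theory.
Local Open Scope ring_scope.

(* Rings may be zero (pzRingType): the corner rings considered below are zero *)
(* when the quiver has no oriented cycle.  Left A-modules are the objects of  *)
(* lmodType A, right A-modules those of lmodType A^c.                         *)

Record quiver := Quiver {
  vert : finType;
  arr : finType;
  src : arr -> vert;
  tgt : arr -> vert
}.

Section Paths.
Variable Q : quiver.

(* The pair (v, [:: a_n; ...; a_1]) stands for the path a_n ... a_1, composed *)
(* from right to left, which starts in v; (v, [::]) is the path of length 0.  *)
Definition raw_end (x : vert Q * seq (arr Q)) : vert Q :=
  if x.2 is a :: _ then tgt a else x.1.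

Fixpoint wf_path_rec (v : vert Q) (s : seq (arr Q)) : bool :=
  if s is a :: s' then (src a == raw_end (v, s')) && wf_path_rec v s' else true.

Definition wf_path (x : vert Q * seq (arr Q)) : bool := wf_path_rec x.1 x.2.

Definition qpath : choiceType := {x : vert Q * seq (arr Q) | wf_path x}.

Definition path_start (p : qpath) : vert Q := (val p).1.
Definition path_end (p : qpath) : vert Q := raw_end (val p).
Definition path_length (p : qpath) : nat := size (val p).2.

Definition trivial_path (v : vert Q) : qpath :=
  exist _ (v, [::]) (erefl true).

(* The path pq is "first q, then p"; insub never fails (path_comp_some). *)
Definition path_comp (p q : qpath) : option qpath :=
  if path_start p == path_end q
  then insub (path_start q, (val p).2 ++ (val q).2)
  else None.

Lemma raw_end_cat v s t :
  raw_end (v, s ++ t) = raw_end (raw_end (v, t), s).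
Proof. by case: s. Qed.

Lemma wf_path_cat v s t :
  wf_path_rec v (s ++ t) = wf_path_rec (raw_end (v, t)) s && wf_path_rec v t.
Proof. by elim: s => //= a s ->; rewrite raw_end_cat andbA. Qed.

Lemma path_comp_some p q : path_start p = path_end q ->
  exists2 r, path_comp p q = Some r
    & val r = (path_start q, (val p).2 ++ (val q).2).
Proof.
move=> pq; rewrite /path_comp pq eqxx; case: insubP => [r _ valr|]; first by exists r.
case: p q pq => [[v s] /= wp] [[w t] /= wq]; rewrite /path_start /path_end /= => ev.
by rewrite /wf_path /= in wp wq *; rewrite wf_path_cat -ev wp wq.
Qed.

Lemma path_compA p q r :
  obind (path_comp^~ r) (path_comp p q) = obind (path_comp p) (path_comp q r).
Proof.
have [pq|pq] := eqVneq (path_start p) (path_end q); last first.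
  have -> : path_comp p q = None by rewrite /path_comp (negPf pq).
  have [qr|qr] := eqVneq (path_start q) (path_end r); last first.
    by rewrite /path_comp (negPf qr).
  have [u -> valu] := path_comp_some qr.
  rewrite /= /path_comp; case: eqP => // pu; case/eqP: pq; rewrite pu.
  rewrite /path_end valu raw_end_cat; move: qr; rewrite /path_start /path_end.
  by case: (val q) (val r) => [v s] [v' s'] /= ->.
have [u -> valu] := path_comp_some pq; rewrite /=.
have [qr|qr] := eqVneq (path_start q) (path_end r); last first.
  by rewrite /path_comp /path_start valu /= -/(path_start q) (negPf qr).
have [w -> valw] := path_comp_some qr; rewrite /=.
have ur : path_start u = path_end r by rewrite /path_start valu.
have pw : path_start p = path_end w.
  rewrite pq /path_end valw raw_end_cat; move: qr; rewrite /path_start /path_end.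
  by case: (val q) (val r) => [v s] [v' s'] /= ->.
have [x -> valx] := path_comp_some ur; have [y -> valy] := path_comp_some pw.
congr Some; apply: val_inj; rewrite valx valy valu valw /= catA.
by rewrite /path_start valw.
Qed.

Lemma path_comp_triv_l v p :
  path_comp (trivial_path v) p = if v == path_end p then Some p else None.
Proof.
case: eqP => [vp|/eqP vp]; last by rewrite /path_comp (negPf vp).
have [r -> valr] := path_comp_some (vp : path_start (trivial_path v) = _).
by congr Some; apply: val_inj; rewrite valr; exact/esym/surjective_pairing.
Qed.

Lemma path_comp_triv_r v p :
  path_comp p (trivial_path v) = if path_start p == v then Some p else None.
Proof.
case: eqP => [vp|/eqP vp]; last by rewrite /path_comp (negPf vp).
have [r -> valr] := path_comp_some (vp : _ = path_end (trivial_path v)).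
congr Some; apply: val_inj; rewrite valr /= cats0 -vp.
exact/esym/surjective_pairing.
Qed.

Definition arrow_rel : rel (vert Q) :=
  [rel v w | [exists a : arr Q, (src a == v) && (tgt a == w)]].

Definition on_oriented_cycle (v : vert Q) : bool :=
  [exists w, arrow_rel v w && connect arrow_rel w v].

Definition precyclic (v : vert Q) : bool :=
  [exists w, connect arrow_rel v w && on_oriented_cycle w].

Definition postcyclic (v : vert Q) : bool :=
  [exists w, on_oriented_cycle w && connect arrow_rel w v].

Definition critical (v : vert Q) : bool := precyclic v && postcyclic v.

End Paths.

Arguments trivial_path {Q} v.

Definition path_algebra (K : fieldType) (Q : quiver) : Type :=
  {malg K[qpath Q]}.

HB.instance Definition _ (K : fieldType) (Q : quiver) :=
  GRing.Lmodule.on (path_algebra K Q).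

(* Locked, like the product below, because unification would otherwise unfold *)
(* finitely supported functions.                                              *)
HB.lock
Definition path_elt (K : fieldType) (Q : quiver) (c : K)
    (p : option (qpath Q)) : path_algebra K Q :=
  if p is Some r then << c *g r >> else 0.

Arguments path_elt {K Q} c p.

HB.lock
Definition pa_mul (K : fieldType) (Q : quiver) (f g : path_algebra K Q) :
    path_algebra K Q :=
  \sum_(p <- msupp f) \sum_(q <- msupp g)
    path_elt (f@_p * g@_q) (path_comp p q).

Arguments pa_mul {K Q} f g.

Section PathAlgebra.
Variables (K : fieldType) (Q : quiver).
Local Notation KQ := (path_algebra K Q).
Implicit Types (f g h : KQ) (p q : qpath Q).

Definition pa_one : KQ := \sum_(v : vert Q) path_elt 1 (Some (trivial_path v)).

Lemma path_elt0 x : path_elt 0 x = 0 :> KQ.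
Proof. by rewrite path_elt.unlock; case: x => //= r; rewrite monalgU0. Qed.

Lemma path_eltD c d x :
  path_elt (c + d) x = path_elt c x + path_elt d x :> KQ.
Proof.
by rewrite path_elt.unlock; case: x => [r|] /=; rewrite ?monalgUD ?addr0.
Qed.

Lemma pa_mulw (d1 d2 : {fset qpath Q}) f g :
  (msupp f `<=` d1)%fset -> (msupp g `<=` d2)%fset ->
  pa_mul f g = \sum_(p <- d1) \sum_(q <- d2)
                 path_elt (f@_p * g@_q) (path_comp p q).
Proof.
move=> le1 le2; rewrite pa_mul.unlock (big_fset_incl _ le1) /=.
  apply: eq_bigr => p _; apply: big_fset_incl => // q _ /mcoeff_outdom ->.
  by rewrite mulr0 path_elt0.
move=> p _ /mcoeff_outdom fp.
by rewrite big1 // => q _; rewrite fp mul0r path_elt0.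
Qed.

Lemma pa_mulDl : left_distributive (@pa_mul K Q) +%R.
Proof.
move=> f g h; set d := (msupp f `|` msupp g)%fset.
rewrite (@pa_mulw d (msupp h) (f + g)) ?msuppD_le //.
rewrite (@pa_mulw d (msupp h) f) ?fsubsetUl // (@pa_mulw d (msupp h) g) ?fsubsetUr //.
rewrite -big_split /=; apply: eq_bigr => p _; rewrite -big_split /=.
by apply: eq_bigr => q _; rewrite mcoeffD mulrDl path_eltD.
Qed.

Lemma pa_mulDr : right_distributive (@pa_mul K Q) +%R.
Proof.
move=> h f g; set d := (msupp f `|` msupp g)%fset.
rewrite (@pa_mulw (msupp h) d h (f + g)) ?msuppD_le //.
rewrite (@pa_mulw (msupp h) d h f) ?fsubsetUl // (@pa_mulw (msupp h) d h g) ?fsubsetUr //.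
rewrite -big_split /=; apply: eq_bigr => p _; rewrite -big_split /=.
by apply: eq_bigr => q _; rewrite mcoeffD mulrDr path_eltD.
Qed.

Lemma pa_mul0l g : pa_mul 0 g = 0.
Proof. by rewrite pa_mul.unlock msupp0 big_seq_fset0. Qed.

Lemma pa_mul0r f : pa_mul f 0 = 0.
Proof. by rewrite pa_mul.unlock big1 // => p _; rewrite msupp0 big_seq_fset0. Qed.

Lemma pa_mul_suml (J : Type) (s : seq J) (P : pred J) (F : J -> KQ) g :
  pa_mul (\sum_(j <- s | P j) F j) g = \sum_(j <- s | P j) pa_mul (F j) g.
Proof. exact: (big_morph (pa_mul^~ g) (fun _ _ => pa_mulDl _ _ _) (pa_mul0l g)). Qed.

Lemma pa_mul_sumr (J : Type) (s : seq J) (P : pred J) (F : J -> KQ) f :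
  pa_mul f (\sum_(j <- s | P j) F j) = \sum_(j <- s | P j) pa_mul f (F j).
Proof. exact: (big_morph (pa_mul f) (fun _ _ => pa_mulDr _ _ _) (pa_mul0r f)). Qed.

Lemma pa_mulUU c d p q :
  pa_mul (path_elt c (Some p)) (path_elt d (Some q)) =
  path_elt (c * d) (path_comp p q) :> KQ.
Proof.
rewrite {1 2}path_elt.unlock (pa_mulw msuppU_le msuppU_le).
by rewrite !big_seq_fset1 !mcoeffUU.
Qed.

Lemma pa_ind (P : KQ -> Prop) :
  P 0 -> (forall f g, P f -> P g -> P (f + g)) ->
  (forall c p, P (path_elt c (Some p))) ->
  forall f, P f.
Proof.
move=> P0 PD PU f; rewrite [f]monalgE; apply: big_ind => // p _.
by have := PU f@_p p; rewrite path_elt.unlock.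
Qed.

Lemma path_elt_None c : path_elt c None = 0 :> KQ.
Proof. by rewrite path_elt.unlock. Qed.

Lemma pa_mulA : associative (@pa_mul K Q).
Proof.
move=> f g h.
elim/pa_ind: f => [|f1 f2 E1 E2|a p]; first by rewrite !pa_mul0l.
  by rewrite !pa_mulDl E1 E2.
elim/pa_ind: g => [|f1 f2 E1 E2|b q]; first by rewrite !(pa_mul0l, pa_mul0r).
  by rewrite !(pa_mulDl, pa_mulDr) E1 E2.
elim/pa_ind: h => [|f1 f2 E1 E2|c r].
- by rewrite !pa_mul0r.
- by rewrite !pa_mulDr E1 E2.
have El d x : pa_mul (path_elt d x) (path_elt c (Some r)) =
    path_elt (d * c) (obind ((@path_comp Q)^~ r) x) :> KQ.
  by case: x => [x|] /=; rewrite ?pa_mulUU // !path_elt_None pa_mul0l.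
have Er d x : pa_mul (path_elt a (Some p)) (path_elt d x) =
    path_elt (a * d) (obind (path_comp p) x) :> KQ.
  by case: x => [x|] /=; rewrite ?pa_mulUU // !path_elt_None pa_mul0r.
by rewrite !pa_mulUU El Er mulrA path_compA.
Qed.

Lemma pa_mul1l : left_id pa_one (@pa_mul K Q).
Proof.
elim/pa_ind => [|f1 f2 E1 E2|c p]; first by rewrite pa_mul0r.
  by rewrite pa_mulDr E1 E2.
rewrite pa_mul_suml (bigD1 (path_end p)) //= pa_mulUU path_comp_triv_l.
rewrite eqxx mul1r big1 ?addr0 // => v /negPf vp.
by rewrite pa_mulUU path_comp_triv_l vp path_elt_None.
Qed.

Lemma pa_mul1r : right_id pa_one (@pa_mul K Q).
Proof.
elim/pa_ind => [|f1 f2 E1 E2|c p]; first by rewrite pa_mul0l.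
  by rewrite pa_mulDl E1 E2.
rewrite pa_mul_sumr (bigD1 (path_start p)) //= pa_mulUU path_comp_triv_r.
rewrite eqxx mulr1 big1 ?addr0 // => v /negPf vp.
by rewrite pa_mulUU path_comp_triv_r eq_sym vp path_elt_None.
Qed.

HB.instance Definition _ := GRing.Zmodule_isPzRing.Build KQ
  pa_mulA pa_mul1l pa_mul1r pa_mulDl pa_mulDr.

(* The m-th power of the ideal of KQ generated by the arrows, i.e. the        *)
(* K-span of the paths of length at least m.                                  *)
Definition arrow_ideal_pow (m : nat) (f : KQ) : Prop :=
  forall p, p \in msupp f -> (m <= path_length p)%N.

End PathAlgebra.

Definition two_sided_ideal (A : pzRingType) (I : A -> Prop) : Prop :=
  [/\ I 0,
      forall x y, I x -> I y -> I (x + y)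
    & forall a x b, I x -> I (a * x * b)].

Definition admissible_ideal (K : fieldType) (Q : quiver)
    (I : path_algebra K Q -> Prop) : Prop :=
  [/\ two_sided_ideal I,
      exists2 m, (2 <= m)%N & forall f, arrow_ideal_pow m f -> I f
    & forall f, I f -> arrow_ideal_pow 2 f].

(* f : A -> B identifies B with the quotient ring A/I. *)
Definition is_quotient_map (A B : pzRingType) (I : A -> Prop)
    (f : {rmorphism A -> B}) : Prop :=
  (forall y, exists x, f x = y) /\ (forall x, f x = 0 <-> I x).

Record idempotent_elt (A : pzRingType) := Idempotent {
  idem_val : A;
  idem_mul : idem_val * idem_val = idem_val
}.

Definition idem_map (A B : pzRingType) (f : {rmorphism A -> B})
    (e : idempotent_elt A) : idempotent_elt B :=
  @Idempotent B (f (idem_val e))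
    (etrans (esym (rmorphM f _ _)) (congr1 f (idem_mul e))).

Section VertexIdempotent.
Variables (K : fieldType) (Q : quiver) (P : pred (vert Q)).

Definition vertex_sum : path_algebra K Q :=
  \sum_(v | P v) path_elt 1 (Some (trivial_path v)).

Lemma vertex_sum_idem : vertex_sum * vertex_sum = vertex_sum.
Proof.
rewrite {1}/vertex_sum mulr_suml; apply: eq_bigr => v Pv.
rewrite mulr_sumr (bigD1 v) //= big1 => [|w /andP[_ /negPf wv]];
  rewrite /GRing.mul /= pa_mulUU path_comp_triv_l /path_end /raw_end /=.
  by rewrite eqxx addr0 mulr1.
by rewrite eq_sym wv path_elt_None.
Qed.

Definition vertex_idem : idempotent_elt (path_algebra K Q) :=
  Idempotent vertex_sum_idem.

End VertexIdempotent.

Section Corner.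
Variables (A : pzRingType) (e : idempotent_elt A).
Local Notation e0 := (idem_val e).

Definition corner_pred : {pred A} := fun x => e0 * x * e0 == x.

Record corner := Corner {
  corner_val : A;
  corner_valP : corner_val \in corner_pred
}.

HB.instance Definition _ := [isSub for corner_val].
HB.instance Definition _ := [Choice of corner by <:].

Lemma corner_predE x : (x \in corner_pred) = (e0 * x * e0 == x).
Proof. by []. Qed.

Lemma corner_zmod_closed : zmod_closed corner_pred.
Proof.
split; first by rewrite corner_predE mulr0 mul0r.
by move=> x y /eqP xe /eqP ye; rewrite corner_predE mulrBr mulrBl xe ye.
Qed.

HB.instance Definition _ := GRing.isZmodClosed.Build A corner_pred corner_zmod_closed.
HB.instance Definition _ := [SubChoice_isSubZmodule of corner by <:].

Lemma corner_el (x : corner) : e0 * val x = val x.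
Proof. by have /eqP <- := valP x; rewrite !mulrA idem_mul. Qed.

Lemma corner_er (x : corner) : val x * e0 = val x.
Proof. by have /eqP <- := valP x; rewrite -!mulrA idem_mul. Qed.

Lemma corner_one_subproof : e0 \in corner_pred.
Proof. by rewrite corner_predE !idem_mul. Qed.

Lemma corner_mul_subproof (x y : corner) : val x * val y \in corner_pred.
Proof. by rewrite corner_predE mulrA corner_el -mulrA corner_er. Qed.

Definition corner_one : corner := Corner corner_one_subproof.
Definition corner_mul (x y : corner) : corner := Corner (corner_mul_subproof x y).

Lemma corner_mulA : associative corner_mul.
Proof. by move=> x y z; apply: val_inj; rewrite /= mulrA. Qed.
Lemma corner_mul1l : left_id corner_one corner_mul.
Proof. by move=> x; apply: val_inj; rewrite /= corner_el. Qed.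
Lemma corner_mul1r : right_id corner_one corner_mul.
Proof. by move=> x; apply: val_inj; rewrite /= corner_er. Qed.
Lemma corner_mulDl : left_distributive corner_mul +%R.
Proof. by move=> x y z; apply: val_inj; rewrite /= mulrDl. Qed.
Lemma corner_mulDr : right_distributive corner_mul +%R.
Proof. by move=> x y z; apply: val_inj; rewrite /= mulrDr. Qed.

HB.instance Definition _ := GRing.Zmodule_isPzRing.Build corner
  corner_mulA corner_mul1l corner_mul1r corner_mulDl corner_mulDr.

End Corner.

Section Modules.
Variable A : pzRingType.
Implicit Types M N P T X Y : lmodType A.

Definition fin_gen M : Prop :=
  exists s : seq M, forall x, exists c : 'I_(size s) -> A,
    x = \sum_(i < size s) c i *: s`_i.

Definition zero_module M : Prop := forall x : M, x = 0.

Definition iso_modules M N : Prop :=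
  exists (f : {linear M -> N}) (g : {linear N -> M}), cancel f g /\ cancel g f.

Definition direct_summand N M : Prop :=
  exists (i : {linear N -> M}) (p : {linear M -> N}), cancel i p.

Definition indecomposable M : Prop :=
  ~ zero_module M /\
  forall X Y, iso_modules M (X * Y)%type -> zero_module X \/ zero_module Y.

Definition basic_module M : Prop :=
  forall N, indecomposable N -> ~ direct_summand (N * N)%type M.

Definition in_add T M : Prop :=
  exists n : nat, direct_summand M {ffun 'I_n -> T}.

Definition exact_at M N P (f : {linear M -> N}) (g : {linear N -> P}) : Prop :=
  forall y, g y = 0 <-> exists x, f x = y.

Definition projective P : Prop :=
  forall M N (g : {linear M -> N}) (f : {linear P -> N}),
    (forall y, exists x, g x = y) ->
    exists h : {linear P -> M}, forall x, g (h x) = f x.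

Record proj_resolution M := ProjResolution {
  pr_obj : nat -> lmodType A;
  pr_diff : forall i, {linear pr_obj i.+1 -> pr_obj i};
  pr_aug : {linear pr_obj 0%N -> M};
  pr_proj : forall i, projective (pr_obj i);
  pr_aug_surj : forall y, exists x, pr_aug x = y;
  pr_aug_exact : exact_at (pr_diff 0%N) pr_aug;
  pr_diff_exact : forall i, exact_at (pr_diff i.+1) (pr_diff i)
}.

Definition pd_le M (n : nat) : Prop :=
  exists P : proj_resolution M, forall i, (n < i)%N -> zero_module (pr_obj P i).

(* The category of finitely generated modules of finite projective dimension. *)
Definition fin_pd M : Prop := fin_gen M /\ exists n, pd_le M n.

(* d is the supremum of the projective dimensions of the objects of fin_pd,   *)
(* the zero module having projective dimension 0.                             *)
Definition findim_eq (d : nat) : Prop :=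
  (forall M, fin_pd M -> pd_le M d) /\
  (forall d', (forall M, fin_pd M -> pd_le M d') -> (d <= d')%N).

(* Ext^(i+1)(M, N) = 0: the complex Hom(P, N) is exact in degree i+1 for      *)
(* every projective resolution P of M (the choice of P does not matter).      *)
Definition ext_succ_eq0 (i : nat) M N : Prop :=
  forall (P : proj_resolution M) (f : {linear pr_obj P i.+1 -> N}),
    (forall x, f (pr_diff P i.+1 x) = 0) ->
    exists g : {linear pr_obj P i -> N}, forall x, f x = g (pr_diff P i x).

Definition ext_pos_eq0 M N : Prop := forall i, ext_succ_eq0 i M N.

Definition fin_pd_contravariantly_finite : Prop :=
  forall M, fin_gen M ->
  exists X (phi : {linear X -> M}), fin_pd X /\
    forall Y (f : {linear Y -> M}), fin_pd Y ->
      exists g : {linear Y -> X}, forall y, phi (g y) = f y.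

(* 0 -> A -> T_0 -> ... -> T_s -> 0 is exact with all T_j in add(T); the      *)
(* sequence is continued by zero modules after T_s.                           *)
Definition has_add_coresolution T : Prop :=
  exists (s : nat) (C : nat -> lmodType A)
         (eps : {linear A^o -> C 0%N})
         (d : forall j, {linear C j -> C j.+1}),
    [/\ forall j, in_add T (C j),
        forall j, (s < j)%N -> zero_module (C j),
        injective eps,
        exact_at eps (d 0%N)
      & forall j, exact_at (d j) (d j.+1)].

Definition tilting T : Prop :=
  [/\ fin_pd T, ext_pos_eq0 T T & has_add_coresolution T].

Definition strong_tilting T : Prop :=
  tilting T /\ forall M, fin_pd M -> ext_pos_eq0 M T.

(* B is isomorphic to End_A(T), with multiplication the composition of maps   *)
(* (f g)(x) = f (g x).                                                        *)
Definition iso_End (B : pzRingType) T : Prop :=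
  exists phi : B -> {linear T -> T},
    [/\ forall a b x, phi (a + b) x = phi a x + phi b x,
        forall x, phi 1 x = x,
        forall a b x, phi (a * b) x = phi a (phi b x),
        forall a b, phi a =1 phi b -> a = b
      & forall f : {linear T -> T}, exists a, phi a =1 f].

End Modules.

Definition artinian_comm (R : comPzRingType) : Prop :=
  forall J : nat -> R -> Prop,
    (forall n, two_sided_ideal (J n)) ->
    (forall n x, J n.+1 x -> J n x) ->
    exists n, forall m, (n <= m)%N -> forall x, J n x -> J m x.

Definition artin_algebra (A : pzRingType) : Prop :=
  exists (R : comPzRingType) (f : {rmorphism R -> A}),
    [/\ artinian_comm R,
        forall r a, f r * a = a * f r
      & exists s : seq A, forall x, exists c : 'I_(size s) -> R,
          x = \sum_(i < size s) f (c i) * s`_i].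

Definition basic_artin_algebra (A : pzRingType) : Prop :=
  artin_algebra A /\ basic_module (A^o : lmodType A).

(* mod-B results from A-mod: B is isomorphic to End_A(T)^op, that is, B^c is  *)
(* isomorphic to End_A(T).                                                    *)
Definition strong_tilts_left (A B : pzRingType) : Prop :=
  exists T : lmodType A,
    [/\ basic_module T, strong_tilting T & iso_End B^c T].

(* B-mod results from mod-A: B is isomorphic to End_A(T). *)
Definition strong_tilts_right (A B : pzRingType) : Prop :=
  exists T : lmodType A^c,
    [/\ basic_module T, strong_tilting T & iso_End B T].

Definition unlimited_strong_tilting (A : pzRingType) : Prop :=
  exists L : nat -> pzRingType,
    [/\ L 0%N = A,
        forall i, basic_artin_algebra (L i),
        forall i, ~~ odd i -> strong_tilts_left (L i) (L i.+1)
      & forall i, odd i -> strong_tilts_right (L i) (L i.+1)].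

(* Main.v *)
(* Write P(A) for the finitely generated modules of finite projective          *)
(* dimension. Since e Lambda (1 - e) = 0 and Lambda-modules killed by e have   *)
(* finite projective dimension, membership in P(Lambda-mod) is detected by the *)
(* corner e Lambda e; likewise P(mod-e Lambda e) is detected by e' Lambda e'.  *)
(* A detecting corner transports contravariant finiteness. By the              *)
(* Auslander-Reiten argument, contravariant finiteness of P bounds projective  *)
(* dimensions on P, and the special P-approximation T of an injective          *)
(* cogenerator is strong tilting.                                              *)
(*                                                                             *)
(* Up to multiplicities T is U + T0, where U is e Lambda e viewed as a         *)
(* Lambda-module. The corner of End(T) at U is e Lambda e, acting from the     *)
(* right, and modules killed by it are of the form Hom(X, T) with X in P       *)
(* killed by e; hence P(mod-L1) is contravariantly finite for L1 = End(T)^op,  *)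
(* and mod-L1 has a strong tilting module T2. As T is a cogenerator for        *)
(* mod-L1 in the weak sense that every nonzero module maps nontrivially to it, *)
(* so is T2, and this makes T2 strong tilting also over L2 = End(T2). Its      *)
(* endomorphism ring there is L1, up to sides, so the sequence                 *)
(* Lambda, L1, L2, L1, L2, ... works.                                          *)

(* Write P for the finitely generated modules of finite projective dimension. A corner S = eGe is
   said here to detect P when M lies in P exactly if eM does. By [corner_fin_pd] this holds once eG
   is a finitely generated projective S-module and all finitely generated modules killed by e lie in
   P. For vertex idempotents the second condition comes from [peel]: the discarded vertices lie on
   no oriented cycle and can be removed one at a time. Through the right adjoint of M |-> eM,
   detection carries contravariant finiteness from the corner to the ring ([CF_of_corner]) and back
   ([CF_to_corner]).

   Contravariant finiteness produces strong tilting modules. Minimal approximations are special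
   ([wakamatsu]), and the special approximation of an injective cogenerator is an Ext-injective
   cogenerator T of P ([strong_cogen_exists]). Projective dimensions on P are bounded
   ([findim_bound]), so T has the coresolution that makes it tilting ([strong_cogen_tilting]).

   The hypothesis on eGe for G = Lambda enters twice: P(eGe) consists of the projective modules,
   hence is contravariantly finite, and U = eGe is Ext-injective over G ([UU_perp]), so U may be
   added to T. Then End(T) acquires the corner (eGe)^op, which again detects P ([FB_reg],
   [FB_kill]), and contravariant finiteness for (eGe)^op is inherited from e'Ge'. This yields T2
   over End(T). From there the iteration is periodic: T2 is strong tilting over its own endomorphism
   ring as well ([sharp_tilting]) and has the double centralizer property ([is_End_ract]). *)
Require Import Defs.
From HB Require Import structures.
From mathcomp Require Import all_boot all_order all_algebra.
From mathcomp Require Import finmap monalg.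
From mathcomp Require Import generic_quotient ring_quotient.
From mathcomp Require Import boolp.
Import GRing.Theory.
Set Implicit Arguments.
Unset Strict Implicit.
Unset Printing Implicit Defensive.
Local Open Scope ring_scope.

(** * Linear maps, submodules and quotients *)

Section LinearMaps.
Variable A : pzRingType.
Implicit Types M N P Q X : lmodType A.

(* Opaque, so that simplification leaves the maps below folded. *)
Fact mkL_subproof M N (f : M -> N) (lf : linear f) :
  {g : {linear M -> N} | forall x, g x = f x}.
Proof.
pose g : {linear M -> N} := HB.pack f (GRing.isLinear.Build A M N *:%R f lf).
by exists g.
Qed.
Definition mkL M N f lf : {linear M -> N} := sval (@mkL_subproof M N f lf).
Lemma mkLE M N f lf x : @mkL M N f lf x = f x.
Proof. by rewrite /mkL; case: mkL_subproof. Qed.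

Definition lcomp M N P (f : {linear N -> P}) (g : {linear M -> N}) :
  {linear M -> P} := mkL (linearP (f \o g)).
Definition ladd M N (f g : {linear M -> N}) : {linear M -> N} :=
  mkL (linearP (f \+ g)).
Definition lsub M N (f g : {linear M -> N}) : {linear M -> N} :=
  mkL (linearP (f \- g)).
Definition lzero M N : {linear M -> N} := mkL (linearP (\0 : M -> N)).
Definition lid M : {linear M -> M} := mkL (linearP (@idfun M)).

Fact lpair_subproof M N P (f : {linear M -> N}) (g : {linear M -> P}) :
  linear (fun x => (f x, g x)).
Proof. by move=> a x y; rewrite !linearP. Qed.
Definition lpair M N P (f : {linear M -> N}) (g : {linear M -> P}) :
  {linear M -> (N * P)%type} := mkL (lpair_subproof f g).

Definition lfst M N : {linear (M * N)%type -> M} := mkL (linearP (@fst M N)).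
Definition lsnd M N : {linear (M * N)%type -> N} := mkL (linearP (@snd M N)).

Definition linl M N : {linear M -> (M * N)%type} := lpair (lid M) (lzero M N).
Definition linr M N : {linear N -> (M * N)%type} := lpair (lzero N M) (lid N).
Definition lcase M N P (f : {linear M -> P}) (g : {linear N -> P}) :
  {linear (M * N)%type -> P} := ladd (lcomp f (lfst M N)) (lcomp g (lsnd M N)).
Definition lprod M N P X (f : {linear M -> P}) (g : {linear N -> X}) :
  {linear (M * N)%type -> (P * X)%type} :=
  lpair (lcomp f (lfst M N)) (lcomp g (lsnd M N)).

Lemma lcompE M N P f g x : @lcomp M N P f g x = f (g x).
Proof. exact: mkLE. Qed.
Lemma laddE M N f g x : @ladd M N f g x = f x + g x.
Proof. exact: mkLE. Qed.
Lemma lsubE M N f g x : @lsub M N f g x = f x - g x.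
Proof. exact: mkLE. Qed.
Lemma lzeroE M N x : lzero M N x = 0.
Proof. exact: mkLE. Qed.
Lemma lidE M x : lid M x = x.
Proof. exact: mkLE. Qed.
Lemma lpairE M N P f g x : @lpair M N P f g x = (f x, g x).
Proof. exact: mkLE. Qed.
Lemma lfstE M N x : lfst M N x = x.1.
Proof. exact: mkLE. Qed.
Lemma lsndE M N x : lsnd M N x = x.2.
Proof. exact: mkLE. Qed.
Lemma linlE M N x : linl M N x = (x, 0).
Proof. by rewrite lpairE lidE lzeroE. Qed.
Lemma linrE M N x : linr M N x = (0, x).
Proof. by rewrite lpairE lidE lzeroE. Qed.
Lemma lcaseE M N P f g x : @lcase M N P f g x = f x.1 + g x.2.
Proof. by rewrite laddE !lcompE lfstE lsndE. Qed.
Lemma lprodE M N P X f g x : @lprod M N P X f g x = (f x.1, g x.2).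
Proof. by rewrite lpairE !lcompE lfstE lsndE. Qed.
Definition lE := (lfstE, lsndE, linlE, linrE, lcompE, laddE, lsubE, lzeroE,
  lidE, lpairE, lcaseE, lprodE).

Fact lproj_subproof M n (k : 'I_n) : linear (fun x : {ffun 'I_n -> M} => x k).
Proof. by move=> a x y; rewrite !ffunE. Qed.
Definition lproj M n k : {linear {ffun 'I_n -> M} -> M} :=
  mkL (@lproj_subproof M n k).

Fact linj_subproof M n (k : 'I_n) :
  linear (fun x : M => [ffun l => if l == k then x else 0]).
Proof.
move=> a x y; apply/ffunP=> l; rewrite !ffunE.
by case: (l == k) => //; rewrite scaler0 addr0.
Qed.
Definition linj M n k : {linear M -> {ffun 'I_n -> M}} :=
  mkL (@linj_subproof M n k).

Arguments lproj {M n} k.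
Arguments linj {M n} k.

Fact ltuple_subproof M N n (f : 'I_n -> {linear M -> N}) :
  linear (fun x => [ffun k => f k x]).
Proof. by move=> a x y; apply/ffunP=> k; rewrite !ffunE linearP. Qed.
Definition ltuple M N n f : {linear M -> {ffun 'I_n -> N}} :=
  mkL (@ltuple_subproof M N n f).

Fact lsum_subproof M N n (f : 'I_n -> {linear M -> N}) :
  linear (fun x : {ffun 'I_n -> M} => \sum_k f k (x k)).
Proof.
move=> a x y; rewrite scaler_sumr -big_split /=; apply: eq_bigr => k _.
by rewrite !ffunE linearP.
Qed.
Definition lsum M N n f : {linear {ffun 'I_n -> M} -> N} :=
  mkL (@lsum_subproof M N n f).

Fact comb_subproof M n (s : 'I_n -> M) :
  linear (fun x : {ffun 'I_n -> A^o} => \sum_k (x k : A) *: s k).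
Proof.
move=> a x y; rewrite scaler_sumr -big_split /=; apply: eq_bigr => k _.
by rewrite !ffunE scalerDl scalerA.
Qed.
Definition comb M n s : {linear {ffun 'I_n -> A^o} -> M} :=
  mkL (@comb_subproof M n s).

Lemma lprojE M n k x : @lproj M n k x = x k.
Proof. exact: mkLE. Qed.
Lemma linjE M n k x l : @linj M n k x l = if l == k then x else 0.
Proof. by rewrite mkLE ffunE. Qed.
Lemma ltupleE M N n f x k : @ltuple M N n f x k = f k x.
Proof. by rewrite mkLE ffunE. Qed.
Lemma lsumE M N n f x : @lsum M N n f x = \sum_k f k (x k).
Proof. exact: mkLE. Qed.
Lemma combE M n s x : @comb M n s x = \sum_k (x k : A) *: s k.
Proof. exact: mkLE. Qed.

Lemma linj_proj M n (x : {ffun 'I_n -> M}) : x = \sum_k linj k (x k).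
Proof.
apply/ffunP=> l; rewrite sum_ffunE (bigD1 l) //= linjE eqxx big1 ?addr0 // => k.
by rewrite eq_sym linjE => /negPf->.
Qed.

Definition fbase n (k : 'I_n) : {ffun 'I_n -> A^o} := linj k (1 : A^o).

Lemma free_comb M n (f : {linear {ffun 'I_n -> A^o} -> M}) x :
  f x = \sum_k (x k : A) *: f (fbase k).
Proof.
rewrite [in LHS](linj_proj x) linear_sum; apply: eq_bigr => k _.
rewrite -linearZ_LR; congr (f _); apply/ffunP=> l; rewrite ffunE !linjE.
by case: (l == k); rewrite ?scaler0 // /GRing.scale /= mulr1.
Qed.

Lemma ext_free M n (f g : {linear {ffun 'I_n -> A^o} -> M}) :
  (forall k, f (fbase k) = g (fbase k)) -> f =1 g.
Proof.
by move=> fg x; rewrite !free_comb; apply: eq_bigr => k _; rewrite fg.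
Qed.

Lemma comb_fbase M n (s : 'I_n -> M) k : comb s (fbase k) = s k.
Proof.
rewrite combE (bigD1 k) //= linjE eqxx scale1r big1 ?addr0 // => l /negPf lk.
by rewrite linjE lk scale0r.
Qed.

Definition submodP M (S : M -> Prop) :=
  S 0 /\ forall a x y, S x -> S y -> S (a *: x + y).

Definition surj M N (f : {linear M -> N}) := forall y, exists x, f x = y.

Lemma lin_inj M N (f : {linear M -> N}) :
  (forall x, f x = 0 -> x = 0) -> injective f.
Proof. by move=> f0 x y fxy; apply/subr0_eq/f0; rewrite linearB fxy subrr. Qed.

Lemma factor_surj M N Q (q : {linear M -> Q}) (h : {linear M -> N}) :
  surj q -> (forall x, q x = 0 -> h x = 0) ->
  exists k : {linear Q -> N}, forall x, k (q x) = h x.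
Proof.
move=> /choice[s qs] q0; have hs x y : q x = y -> h (s y) = h x.
  by move=> qx; apply/subr0_eq; rewrite -linearB q0 // linearB qs qx subrr.
have lin : linear (h \o s).
  by move=> a x y; rewrite /= -linearP; apply: hs; rewrite linearP !qs.
by exists (mkL lin) => x; rewrite mkLE; apply: hs.
Qed.

Lemma factor_inj M N N' (i : {linear N' -> N}) (h : {linear M -> N}) :
  injective i -> (forall x, exists y, i y = h x) ->
  exists k : {linear M -> N'}, forall x, i (k x) = h x.
Proof.
move=> inj_i /choice[k ik].
have lin : linear k by move=> a x y; apply: inj_i; rewrite linearP !ik linearP.
by exists (mkL lin) => x; rewrite mkLE.
Qed.

Lemma submod_ker M N (f : {linear M -> N}) : submodP (fun x => f x = 0).
Proof.
split=> [|a x y fx fy]; first exact: linear0.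
by rewrite linearP fx fy scaler0 addr0.
Qed.

Lemma submod_im M N (f : {linear M -> N}) : submodP (fun y => exists x, f x = y).
Proof.
split=> [|a x y [x' <-] [y' <-]]; first by exists 0; exact: linear0.
by exists (a *: x' + y'); rewrite linearP.
Qed.

Lemma lin_bij M N (f : {linear M -> N}) : injective f -> surj f ->
  exists2 g : {linear N -> M}, cancel f g & cancel g f.
Proof.
move=> inj_f surj_f; have [y|g fg] := factor_inj (h := lid N) inj_f.
  by rewrite lidE; apply: surj_f.
by exists g => x; [apply: inj_f|]; rewrite fg lidE.
Qed.

Section Sub.
Variables (M : lmodType A) (S : M -> Prop) (HS : submodP S).

(** [asbool] turns the Prop-valued [S] into a boolean predicate, as the substructure builders
    require. The proof that [S] is a submodule is an argument so that the closure instance can be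
    attached to [sub_pred HS]. *)
Definition sub_pred of submodP S : {pred M} := fun x => `[< S x >].
Local Notation pS := (sub_pred HS).

Fact sub_pred_closed : submod_closed pS.
Proof.
case: HS => S0 SP; split; first exact/asboolP.
by move=> a x y /asboolP Sx /asboolP Sy; apply/asboolP/SP.
Qed.
HB.instance Definition _ := GRing.isSubmodClosed.Build A M pS
  (GRing.submod_closed_semi sub_pred_closed).

Record sub_type := SubType { sub_val : M; sub_valP : sub_val \in pS }.
HB.instance Definition _ := [isSub for sub_val].
HB.instance Definition _ := [Choice of sub_type by <:].
HB.instance Definition _ := [SubChoice_isSubLmodule of sub_type by <:].

Lemma ex_sub : exists (N : lmodType A) (i : {linear N -> M}),
  injective i /\ forall x, S x <-> exists y, i y = x.
Proof.
exists sub_type, (val : {linear sub_type -> M}); split; first exact: val_inj.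
move=> x; split=> [Sx|[y <-]]; last by apply/asboolP; exact: (valP y).
have xS : x \in pS by apply/asboolP.
by exists (SubType xS).
Qed.

End Sub.

Section Quotient.
Variables (M : lmodType A) (S : M -> Prop) (HS : submodP S).

Definition quo_type : Type := Quotient.quot (sub_pred HS).
HB.instance Definition _ := GRing.Zmodule.on quo_type.
Definition quo_proj : M -> quo_type := \pi_(Quotient.quot (sub_pred HS))%qT.

Lemma quo_projP x y : quo_proj x = quo_proj y <-> S (x - y).
Proof.
split=> [/eqP|Sxy]; last apply/eqP; rewrite -[_ == _]Quotient.idealrBE.
  by move/asboolP.
exact/asboolP.
Qed.

Lemma quo_projK (x : quo_type) : quo_proj (repr x) = x.
Proof. exact: reprK. Qed.

Lemma quo_projD x y : quo_proj (x + y) = quo_proj x + quo_proj y.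
Proof. exact: (raddfD \pi_(Quotient.quot (sub_pred HS))%qT). Qed.

Definition quo_scale a (x : quo_type) := quo_proj (a *: repr x).
Lemma quo_scaleE a x : quo_scale a (quo_proj x) = quo_proj (a *: x).
Proof.
apply/quo_projP; rewrite -scalerBr -[_ *: _]addr0; have [S0 SP] := HS.
by apply: SP => //; apply/quo_projP; rewrite quo_projK.
Qed.

Fact quo_scaleA a b (x : quo_type) :
  quo_scale a (quo_scale b x) = quo_scale (a * b) x.
Proof. by rewrite -(quo_projK x) !quo_scaleE scalerA. Qed.
Fact quo_scale1 : left_id 1 quo_scale.
Proof. by move=> x; rewrite -(quo_projK x) quo_scaleE scale1r. Qed.
Fact quo_scaleDr : right_distributive quo_scale +%R.
Proof.
move=> a x y; rewrite -(quo_projK x) -(quo_projK y) -quo_projD !quo_scaleE.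
by rewrite -quo_projD scalerDr.
Qed.
Fact quo_scaleDl (x : quo_type) : {morph quo_scale^~ x : a b / a + b}.
Proof.
by move=> a b; rewrite -(quo_projK x) !quo_scaleE -quo_projD scalerDl.
Qed.
HB.instance Definition _ := GRing.Zmodule_isLmodule.Build A quo_type
  quo_scaleA quo_scale1 quo_scaleDr quo_scaleDl.

Lemma ex_quo : exists (Q : lmodType A) (q : {linear M -> Q}),
  surj q /\ forall x, S x <-> q x = 0.
Proof.
have lin : linear quo_proj.
  by move=> a x y; rewrite quo_projD -quo_scaleE.
exists quo_type, (mkL lin); split=> [y|x].
  by exists (repr y); rewrite mkLE; exact: quo_projK.
rewrite mkLE -[x in S x]subr0 -quo_projP.
by have -> : quo_proj 0 = 0 by exact: (raddf0 \pi_(Quotient.quot (sub_pred HS))%qT).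
Qed.

End Quotient.

End LinearMaps.

Arguments lproj {A M n} k.
Arguments linj {A M n} k.
Arguments linl {A M N}.
Arguments linr {A M N}.
Arguments lfst {A M N}.
Arguments lsnd {A M N}.

(** * Exact sequences and projective modules *)

(** [fin_gen] quantifies over sequences, the linear algebra below over families indexed by ['I_n].
    The size equation is stated so that it can be substituted. *)
Lemma ex_seq (V : Type) n (f : 'I_n -> V) : exists s : seq V,
  n = size s /\ forall x0 (k : 'I_n), nth x0 s k = f k.
Proof.
exists [seq f k | k <- enum 'I_n]; split=> [|x0 k].
  by rewrite size_map size_enum_ord.
rewrite (nth_map k) ?size_enum_ord //; congr f; apply: val_inj.
by rewrite /= nth_enum_ord.
Qed.

Section Homological.
Variable A : pzRingType.
Implicit Types M N P X Y K L : lmodType A.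

Definition ses K X M (i : {linear K -> X}) (p : {linear X -> M}) :=
  [/\ injective i, exact_at i p & surj p].

Lemma ses_surj X M (p : {linear X -> M}) : surj p ->
  exists K (i : {linear K -> X}), ses i p.
Proof.
by move=> sp; have [K [i [inj_i iP]]] := ex_sub (submod_ker p); exists K, i.
Qed.

Lemma ses_inj K X (i : {linear K -> X}) : injective i ->
  exists M (p : {linear X -> M}), ses i p.
Proof.
move=> inj_i; have [M [p [sp pP]]] := ex_quo (submod_im i); exists M, p; split=> // y.
by split=> /pP.
Qed.

Lemma ses0 K X M (i : {linear K -> X}) (p : {linear X -> M}) x :
  ses i p -> p (i x) = 0.
Proof. by case=> _ ex _; apply/ex; exists x. Qed.

Lemma ses_ker K X M (i : {linear K -> X}) (p : {linear X -> M}) x :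
  ses i p -> p x = 0 -> exists y, i y = x.
Proof. by case=> _ ex _ /ex. Qed.

Lemma ses_lift K X M Y (i : {linear K -> X}) (p : {linear X -> M})
    (h : {linear Y -> X}) : ses i p -> (forall y, p (h y) = 0) ->
  exists k : {linear Y -> K}, forall y, i (k y) = h y.
Proof.
by move=> s ph; case: (s) => inj_i _ _; apply: factor_inj => // y; apply: (ses_ker s).
Qed.

Lemma ses_desc K X M N (i : {linear K -> X}) (p : {linear X -> M})
    (h : {linear X -> N}) : ses i p -> (forall x, h (i x) = 0) ->
  exists k : {linear M -> N}, forall x, k (p x) = h x.
Proof.
move=> s hi; case: (s) => _ _ sp; apply: factor_surj => // x /(ses_ker s)[y <-].
exact: hi.
Qed.

(** The kernel of a composite of two surjections is an extension of the kernel of the second map by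
    the kernel of the first. *)
Lemma ses_comp K0 P X K M L (i0 : {linear K0 -> P}) (f : {linear P -> X})
    (i : {linear K -> X}) (p : {linear X -> M}) (l : {linear L -> P}) :
  ses i0 f -> ses i p -> ses l (lcomp p f) ->
  exists (a : {linear K0 -> L}) (b : {linear L -> K}),
    [/\ ses a b, forall x, l (a x) = i0 x & forall x, i (b x) = f (l x)].
Proof.
move=> s0 s sl; have [inj0 _ sf] := s0; have [inj_i _ _] := s; have [inj_l _ _] := sl.
have [x|a la] := ses_lift (h := i0) sl; first by rewrite lE (ses0 _ s0) linear0.
have [x|b ib] := ses_lift (h := lcomp f l) s; first by rewrite lE -(lcompE p) (ses0 _ sl).
have {}ib x : i (b x) = f (l x) by rewrite ib lE.
exists a, b; split=> //; split.
- by move=> x y axy; apply: inj0; rewrite -!la axy.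
- move=> y; split=> [by0|[x <-]].
    have [|x i0x] := ses_ker (x := l y) s0; first by rewrite -ib by0 linear0.
    by exists x; apply: inj_l; rewrite la.
  by apply: inj_i; rewrite ib la (ses0 _ s0) linear0.
- move=> k; have [y fy] := sf (i k).
  have [|x lx] := ses_ker (x := y) sl; first by rewrite lE fy (ses0 _ s).
  by exists x; apply: inj_i; rewrite ib lx.
Qed.

Lemma ses_retract K X M (i : {linear K -> X}) (p : {linear X -> M})
    (s : {linear M -> X}) : ses i p -> cancel s p ->
  exists2 r : {linear X -> K}, cancel i r & forall x, i (r x) = x - s (p x).
Proof.
move=> sip sp.
have [x|r ir] := ses_lift (h := lsub (lid X) (lcomp s p)) sip.
  by rewrite !lE linearB sp subrr.
exists r => x; last by rewrite ir !lE.
case: (sip) => inj_i _ _; apply: inj_i.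
by rewrite ir !lE (ses0 _ sip) linear0 subr0.
Qed.

Lemma ses_section K X M (i : {linear K -> X}) (p : {linear X -> M})
    (r : {linear X -> K}) : ses i p -> cancel i r ->
  exists2 s : {linear M -> X}, cancel s p & forall x, s (p x) = x - i (r x).
Proof.
move=> sip ir.
have [x|s ps] := ses_desc (h := lsub (lid X) (lcomp i r)) sip.
  by rewrite !lE ir subrr.
exists s => x; last by rewrite ps !lE.
case: (sip) => _ _ /(_ x)[y <-].
by rewrite ps !lE linearB (ses0 _ sip) subr0.
Qed.

Lemma split_iso K X M (i : {linear K -> X}) (p : {linear X -> M})
    (r : {linear X -> K}) : ses i p -> cancel i r ->
  iso_modules X (K * M)%type.
Proof.
move=> sip ir; have [s sp sE] := ses_section sip ir.
exists (lpair r p), (lcase i s); split=> [x|[k m]]; rewrite !lE /=.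
  by rewrite sE addrC subrK.
have rs : r (s m) = 0.
  by case: (sip) => _ _ /(_ m)[x <-]; rewrite sE linearB ir subrr.
by rewrite !linearD ir rs sp (ses0 _ sip) add0r addr0.
Qed.

Lemma direct_summand_compl N M : direct_summand N M ->
  exists N', iso_modules M (N * N')%type.
Proof.
move=> [i [p ip]].
have [N' [q s]] : exists N' (q : {linear M -> N'}), ses i q.
  by apply: ses_inj; apply: can_inj ip.
by exists N'; apply: split_iso s ip.
Qed.

Lemma iso_sym M N : iso_modules M N -> iso_modules N M.
Proof. by case=> f [g [fg gf]]; exists g, f. Qed.

Lemma iso_trans M N P : iso_modules M N -> iso_modules N P -> iso_modules M P.
Proof.
move=> [f [g [fg gf]]] [h [k [hk kh]]]; exists (lcomp h f), (lcomp g k).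
by split=> x; rewrite !lE ?hk ?kh ?fg ?gf.
Qed.

Lemma iso_summand M N : iso_modules M N -> direct_summand M N.
Proof. by case=> f [g [fg gf]]; exists f, g. Qed.

Lemma summand_trans M N P :
  direct_summand M N -> direct_summand N P -> direct_summand M P.
Proof.
move=> [f [g fg]] [h [k hk]]; exists (lcomp h f), (lcomp g k).
by move=> x; rewrite !lE hk fg.
Qed.

Lemma summandl M N : direct_summand M (M * N)%type.
Proof. by exists linl, lfst => x; rewrite !lE. Qed.
Lemma summandr M N : direct_summand N (M * N)%type.
Proof. by exists linr, lsnd => x; rewrite !lE. Qed.

Definition zmod0 : lmodType A := {ffun 'I_0 -> A^o}.
Lemma zmod0P (x : zmod0) : x = 0.
Proof. by apply/ffunP=> -[]. Qed.

Lemma iso_zero M N : zero_module M -> zero_module N -> iso_modules M N.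
Proof.
move=> M0 N0; exists (lzero _ _), (lzero _ _).
by split=> x; rewrite lE ?(M0 x) ?(N0 x).
Qed.

Lemma zero_ffun0 M : zero_module {ffun 'I_0 -> M}.
Proof. by move=> x; apply/ffunP=> -[]. Qed.

Lemma ses_lid M : ses (lzero zmod0 M) (lid M).
Proof.
split=> [x y _|y|y]; first by rewrite (zmod0P x) (zmod0P y).
  by rewrite lE; split=> [->|[x <-]]; [exists 0|]; rewrite lE.
by exists y; rewrite lE.
Qed.

Lemma iso_prod0 M : iso_modules M (M * zmod0)%type.
Proof.
exists linl, lfst; split=> [x|[x z]]; rewrite !lE //.
by rewrite (zmod0P z).
Qed.

Lemma iso_refl M : iso_modules M M.
Proof. by exists (lid M), (lid M); split=> x; rewrite !lE. Qed.

Lemma iso_prod M N M' N' : iso_modules M N -> iso_modules M' N' ->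
  iso_modules (M * M')%type (N * N')%type.
Proof.
move=> [f [g [fg gf]]] [h [k [hk kh]]]; exists (lprod f h), (lprod g k).
by split=> -[x y]; rewrite !lE /= ?fg ?gf ?hk ?kh.
Qed.

Lemma summand_prod M N M' N' : direct_summand M N -> direct_summand M' N' ->
  direct_summand (M * M')%type (N * N')%type.
Proof.
move=> [f [g fg]] [h [k hk]]; exists (lprod f h), (lprod g k).
by move=> -[x y]; rewrite !lE /= ?fg ?hk.
Qed.

Lemma proj_summand N M : direct_summand N M -> projective M -> projective N.
Proof.
move=> [i [p ip]] pM X Y g f sg; have [h gh] := pM _ _ g (lcomp f p) sg.
by exists (lcomp h i) => x; rewrite lE gh lE ip.
Qed.

Lemma proj_iso N M : iso_modules N M -> projective M -> projective N.
Proof. by move=> /iso_summand; apply: proj_summand. Qed.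

Lemma proj_prod M N : projective M -> projective N -> projective (M * N)%type.
Proof.
move=> pM pN X Y g f sg.
have [h gh] := pM _ _ g (lcomp f linl) sg.
have [k gk] := pN _ _ g (lcomp f linr) sg.
exists (lcase h k) => -[x y]; rewrite lcaseE linearD gh gk !lE -linearD.
by rewrite /GRing.add /= /add_pair /= addr0 add0r.
Qed.

Lemma proj_ffun n M : projective M -> projective {ffun 'I_n -> M}.
Proof.
move=> pM X Y g f sg.
have /choice[h hE] k : exists h : {linear M -> X},
    forall x, g (h x) = f (linj k x).
  by have [h gh] := pM _ _ g (lcomp f (linj k)) sg; exists h => x; rewrite gh lE.
exists (lsum h) => x; rewrite lsumE linear_sum /=.
rewrite [in RHS](linj_proj x) linear_sum; apply: eq_bigr => k _; exact: hE.
Qed.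

Fact lmul_subproof M (x : M) : linear (fun a : A^o => (a : A) *: x).
Proof. by move=> a b c; rewrite scalerDl scalerA. Qed.
Definition lmul M (x : M) : {linear A^o -> M} := mkL (lmul_subproof x).
Lemma lmulE M (x : M) a : lmul x a = (a : A) *: x.
Proof. exact: mkLE. Qed.

Lemma lmul_ext M (f : {linear A^o -> M}) a : f a = (a : A) *: f 1.
Proof.
rewrite -linearZ; congr (f _); rewrite /GRing.scale /=.
by rewrite mulr1.
Qed.

Lemma proj_reg : projective (A^o : lmodType A).
Proof.
move=> X Y g f sg; have [x gx] := sg (f 1).
by exists (lmul x) => a; rewrite lmulE linearZ gx [RHS]lmul_ext.
Qed.

Lemma proj_free n : projective {ffun 'I_n -> A^o}.
Proof. by apply: proj_ffun; apply: proj_reg. Qed.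

Lemma proj0 : projective zmod0.
Proof. exact: proj_free. Qed.

Lemma fin_genP M : fin_gen M <->
  exists n (p : {linear {ffun 'I_n -> A^o} -> M}), surj p.
Proof.
split=> [[s sP]|[n [p sp]]].
  exists (size s), (comb (fun k => s`_k)) => y; have [c ->] := sP y.
  by exists [ffun k => c k]; rewrite combE; apply: eq_bigr => k _; rewrite ffunE.
have [s [ns sE]] := ex_seq (fun k => p (fbase A k)); exists s => y.
have [x <-] := sp y; subst n; exists (fun k => x k); rewrite free_comb.
by apply: eq_bigr => k _; rewrite sE.
Qed.

Lemma fg_ses M : fin_gen M -> exists n K (i : {linear K -> {ffun 'I_n -> A^o}})
  (p : {linear {ffun 'I_n -> A^o} -> M}), ses i p.
Proof.
move=> /fin_genP[n [p sp]]; have [K [i s]] := ses_surj sp.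
by exists n, K, i, p.
Qed.

Lemma fg_surj M N (p : {linear M -> N}) : surj p -> fin_gen M -> fin_gen N.
Proof.
move=> sp /fin_genP[n [q sq]]; apply/fin_genP; exists n, (lcomp p q) => y.
by have [x <-] := sp y; have [z <-] := sq x; exists z; rewrite lE.
Qed.

Lemma fg_free n : fin_gen {ffun 'I_n -> A^o}.
Proof. by apply/fin_genP; exists n, (lid _) => y; exists y; rewrite lE. Qed.

Lemma fg_iso M N : iso_modules M N -> fin_gen M -> fin_gen N.
Proof.
case=> f [g [_ gf]]; apply: (@fg_surj _ _ f) => y; exists (g y).
exact: gf.
Qed.

Lemma fg_reg : fin_gen (A^o : lmodType A).
Proof.
apply: (@fg_surj {ffun 'I_1 -> A^o} _ (lproj ord0) _ (fg_free 1)) => y.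
by exists [ffun=> y]; rewrite lprojE ffunE.
Qed.

Lemma fg_summand M N : direct_summand M N -> fin_gen N -> fin_gen M.
Proof. by case=> f [g fg]; apply: (@fg_surj _ _ g) => y; exists (f y). Qed.

(** Recognizes an n-th power by its biproduct identities; this is how the additive functors [DX] and
    [FF] are seen to commute with finite powers. *)
Lemma ffun_biprod n X M (u : 'I_n -> {linear M -> X}) (v : 'I_n -> {linear X -> M}) :
  (forall k l x, v k (u l x) = if k == l then x else 0) ->
  (forall x, \sum_k u k (v k x) = x) -> iso_modules X {ffun 'I_n -> M}.
Proof.
move=> vu uv; exists (ltuple v), (lsum u); split=> x.
  by rewrite lsumE -[RHS]uv; apply: eq_bigr => k _; rewrite ltupleE.
apply/ffunP=> k; rewrite ltupleE lsumE linear_sum (bigD1 k) //= vu eqxx.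
by rewrite big1 ?addr0 // => l /negPf lk; rewrite vu eq_sym lk.
Qed.

Lemma ffunD_iso m n M :
  iso_modules ({ffun 'I_m -> M} * {ffun 'I_n -> M})%type {ffun 'I_(m + n) -> M}.
Proof.
exists (ltuple (fun k => match split k with
    | inl l => lcomp (lproj l) lfst | inr l => lcomp (lproj l) lsnd end)).
exists (lpair (ltuple (fun k => lproj (lshift n k)))
              (ltuple (fun k => lproj (rshift m k)))); split=> [[x y]|x].
  rewrite lpairE; congr (_, _); apply/ffunP=> k; rewrite ltupleE lprojE ltupleE.
    by rewrite (unsplitK (inl k : 'I_m + 'I_n)) lE lprojE lE.
  by rewrite (unsplitK (inr k : 'I_m + 'I_n)) lE lprojE lE.
apply/ffunP=> k; rewrite ltupleE -[in RHS](splitK k) lpairE.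
by case: (split k) => l; rewrite !lE lprojE ltupleE lprojE.
Qed.

Lemma ffunS_iso n M :
  iso_modules (M * {ffun 'I_n -> M})%type {ffun 'I_n.+1 -> M}.
Proof.
apply: iso_trans (ffunD_iso 1 n M); apply: iso_prod (iso_refl _).
apply: (@ffun_biprod _ _ _ (fun=> lid M) (fun=> lid M)) => [k l x|x].
  by rewrite !lE !ord1.
by rewrite big_ord1 !lE.
Qed.

Lemma fg_ext K X M (i : {linear K -> X}) (p : {linear X -> M}) : ses i p ->
  fin_gen K -> fin_gen M -> fin_gen X.
Proof.
move=> sip /fin_genP[m [a sa]] /fin_genP[n [b sb]]; have [_ _ sp] := sip.
have [b' pb'] := @proj_free n _ _ p b sp.
have s2 : surj (lcase (lcomp i a) b').
  move=> y; have [z bz] := sb (p y).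
  have [|k ik] := ses_ker (x := y - b' z) sip.
    by rewrite linearB pb' bz subrr.
  by have [w aw] := sa k; exists (w, z); rewrite !lE /= aw ik subrK.
exact: fg_surj s2 (fg_iso (iso_sym (ffunD_iso m n _)) (fg_free _)).
Qed.

Lemma ses_prod M N : ses (@linl A M N) lsnd.
Proof.
split=> [x y|y|y]; last by exists (0, y); rewrite lE.
  by rewrite !lE => -[].
split=> [y2|[x <-]]; last by rewrite !lE.
exists y.1; by case: y y2 => a b; rewrite !lE /= => ->.
Qed.

Lemma fg_prod M N : fin_gen M -> fin_gen N -> fin_gen (M * N)%type.
Proof. exact/fg_ext/ses_prod. Qed.

Lemma fg_ffun n M : fin_gen M -> fin_gen {ffun 'I_n -> M}.
Proof.
move=> fM; elim: n => [|n IH].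
  apply: (@fg_surj zmod0 _ (lzero _ _)); last exact: fg_free.
  by move=> y; exists 0; apply/ffunP=> -[].
exact: fg_iso (ffunS_iso n M) (fg_prod fM IH).
Qed.

Lemma proj_section X M (p : {linear X -> M}) : projective M -> surj p ->
  exists s : {linear M -> X}, cancel s p.
Proof. by move=> pM sp; have [s ps] := pM _ _ p (lid M) sp; exists s => x; rewrite ps lE. Qed.

Lemma fg_proj_free M : fin_gen M -> projective M ->
  exists n, direct_summand M {ffun 'I_n -> A^o}.
Proof.
move=> /fin_genP[n [p sp]] pM; have [s ps] := proj_section pM sp.
by exists n, s, p.
Qed.

End Homological.
Arguments zmod0 A : clear implicits.

Arguments proj_free {A} n.
Arguments proj_reg {A}.
Arguments proj0 {A}.

(** * Vanishing of Ext and projective dimension *)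

Section ExtDim.
Variable A : pzRingType.
Implicit Types M N P Q X Y Z E K L R : lmodType A.

(* Ext^1(M, N) = 0, as an extension property. *)
Definition E1 M N := forall K X (i : {linear K -> X}) (p : {linear X -> M}),
  ses i p -> forall f : {linear K -> N},
  exists g : {linear X -> N}, forall x, g (i x) = f x.

(** One projective presentation suffices: lifting [p] to another extension [X] of [M] makes [X] a
    quotient of [K' * P], and there [f] agrees with an extension of [f \o v] to [P]. *)
Lemma E1_pres K P M N (i : {linear K -> P}) (p : {linear P -> M}) :
  projective P -> ses i p ->
  (forall f : {linear K -> N}, exists g : {linear P -> N},
     forall x, g (i x) = f x) -> E1 M N.
Proof.
move=> pP s ext K' X j q s' f; have [inj_j _ sq] := s'.
have [u qu] := pP _ _ q p sq.
have [x|v jv] := ses_lift (h := lcomp u i) s'; first by rewrite lE qu (ses0 _ s).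
have [g gE] := ext (lcomp f v).
have sju : surj (lcase j u).
  move=> y; have [_ _ sp] := s; have [x px] := sp (q y).
  have [|k jk] := ses_ker (x := y - u x) s'; first by rewrite linearB qu px subrr.
  by exists (k, x); rewrite !lE /= jk subrK.
have [|h hE] := factor_surj (h := lcase f g) sju.
  move=> [k x]; rewrite !lE /= => jkx.
  have /(ses_ker s)[y iy] : p x = 0.
    by have := congr1 q jkx; rewrite linearD (ses0 _ s') add0r linear0 qu.
  have -> : k = - v y.
    apply: inj_j; rewrite linearN jv lE iy; by apply/eqP; rewrite -addr_eq0 jkx.
  by rewrite -iy gE lE linearN addNr.
by exists h => x; have := hE (x, 0); rewrite !lE /= !linear0 !addr0.
Qed.

Lemma E1_proj M N : projective M -> E1 M N.
Proof.
move=> pM K X i p sip f; have [_ _ sp] := sip.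
have [s ps] := proj_section pM sp; have [r ir _] := ses_retract sip ps.
by exists (lcomp f r) => x; rewrite lE ir.
Qed.

Lemma E1_split K X M (i : {linear K -> X}) (p : {linear X -> M}) :
  E1 M K -> ses i p -> exists r : {linear X -> K}, cancel i r.
Proof.
by move=> e sip; have [r rE] := e _ _ _ _ sip (lid K); exists r => x; rewrite rE lE.
Qed.

Lemma pullback X Y N (b : {linear X -> N}) (f : {linear Y -> N}) :
  exists E (e1 : {linear E -> X}) (e2 : {linear E -> Y}),
  [/\ forall z, b (e1 z) = f (e2 z),
      forall x y, b x = f y -> exists2 z, e1 z = x & e2 z = y
    & forall z, e1 z = 0 -> e2 z = 0 -> z = 0].
Proof.
have HS : submodP (fun z : (X * Y)%type => b z.1 = f z.2).
  by split=> [|a x y /= ex ey]; rewrite /= ?linear0 // !linearP ex ey.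
have [E [d [inj_d dP]]] := ex_sub HS.
exists E, (lcomp lfst d), (lcomp lsnd d); split=> [z|x y bf|z].
- by rewrite !lE; apply/dP; exists z.
- have /dP[z dz] : b (x, y).1 = f (x, y).2 by [].
  by exists z; rewrite !lE dz.
- rewrite !lE => z1 z2; apply: inj_d; rewrite linear0.
  by case: (d z) z1 z2 => u v /= -> ->.
Qed.

Lemma pull_ses K X Y N E (a : {linear K -> X}) (b : {linear X -> N})
    (f : {linear Y -> N}) (e1 : {linear E -> X}) (e2 : {linear E -> Y}) :
  (forall z, b (e1 z) = f (e2 z)) ->
  (forall x y, b x = f y -> exists2 z, e1 z = x & e2 z = y) ->
  (forall z, e1 z = 0 -> e2 z = 0 -> z = 0) -> ses a b ->
  exists2 c : {linear K -> E}, ses c e2 & forall x, e1 (c x) = a x.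
Proof.
move=> be eE e0 s; have [inj_a _ sb] := s.
have inj_e : injective (lpair e1 e2).
  by apply: lin_inj => z; rewrite lE => -[]; apply: e0.
have [x|c cE] := factor_inj (h := lpair a (lzero K Y)) inj_e.
  have [|z z1 z2] := eE (a x) 0; first by rewrite (ses0 _ s) linear0.
  by exists z; rewrite !lE z1 z2.
have c1 x : e1 (c x) = a x by have := cE x; rewrite !lE => -[].
have c2 x : e2 (c x) = 0 by have := cE x; rewrite !lE => -[].
exists c => //; split=> [x y cxy|z|y].
- by apply: inj_a; rewrite -!c1 cxy.
- split=> [z2|[x <-] //].
  have [|x ax] := ses_ker (x := e1 z) s; first by rewrite be z2 linear0.
  by exists x; apply: inj_e; rewrite !lE c1 c2 ax z2.
- by have [x bx] := sb (f y); have [z _ <-] := eE _ _ bx; exists z.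
Qed.

(** Pulling the sequence back along [f] gives an extension of [K] by [N]. It splits, and the section
    followed by the map to [X] is the lift. *)
Lemma E1_lift N X N' K (a : {linear N -> X}) (b : {linear X -> N'})
    (f : {linear K -> N'}) : E1 K N -> ses a b ->
  exists g : {linear K -> X}, forall x, b (g x) = f x.
Proof.
move=> e sab; have [E [e1 [e2 [be eE e0]]]] := pullback b f.
have [c sec _] := pull_ses be eE e0 sab.
have [r rc] := E1_split e sec; have [s sE' _] := ses_section sec rc.
by exists (lcomp e1 s) => x; rewrite lE be sE'.
Qed.

(** [E] is the quotient of [X * P] by the image of [(c, - i)]; pushing out along [c] keeps the
    cokernel [Z]. *)
Lemma pushout L P Z X (i : {linear L -> P}) (p : {linear P -> Z})
    (c : {linear L -> X}) : ses i p ->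
  exists E (a : {linear X -> E}) (b : {linear P -> E}) (q : {linear E -> Z}),
  [/\ ses a q, forall l, a (c l) = b (i l), forall y, q (b y) = p y,
      forall z, exists x y, z = a x + b y
    & forall N (u : {linear X -> N}) (v : {linear P -> N}),
        (forall l, u (c l) = v (i l)) -> exists w : {linear E -> N},
        (forall x, w (a x) = u x) /\ (forall y, w (b y) = v y)].
Proof.
move=> s; have [inj_i _ sp] := s.
have [|E [q sq]] := @ses_inj _ _ _ (lpair c (lsub (lzero _ _) i)).
  by apply: lin_inj => l; rewrite !lE sub0r => -[_ /eqP]; rewrite oppr_eq0 => /eqP il;
     apply: inj_i; rewrite il linear0.
have [_ _ surj_q] := sq.
have qE x y : q (x, y) = lcomp q linl x + lcomp q linr y.
  by rewrite !lE -linearD; congr (q _); rewrite /GRing.add /= /add_pair /= addr0 add0r.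
have univ N (u : {linear X -> N}) (v : {linear P -> N}) :
    (forall l, u (c l) = v (i l)) -> exists w : {linear E -> N},
    (forall x, w (lcomp q linl x) = u x) /\ (forall y, w (lcomp q linr y) = v y).
  move=> uv; have [l|w wE] := ses_desc (h := lcase u v) sq.
    by rewrite !lE /= sub0r linearN uv subrr.
  by exists w; split=> x; rewrite lcompE wE !lE /= linear0 ?addr0 ?add0r.
have [l|q' [q'a q'b]] := univ _ (lzero X Z) p; first by rewrite lE (ses0 _ s).
have ab l : lcomp q linl (c l) = lcomp q linr (i l).
  apply/eqP; rewrite -subr_eq0 -linearN -qE; apply/eqP.
  by rewrite -[RHS](ses0 l sq) !lE sub0r.
have gen z : exists x y, z = lcomp q linl x + lcomp q linr y.
  by have [[x y] <-] := surj_q z; exists x, y.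
exists E, (lcomp q linl), (lcomp q linr), q'; split=> //; split=> [|z|y].
- apply: lin_inj => x; rewrite !lE => /(ses_ker sq)[l].
  rewrite !lE sub0r => -[<- /eqP]; rewrite oppr_eq0 => /eqP il.
  suff -> : l = 0 by rewrite linear0.
  by apply: inj_i; rewrite il linear0.
- split=> [|[x <-]]; last by rewrite q'a lE.
  have [x [y ->]] := gen z; rewrite linearD q'a q'b lE add0r => /(ses_ker s)[l <-].
  by exists (x + c l); rewrite linearD ab.
- by have [x <-] := sp y; exists (lcomp q linr x).
Qed.

Lemma E1_ext K P M N' N N'' (i : {linear K -> P}) (p : {linear P -> M})
    (a : {linear N' -> N}) (b : {linear N -> N''}) :
  projective P -> ses i p -> ses a b -> E1 M N' -> E1 M N'' -> E1 M N.
Proof.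
move=> pP sip sab e' e''; apply: (E1_pres pP sip) => f.
have [g'' g''E] := e'' _ _ _ _ sip (lcomp b f).
have [_ _ sb] := sab; have [g bg] := pP _ _ b g'' sb.
have [x|h ah] := ses_lift (h := lsub f (lcomp g i)) sab.
  by rewrite !lE linearB bg g''E !lE subrr.
have [k kE] := e' _ _ _ _ sip h.
by exists (ladd (lcomp a k) g) => x; rewrite !lE kE ah !lE subrK.
Qed.

(** Dimension shift in both variables: in the long exact sequence Ext^1(M, N'') lies between
    Ext^1(M, X) and Ext^2(M, N) = Ext^1(K, N). *)
Lemma E1_shift K P M N X N'' (i : {linear K -> P}) (p : {linear P -> M})
    (a : {linear N -> X}) (b : {linear X -> N''}) :
  projective P -> ses i p -> ses a b -> E1 M X -> E1 K N -> E1 M N''.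
Proof.
move=> pP sip sab eX eN; apply: (E1_pres pP sip) => f.
have [f' bf'] := E1_lift f eN sab.
have [g gE] := eX _ _ _ _ sip f'.
by exists (lcomp b g) => x; rewrite lE gE bf'.
Qed.

Lemma E1_summand M X N : direct_summand M X -> E1 X N -> E1 M N.
Proof.
move=> [t [r tr]] e K Y i p sip f.
have [E [e1 [e2 [be eE e0]]]] := pullback p r.
have [c sec c1] := pull_ses be eE e0 sip; have [g gE] := e _ _ _ _ sec f.
have [|y|w wE] := factor_inj (h := lpair (lid Y) (lcomp t p)) (i := lpair e1 e2).
- by apply: lin_inj => z; rewrite lE => -[]; apply: e0.
- by have [|z z1 z2] := eE y (t (p y)); rewrite ?tr //; exists z; rewrite !lE z1 z2.
exists (lcomp g w) => x; rewrite lE -gE; congr (g _); apply/subr0_eq/e0.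
  have := wE (i x); rewrite !lE => -[e1w _].
  by rewrite linearB e1w c1 subrr.
have := wE (i x); rewrite !lE => -[_ e2w].
by rewrite linearB e2w (ses0 _ sip) linear0 (ses0 _ sec) subr0.
Qed.

Lemma E1_summand2 M N N' : direct_summand N N' -> E1 M N' -> E1 M N.
Proof.
move=> [t [r tr]] e K X i p s f; have [g gE] := e _ _ _ _ s (lcomp t f).
by exists (lcomp r g) => x; rewrite !lE gE lE tr.
Qed.

Lemma E1_prod2 M N N' : E1 M N -> E1 M N' -> E1 M (N * N')%type.
Proof.
move=> e e' K X i p s f; have [g gE] := e _ _ _ _ s (lcomp lfst f).
have [g' g'E] := e' _ _ _ _ s (lcomp lsnd f); exists (lpair g g') => x.
by rewrite lE gE g'E !lE -surjective_pairing.
Qed.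

Lemma E1_ffun n M N : E1 M N -> E1 M {ffun 'I_n -> N}.
Proof.
move=> e K X i p s f; have /choice[g gE] k : exists g : {linear X -> N},
    forall x, g (i x) = f x k.
  have [g gE] := e _ _ _ _ s (lcomp (lproj k) f); exists g => x.
  by rewrite gE lE lprojE.
by exists (ltuple g) => x; apply/ffunP=> k; rewrite ltupleE gE.
Qed.

(** Stable isomorphism. By [schanuel] it is the precision up to which a syzygy is determined; [R]
    and [R'] may be infinitely generated. *)
Definition stab M M' := exists R R',
  [/\ projective R, projective R' & iso_modules (M * R)%type (M' * R')%type].

Lemma stab_iso M M' : iso_modules M M' -> stab M M'.
Proof.
move=> h; exists (zmod0 A), (zmod0 A); split; try exact: proj0.
exact/iso_prod/iso_refl.
Qed.

Lemma stab_sym M M' : stab M M' -> stab M' M.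
Proof. by case=> R [R' [pR pR' /iso_sym h]]; exists R', R. Qed.

Lemma stab_summand M M' : stab M M' -> exists2 R', projective R' &
  direct_summand M (M' * R')%type.
Proof.
case=> R [R' [_ pR' h]]; exists R' => //.
exact: summand_trans (summandl _ _) (iso_summand h).
Qed.

(** Schanuel's lemma with explicit maps: (k, y) goes to x = i k + b y in [P], paired with the
    element of [K'] that measures the error y - a x. The inverse has the same form with the two
    presentations exchanged. *)
Lemma schanuel_same K P K' P' X (i : {linear K -> P}) (p : {linear P -> X})
    (i' : {linear K' -> P'}) (p' : {linear P' -> X}) :
  projective P -> projective P' -> ses i p -> ses i' p' ->
  iso_modules (K * P')%type (K' * P)%type.
Proof.
move=> pP pP' s s'; have [inj_i _ sp] := s; have [inj_i' _ sp'] := s'.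
have [a aE] := pP _ _ p' p sp'; have [b bE] := pP' _ _ p p' sp.
pose u : {linear (K * P')%type -> P} := lcase i b.
pose u' : {linear (K' * P)%type -> P'} := lcase i' a.
have pu z : p (u z) = p' z.2 by rewrite lcaseE linearD (ses0 _ s) add0r bE.
have pu' z : p' (u' z) = p z.2 by rewrite lcaseE linearD (ses0 _ s') add0r aE.
have [z|k kE] := ses_lift (h := lsub lsnd (lcomp a u)) s'.
  by rewrite lsubE linearB lsndE lcompE aE pu subrr.
have [z|k' kE'] := ses_lift (h := lsub lsnd (lcomp b u')) s.
  by rewrite lsubE linearB lsndE lcompE bE pu' subrr.
have {}kE z : i' (k z) = z.2 - a (u z) by rewrite kE lsubE lsndE lcompE.
have {}kE' z : i (k' z) = z.2 - b (u' z) by rewrite kE' lsubE lsndE lcompE.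
exists (lpair k u), (lpair k' u'); split=> z; rewrite !lpairE.
  have uE : u' (k z, u z) = z.2 by rewrite lcaseE kE subrK.
  rewrite uE [RHS]surjective_pairing; congr (_, _).
  by apply: inj_i; rewrite kE' uE lcaseE /= addrK.
have uE : u (k' z, u' z) = z.2 by rewrite lcaseE kE' subrK.
rewrite uE [RHS]surjective_pairing; congr (_, _).
by apply: inj_i'; rewrite kE uE lcaseE /= addrK.
Qed.

Lemma ses_iso K X M M' (i : {linear K -> X}) (p : {linear X -> M})
    (f : {linear M -> M'}) (g : {linear M' -> M}) :
  cancel f g -> cancel g f -> ses i p -> ses i (lcomp f p).
Proof.
move=> fg gf [inj_i ex sp]; split=> // [y|y].
  rewrite lE -ex; split=> [fp|->]; last exact: linear0.
  by apply: (can_inj fg); rewrite fp linear0.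
by have [x px] := sp (g y); exists x; rewrite lE px.
Qed.

Lemma ses_prodr K X M R (i : {linear K -> X}) (p : {linear X -> M}) :
  ses i p -> ses (lcomp linl i : {linear K -> (X * R)%type}) (lprod p (lid R)).
Proof.
move=> [inj_i ex sp]; split=> [x y|[y r]|[m r]].
- by rewrite !lE => -[/inj_i].
- rewrite !lE /=; split=> [[/ex[x <-] ->]|[x]]; first by exists x; rewrite !lE.
  by rewrite !lE => -[<- <-]; congr (_, _); apply/ex; exists x.
- by have [x px] := sp m; exists (x, r); rewrite !lE /= px.
Qed.

Lemma E1_stab M M' N : fin_gen M' -> stab M M' -> E1 M' N -> E1 M N.
Proof.
move=> fM' /stab_summand[R pR h] e; apply: E1_summand h _.
have [n [K [i [p s]]]] := fg_ses fM'.
apply: (E1_pres (proj_prod (proj_free n) pR) (ses_prodr R s)) => f.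
have [g gE] := e _ _ _ _ s f; exists (lcomp g lfst) => x.
by rewrite !lE gE.
Qed.

Lemma schanuel K P M K' P' M' (i : {linear K -> P}) (p : {linear P -> M})
    (i' : {linear K' -> P'}) (p' : {linear P' -> M'}) : stab M M' ->
  projective P -> projective P' -> ses i p -> ses i' p' -> stab K K'.
Proof.
move=> [R [R' [pR pR' [f [g [fg gf]]]]]] pP pP' s s'.
have s1 := ses_iso fg gf (ses_prodr R s); have s2 := ses_prodr R' s'.
exists (P' * R')%type, (P * R)%type; split; try exact: proj_prod.
apply: schanuel_same s1 s2; exact: proj_prod.
Qed.

(** The recursive form of [pd_le], to which it is equivalent ([pd_le_PD], [PD_pd_le]). Neither [P]
    nor [K] need be finitely generated. *)
Fixpoint PD n M : Prop :=
  if n is m.+1 then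
    exists P K (i : {linear K -> P}) (p : {linear P -> M}),
      [/\ projective P, ses i p & PD m K]
  else projective M.

Lemma PDS K P M (i : {linear K -> P}) (p : {linear P -> M}) n :
  projective P -> ses i p -> PD n K -> PD n.+1 M.
Proof. by move=> pP s pK; exists P, K, i, p. Qed.

Lemma PD_mono n M : PD n M -> PD n.+1 M.
Proof.
elim: n M => [|n IH] M /= => [pM|[P [K [i [p [pP s pK]]]]]].
  by exists M, (zmod0 A), (lzero _ _), (lid _); split; [|exact: ses_lid|exact: proj0].
by exists P, K, i, p; split=> //; apply: IH.
Qed.

Lemma PD_le m n M : (m <= n)%N -> PD m M -> PD n M.
Proof.
move=> /subnK <-; elim: (n - m)%N => // k IH pM.
by rewrite addSn; apply/PD_mono/IH.
Qed.

(** In the step [P * R] covers [M' * R'], hence [M']. The new syzygy is an extension of the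
    projective [R'] by [K], so it is [K * R']. *)
Lemma PD_stab n M M' : stab M M' -> PD n M -> PD n M'.
Proof.
elim: n M M' => [|n IH] M M' st /=.
  move=> pM; have [R pR h] := stab_summand (stab_sym st).
  exact: proj_summand h (proj_prod pM pR).
move=> [P [K [i [p [pP s pK]]]]]; have [R [R' [pR pR' [f [g [fg gf]]]]]] := st.
have s1 := ses_iso fg gf (ses_prodr R s).
have s2 : ses (@linr A M' R') lfst.
  split=> [x y|y|y]; last by exists (y, 0); rewrite lE.
    by rewrite !lE => -[].
  rewrite lE; split=> [y1|[x <-]]; last by rewrite lE.
  by exists y.2; rewrite lE; case: y y1 => u v /= ->.
have [|L [l sl]] := @ses_surj _ _ _ (lcomp lfst (lcomp f (lprod p (lid R)))).
  move=> y; have [_ _ sf] := s1; have [x fx] := sf (y, 0).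
  by exists x; rewrite lE fx lE.
have [a [b [sab _ _]]] := ses_comp s1 s2 sl.
exists (P * R)%type, L, l, (lcomp lfst (lcomp f (lprod p (lid R)))).
split=> //; first exact: proj_prod.
apply: IH pK; exists R', (zmod0 A); split=> //; first exact: proj0.
apply: iso_trans (iso_prod0 L); apply: iso_sym.
have [t bt] := proj_section pR' (let: And3 _ _ h := sab in h).
have [r ar _] := ses_retract sab bt.
exact: split_iso sab ar.
Qed.

Lemma PD_iso n M M' : iso_modules M M' -> PD n M -> PD n M'.
Proof. by move=> /stab_iso; apply: PD_stab. Qed.

(** The truncated predecessor is right for [n] = 0 too: the sequence then splits and [K] is
    projective. *)
Lemma PD_ker n K P M (i : {linear K -> P}) (p : {linear P -> M}) :
  projective P -> ses i p -> PD n M -> PD n.-1 K.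
Proof.
case: n => [|n] pP s /=.
  move=> pM; have [t pt] := proj_section pM (let: And3 _ _ h := s in h).
  have [r ir _] := ses_retract s pt; apply: proj_summand pP.
  by exists i, r.
move=> [P' [K' [i' [p' [pP' s' pK']]]]]; apply: PD_stab pK'.
exact: schanuel (stab_iso (iso_refl M)) pP' pP s' s.
Qed.

(** Horseshoe lemma: [P1 * P2] covers [X], and its kernel is an extension of the syzygy [K2] by the
    syzygy [K1]. *)
Lemma PD_ext n K X M (i : {linear K -> X}) (p : {linear X -> M}) :
  ses i p -> PD n K -> PD n M -> PD n X.
Proof.
elim: n K X M i p => [|n IH] K X M i p s /=.
  move=> pK pM; have [t pt] := proj_section pM (let: And3 _ _ h := s in h).
  have [r ir _] := ses_retract s pt; apply: proj_iso (split_iso s ir) _.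
  exact: proj_prod.
move=> [P1 [K1 [i1 [p1 [pP1 s1 pK1]]]]] [P2 [K2 [i2 [p2 [pP2 s2 pK2]]]]].
have [inj_i _ sp] := s; have [u pu] := pP2 _ _ p p2 sp.
have [_ _ sp1] := s1; have [_ _ sp2] := s2.
pose q := lcase (lcomp i p1) u.
have [|L [l sl]] := @ses_surj _ _ _ q.
  move=> y; have [x2 px2] := sp2 (p y).
  have [|k ik] := ses_ker (x := y - u x2) s; first by rewrite linearB pu px2 subrr.
  by have [x1 px1] := sp1 k; exists (x1, x2); rewrite !lE /= px1 ik subrK.
have [inj_l _ _] := sl; have [inj1 _ _] := s1; have [inj2 _ _] := s2.
have lE0 z : i (p1 (l z).1) + u (l z).2 = 0 by have := ses0 z sl; rewrite !lE.
have [x|a la] := ses_lift (h := lcomp linl i1) sl.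
  by rewrite !lE /= (ses0 _ s1) !linear0 addr0.
have [z|b ib] := ses_lift (h := lcomp lsnd l) s2.
  by have := congr1 p (lE0 z); rewrite !lE linearD (ses0 _ s) add0r pu linear0.
exists (P1 * P2)%type, L, l, q; split=> //; first exact: proj_prod.
apply: (IH _ _ _ a b _ pK1 pK2); split=> [x y axy|y|z].
- have /(congr1 fst) : l (a x) = l (a y) by rewrite axy.
  by rewrite !la !lE => /= /inj1.
- split=> [by0|[x <-]]; last by apply: inj2; rewrite ib !lE la !lE linear0.
  have l2 : (l y).2 = 0 by have := ib y; rewrite !lE by0 linear0.
  have [|x i1x] := ses_ker (x := (l y).1) s1.
    by apply: inj_i; have := lE0 y; rewrite l2 !linear0 addr0.
  by exists x; apply: inj_l; rewrite la !lE i1x -l2 -surjective_pairing.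
- have [|k ik] := ses_ker (x := - u (i2 z)) s.
    by rewrite linearN pu (ses0 _ s2) oppr0.
  have [x1 px1] := sp1 k; have [|y ly] := ses_ker (x := (x1, i2 z)) sl.
    by rewrite !lE /= px1 ik addNr.
  by exists y; apply: inj2; rewrite ib !lE ly.
Qed.

Lemma PD_quot n K X M (i : {linear K -> X}) (p : {linear X -> M}) :
  ses i p -> PD n K -> PD n X -> PD n.+1 M.
Proof.
move=> s pK /PD_mono[P [K0 [i0 [p0 [pP s0 pK0]]]]].
have [|L [l sl]] := @ses_surj _ _ _ (lcomp p p0).
  move=> y; have [_ _ sp] := s; have [_ _ sp0] := s0.
  by have [x <-] := sp y; have [z <-] := sp0 x; exists z; rewrite lE.
have [a [b [sab _ _]]] := ses_comp s0 s sl.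
by apply: PDS pP sl _; apply: PD_ext sab pK0 pK.
Qed.

(** Let [L] be a syzygy of [M] inside a projective [P]. Lifting [P -> M] to [X] makes [K * P] an
    extension of [X] by [L], and both ends have dimension at most [n]. *)
Lemma PD_sub n K X M (i : {linear K -> X}) (p : {linear X -> M}) :
  ses i p -> PD n X -> PD n M -> PD n K.
Proof.
move=> s pX /PD_mono[P [L [l [q [pP sl pL]]]]].
have [inj_i _ sp] := s; have [inj_l _ sq] := sl; have [u pu] := pP _ _ p q sp.
have [x|c ic] := ses_lift (h := lcomp u l) s; first by rewrite lE pu (ses0 _ sl).
have s1 : ses (lpair (lsub (lzero _ _) c) l) (lcase i u).
  split=> [x y|[k x]|y].
  - by rewrite !lE => -[_ /inj_l].
  - rewrite !lE /=; split=> [e|[z]]; last first.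
      by rewrite !lE => -[<- <-]; rewrite linearB linear0 sub0r ic lE addNr.
    have [|z lz] := ses_ker (x := x) sl.
      by have := congr1 p e; rewrite linearD (ses0 _ s) add0r pu linear0.
    exists z; rewrite !lE lz; congr (_, _); apply: inj_i.
    by rewrite linearB linear0 ic lE lz sub0r; apply/eqP; rewrite eq_sym -addr_eq0 e.
  - have [x qx] := sq (p y); have [|k ik] := ses_ker (x := y - u x) s.
      by rewrite linearB pu qx subrr.
    by exists (k, x); rewrite !lE /= ik subrK.
apply: PD_stab (PD_ext s1 pL pX); exists (zmod0 A), P; split=> //; first exact: proj0.
exact: iso_sym (iso_prod0 _).
Qed.

Lemma ses_prod2 K P M K' P' M' (i : {linear K -> P}) (p : {linear P -> M})
    (i' : {linear K' -> P'}) (p' : {linear P' -> M'}) :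
  ses i p -> ses i' p' -> ses (lprod i i') (lprod p p').
Proof.
move=> [inj_i ex sp] [inj_i' ex' sp']; split=> [[x y] [x' y']|[y y']|[y y']].
- by rewrite !lE /= => -[/inj_i-> /inj_i'->].
- rewrite !lE /=; split=> [[/ex[x <-] /ex'[x' <-]]|[[x x']]].
    by exists (x, x'); rewrite !lE.
  rewrite !lE => -[<- <-] /=; congr (_, _); first by apply/ex; exists x.
  by apply/ex'; exists x'.
- have [x <-] := sp y; have [x' <-] := sp' y'; exists (x, x').
  by rewrite !lE.
Qed.

(** A projective [P] covering [N] covers both summands, so [P * P] covers [N] with kernel [L * L'],
    from which the induction hypothesis splits off the syzygy [L] of [M]. *)
Lemma PD_summand n M N : direct_summand M N -> PD n N -> PD n M.
Proof.
elim: n M N => [|n IH] M N h; first exact: proj_summand h.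
have [M' iso] := direct_summand_compl h; have [f [g [fg gf]]] := iso.
move=> pN; have [P [K [i [p [pP s _]]]]] := pN; have [_ _ sp] := s.
have [|L [l sl]] := @ses_surj _ _ _ (lcomp lfst (lcomp f p)).
  move=> y; have [x px] := sp (g (y, 0)); exists x.
  by rewrite !lE px gf.
have [|L' [l' sl']] := @ses_surj _ _ _ (lcomp lsnd (lcomp f p)).
  move=> y; have [x px] := sp (g (0, y)); exists x.
  by rewrite !lE px gf.
apply: (PDS pP sl); apply: (IH _ (L * L')%type); first exact: summandl.
apply: (PD_ker (n := n.+1) _ (ses_prod2 sl sl')); first exact: proj_prod.
exact: PD_iso iso pN.
Qed.

Lemma res_proj M (P : proj_resolution M) j : projective (pr_obj P j).
Proof. exact: (@pr_proj A M P j). Qed.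
Arguments res_proj [M] P j.

Section ResShift.
Variables (M K : lmodType A) (P : proj_resolution M).
Variables (i : {linear K -> pr_obj P 0}) (a : {linear pr_obj P 1 -> K}).
Hypothesis s : ses i (pr_aug P).
Hypothesis ia : forall x, i (a x) = pr_diff P 0 x.

Fact shift_surj y : exists x, a x = y.
Proof.
have [inj_i _ _] := s; have /pr_aug_exact[x dx] := ses0 y s.
by exists x; apply: inj_i; rewrite ia.
Qed.

Fact shift_exact : exact_at (pr_diff P 1) a.
Proof.
have [inj_i _ _] := s; move=> y; rewrite -pr_diff_exact -ia.
by split=> [->|/eqP]; rewrite ?linear0 // -[0](linear0 i) => /eqP/inj_i.
Qed.

Definition res_shift : proj_resolution K :=
  @ProjResolution A K (fun j => pr_obj P j.+1) (fun j => pr_diff P j.+1) a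
    (fun j => res_proj P j.+1) shift_surj shift_exact
    (fun j => @pr_diff_exact A M P j.+1).
End ResShift.

Lemma ex_shift M (P : proj_resolution M) : exists K (i : {linear K -> pr_obj P 0})
  (a : {linear pr_obj P 1 -> K}),
  ses i (pr_aug P) /\ forall x, i (a x) = pr_diff P 0 x.
Proof.
have [K [i s]] := ses_surj (@pr_aug_surj A M P).
have [x|a ia] := ses_lift (h := pr_diff P 0) s; last by exists K, i, a.
by apply/pr_aug_exact; exists x.
Qed.

Lemma pd_le_PD n M : pd_le M n -> PD n M.
Proof.
elim: n M => [|n IH] M [P P0]; have [K [i [a [s ia]]]] := ex_shift P.
  apply: proj_iso (res_proj P 0); apply: iso_sym.
  have [|g fg gf] := lin_bij _ (@pr_aug_surj A M P); last by exists (pr_aug P), g.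
  apply: lin_inj => x /pr_aug_exact[y <-]; rewrite (P0 1%N _ y) //.
  exact: linear0.
apply: (PDS (res_proj P 0) s); apply: IH.
by exists (res_shift s ia) => j nj; apply: (P0 j.+1).
Qed.

Section ResCons.
Variables (M K P0 : lmodType A) (Q : proj_resolution K).
Variables (i : {linear K -> P0}) (p : {linear P0 -> M}).
Hypotheses (pP0 : projective P0) (s : ses i p).

Definition cons_obj j := if j is j'.+1 then pr_obj Q j' else P0.
Definition cons_diff j : {linear cons_obj j.+1 -> cons_obj j} :=
  match j with 0%N => lcomp i (pr_aug Q) | j'.+1 => pr_diff Q j' end.

Fact cons_proj j : projective (cons_obj j).
Proof. by case: j => //= j; apply: res_proj. Qed.

Fact cons_aug_exact : exact_at (cons_diff 0) p.
Proof.
move=> y; split=> [/(ses_ker s)[k <-]|[x <-]].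
  by have [x <-] := @pr_aug_surj A K Q k; exists x; rewrite /= lE.
by rewrite /= lE (ses0 _ s).
Qed.

Fact cons_diff_exact j : exact_at (cons_diff j.+1) (cons_diff j).
Proof.
case: j => [|j] y /=; last exact: pr_diff_exact.
rewrite lE -pr_aug_exact; have [inj_i _ _] := s.
by split=> [|->]; rewrite ?linear0 // -[X in _ = X](linear0 i) => /inj_i.
Qed.

Definition res_cons : proj_resolution M :=
  @ProjResolution A M cons_obj cons_diff p cons_proj
    (let: And3 _ _ h := s in h) cons_aug_exact cons_diff_exact.
End ResCons.

Lemma PD_pd_le n M : PD n M -> pd_le M n.
Proof.
elim: n M => [|n IH] M /=.
  move=> pM; pose s0 (j : nat) : lmodType A := if j is 0%N then M else zmod0 A.
  have z0 j (x : s0 j.+1) : x = 0 by exact: zmod0P.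
  have ps j : projective (s0 j) by case: j => //= j; apply: proj0.
  have ss : forall y, exists x, lid M x = y by move=> y; exists y; rewrite lE.
  have e0 : exact_at (lzero (s0 1%N) (s0 0%N)) (lid M).
    by move=> y; rewrite lE; split=> [->|[x <-]]; [exists 0|]; rewrite lE.
  have e1 j : exact_at (lzero (s0 j.+2) (s0 j.+1)) (lzero (s0 j.+1) (s0 j)).
    move=> y; split=> _; first by exists 0; rewrite lE (z0 _ y).
    by rewrite lE.
  exists (@ProjResolution A M s0 (fun j => lzero _ _) (lid M) ps ss e0 e1).
  by case=> // j _; apply: z0.
move=> [P [K [i [p [pP s /IH[Q Q0]]]]]]; exists (res_cons Q pP s).
by case=> // j nj; apply: Q0.
Qed.

Lemma fin_pdP M : fin_pd M <-> fin_gen M /\ exists n, PD n M.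
Proof.
by split=> -[fM [n h]]; split=> //; exists n; [apply: pd_le_PD | apply: PD_pd_le].
Qed.

(* Resolutions are arbitrary here, so the syzygies occurring below need not be *)
(* finitely generated; this is why a class closed under all syzygies is used.  *)
Lemma ext_pos_class (Cl : lmodType A -> Prop) N :
  (forall M, Cl M -> E1 M N) ->
  (forall K P M (i : {linear K -> P}) (p : {linear P -> M}),
     Cl M -> projective P -> ses i p -> Cl K) ->
  forall M, Cl M -> ext_pos_eq0 M N.
Proof.
move=> ClE ClK M ClM k; elim: k M ClM => [|k IH] M ClM P;
    have [K [i [a [s ia]]]] := ex_shift P; last first.
  exact: (IH K (ClK _ _ _ _ _ ClM (res_proj P 0) s) (res_shift s ia)).
move=> f fd; have [|f' f'E] := factor_surj (q := a) (h := f) (shift_surj s ia).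
  by move=> x /(shift_exact s ia)[y <-]; apply: fd.
have [g gE] := ClE _ ClM _ _ _ _ s f'.
by exists g => x; rewrite -ia gE f'E.
Qed.

End ExtDim.

(** * Modules of homomorphisms and vector spaces *)

(** A module structure as data. The carrier is then wrapped in the type [boxed], which is tagged by
    the action, so that one group can carry several module structures without competing
    instances. *)
Record action (R : pzRingType) (V : zmodType) := Action {
  act : R -> V -> V;
  actA : forall a b x, act a (act b x) = act (a * b) x;
  act1 : forall x, act 1 x = x;
  actDr : forall a x y, act a (x + y) = act a x + act a y;
  actDl : forall a b x, act (a + b) x = act a x + act b x
}.

Section Boxed.
Variables (R : pzRingType) (V : zmodType) (a : action R V).

Record boxed (b : action R V) := Box { unbox : V }.
Local Notation B := (boxed a).
HB.instance Definition _ := [isNew for @unbox a].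
HB.instance Definition _ := [Choice of B by <:].

Fact boxed_addA : associative (fun x y : B => Box a (unbox x + unbox y)).
Proof. by move=> x y z; rewrite /= addrA. Qed.
Fact boxed_addC : commutative (fun x y : B => Box a (unbox x + unbox y)).
Proof. by move=> x y; rewrite addrC. Qed.
Fact boxed_add0 : left_id (Box a 0) (fun x y : B => Box a (unbox x + unbox y)).
Proof. by move=> [x]; rewrite /= add0r. Qed.
Fact boxed_addN : left_inverse (Box a 0) (fun x : B => Box a (- unbox x))
  (fun x y : B => Box a (unbox x + unbox y)).
Proof. by move=> [x]; rewrite /= addNr. Qed.
HB.instance Definition _ := GRing.isZmodule.Build B
  boxed_addA boxed_addC boxed_add0 boxed_addN.

Fact boxed_scaleA r s (x : B) :
  Box a (act a r (unbox (Box a (act a s (unbox x))))) =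
  Box a (act a (r * s) (unbox x)).
Proof. by rewrite /= actA. Qed.
Fact boxed_scale1 : left_id 1 (fun r (x : B) => Box a (act a r (unbox x))).
Proof. by move=> [x]; rewrite /= act1. Qed.
Fact boxed_scaleDr :
  right_distributive (fun r (x : B) => Box a (act a r (unbox x))) +%R.
Proof. by move=> r x y; rewrite /GRing.add /= actDr. Qed.
Fact boxed_scaleDl (x : B) :
  {morph (fun r => Box a (act a r (unbox x))) : r s / r + s}.
Proof. by move=> r s; rewrite [in RHS]/GRing.add /= actDl. Qed.
HB.instance Definition _ := GRing.Zmodule_isLmodule.Build R B
  boxed_scaleA boxed_scale1 boxed_scaleDr boxed_scaleDl.

Definition boxmod : lmodType R := B.
Definition unb (x : boxmod) : V := unbox x.
Definition bx (x : V) : boxmod := Box a x.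

Lemma unbK : cancel unb bx. Proof. by case. Qed.
Lemma bxK : cancel bx unb. Proof. by []. Qed.
Lemma unbD x y : unb (x + y) = unb x + unb y. Proof. by []. Qed.
Lemma unb0 : unb 0 = 0. Proof. by []. Qed.
Lemma unbZ r x : unb (r *: x) = act a r (unb x). Proof. by []. Qed.
Lemma bxD x y : bx (x + y) = bx x + bx y. Proof. by []. Qed.
Lemma bx0 : bx 0 = 0. Proof. by []. Qed.
Lemma bxZ r x : bx (act a r x) = r *: bx x. Proof. by []. Qed.
Lemma unb_inj : injective unb. Proof. exact: can_inj unbK. Qed.
Lemma unb_sum n (F : 'I_n -> boxmod) : unb (\sum_k F k) = \sum_k unb (F k).
Proof. exact: (big_morph unb unbD unb0). Qed.
End Boxed.
Arguments unb {R V a} x.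
Arguments bx {R V} a x.
Arguments boxmod : simpl never.
Arguments unb : simpl never.
Arguments bx : simpl never.

Section Hom.
Variables (R : pzRingType) (W N : lmodType R).

(** A bare function with a linearity proof, so that functional extensionality and proof irrelevance
    turn pointwise equality into equality ([homP]). *)
Record homT := HomT { hom_fun : W -> N; hom_lin : linear hom_fun }.
HB.instance Definition _ := gen_eqMixin homT.
HB.instance Definition _ := gen_choiceMixin homT.

Definition homL (f : homT) : {linear W -> N} := mkL (hom_lin f).
Fact toH_subproof (f : {linear W -> N}) : linear (f : W -> N).
Proof. by move=> a x y; rewrite linearP. Qed.
Definition toH (f : {linear W -> N}) : homT := HomT (toH_subproof f).

Lemma toHE f x : homL (toH f) x = f x. Proof. exact: mkLE. Qed.

Lemma homP (f g : homT) : homL f =1 homL g -> f = g.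
Proof.
case: f g => [f lf] [g lg] fg; have efg : f = g.
  by apply/funext => x; have := fg x; rewrite !mkLE.
by clear fg; rewrite efg in lf *; congr HomT; apply: Prop_irrelevance.
Qed.

Definition hom_add (f g : homT) := toH (ladd (homL f) (homL g)).
Definition hom_opp (f : homT) := toH (lsub (lzero W N) (homL f)).
Definition hom_zero := toH (lzero W N).

Fact hom_addA : associative hom_add.
Proof. by move=> f g h; apply: homP => x; rewrite !(toHE, lE) addrA. Qed.
Fact hom_addC : commutative hom_add.
Proof. by move=> f g; apply: homP => x; rewrite !(toHE, lE) addrC. Qed.
Fact hom_add0 : left_id hom_zero hom_add.
Proof. by move=> f; apply: homP => x; rewrite !(toHE, lE) add0r. Qed.
Fact hom_addN : left_inverse hom_zero hom_opp hom_add.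
Proof. by move=> f; apply: homP => x; rewrite !(toHE, lE) sub0r addNr. Qed.
HB.instance Definition _ := GRing.isZmodule.Build homT
  hom_addA hom_addC hom_add0 hom_addN.

Lemma homLD (f g : homT) x : homL (f + g) x = homL f x + homL g x.
Proof. by rewrite -[f + g]/(hom_add f g) toHE lE. Qed.
Lemma homL0 x : homL 0 x = 0.
Proof. by rewrite -[0 : homT]/hom_zero toHE lE. Qed.
Lemma homL_sum n (F : 'I_n -> homT) x :
  homL (\sum_k F k) x = \sum_k homL (F k) x.
Proof. exact: (big_morph (homL^~ x) (fun f g => homLD f g x) (homL0 x)). Qed.
End Hom.

Section EndRing.
Variables (R : pzRingType) (T : lmodType R).

Definition endT : Type := homT T T.
HB.instance Definition _ := GRing.Zmodule.on endT.
Definition end_mul (f g : endT) : endT := toH (lcomp (homL f) (homL g)).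
Definition end_one : endT := toH (lid T).

Fact end_mulA : associative end_mul.
Proof. by move=> f g h; apply: homP => x; rewrite !(toHE, lE). Qed.
Fact end_mul1l : left_id end_one end_mul.
Proof. by move=> f; apply: homP => x; rewrite !(toHE, lE). Qed.
Fact end_mul1r : right_id end_one end_mul.
Proof. by move=> f; apply: homP => x; rewrite !(toHE, lE). Qed.
Fact end_mulDl : left_distributive end_mul +%R.
Proof. by move=> f g h; apply: homP => x; rewrite !(toHE, lE, homLD). Qed.
Fact end_mulDr : right_distributive end_mul +%R.
Proof.
by move=> f g h; apply: homP => x; rewrite !(toHE, lE, homLD) linearD.
Qed.
HB.instance Definition _ := GRing.Zmodule_isPzRing.Build endT
  end_mulA end_mul1l end_mul1r end_mulDl end_mulDr.

End EndRing.

(** * Dimension of vector spaces, as modules over a field *)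

Section VectorSpaces.
Variable K : fieldType.
Implicit Types U V W : lmodType K.
Local Notation "K^^ n" := ({ffun 'I_n -> K^o} : lmodType K)
  (at level 8, n at level 2, format "K^^ n").

Lemma ffun_dim m n (f : {linear K^^m -> K^^n}) : injective f ->
  (m <= n)%N /\ (m = n -> surj f).
Proof.
move=> inj_f; pose A := \matrix_(k < m, l < n) (f (fbase K k) l : K).
pose vr r (u : 'rV[K]_r) : K^^r := [ffun k => u 0 k].
have vrE r u k : vr r u k = u 0 k by rewrite ffunE.
have fA (u : 'rV[K]_m) : f (vr m u) = vr n (u *m A).
  rewrite free_comb; apply/ffunP=> l; rewrite sum_ffunE vrE mxE.
  by apply: eq_bigr => k _; rewrite ffunE vrE mxE.
have freeA : row_free A.
  apply: inj_row_free => u uA; have /inj_f/ffunP u0 : f (vr m u) = f 0.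
    by rewrite fA uA linear0; apply/ffunP=> l; rewrite vrE !ffunE mxE.
  by apply/rowP=> k; have := u0 k; rewrite vrE !ffunE mxE.
have mn : (m <= n)%N by rewrite -(eqP freeA) rank_leq_col.
split=> // emn; subst n; rewrite row_free_unit in freeA => y.
exists (vr m ((\row_l (y l : K)) *m invmx A)); rewrite fA mulmxKV //.
by apply/ffunP=> l; rewrite vrE mxE.
Qed.

Definition isdim V n := iso_modules V K^^n.

(** A generating family of minimal length is a basis: a relation with nonzero coefficient at [k]
    makes the k-th generator redundant. *)
Lemma basis_exists V : fin_gen V -> exists n, isdim V n.
Proof.
move=> /fin_genP exn.
pose P n := `[< exists p : {linear K^^n -> V}, surj p >].
have exP : exists n, P n by have [n h] := exn; exists n; apply/asboolP.
have [n /asboolP[p sp] nmin] := ex_minnP exP; exists n.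
apply: iso_sym; have inj_p : injective p.
  apply: lin_inj => x px; apply/ffunP=> k; rewrite ffunE; apply/eqP.
  apply: contraT => xk; case: n k p sp x px xk nmin => [[]//|n] k p sp x px xk nmin.
  suff /nmin : P n by rewrite ltnn.
  apply/asboolP; exists (lsum (fun l => lcomp p (linj (lift k l)))) => y.
  have [z <-] := sp y; pose w := z - (z k / x k) *: x.
  have wk : w k = 0 by rewrite !ffunE [_ *: _]mulfVK // subrr.
  exists [ffun l => w (lift k l)].
  have -> : p z = p w by rewrite linearB linearZ_LR px scaler0 subr0.
  rewrite lsumE [in RHS](linj_proj w) linear_sum (bigD1_ord k) //= wk !linear0 add0r.
  by apply: eq_bigr => l _; rewrite lE ffunE.
by have [g pg gp] := lin_bij inj_p sp; exists p, g.
Qed.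

Lemma fg_isdim V n : isdim V n -> fin_gen V.
Proof. by move=> /iso_sym h; apply: fg_iso h (fg_free K n). Qed.

Lemma vs_proj V : fin_gen V -> projective V.
Proof. by move=> /basis_exists[n h]; apply: proj_iso h _; exact: proj_free. Qed.

Lemma isdim_inj U V m n (f : {linear U -> V}) : injective f ->
  isdim U m -> isdim V n -> (m <= n)%N /\ (m = n -> surj f).
Proof.
move=> inj_f [a [a' [aa' a'a]]] [b [b' [bb' b'b]]].
have [|mn s] := @ffun_dim m n (lcomp b (lcomp f a')).
  by move=> x y; rewrite !lE => /(can_inj bb')/inj_f/(can_inj a'a).
split=> // /s sf y; have [x] := sf (b y); rewrite !lE => /(can_inj bb') <-.
by exists (a' x).
Qed.

Lemma isdim_surj U V m n (f : {linear U -> V}) : surj f ->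
  isdim U m -> isdim V n -> (n <= m)%N /\ (n = m -> injective f).
Proof.
move=> sf dU dV; have [s fs] := proj_section (vs_proj (fg_isdim dV)) sf.
have [nm ss] := isdim_inj (can_inj fs) dV dU; split=> // /ss sus.
by apply: lin_inj => x; have [y <-] := sus x; rewrite fs => ->; rewrite linear0.
Qed.

(** Independent families in [U] are no longer than the dimension of [V]; one of maximal length spans
    [U]. *)
Lemma vs_sub U V (f : {linear U -> V}) : injective f -> fin_gen V -> fin_gen U.
Proof.
move=> inj_f /basis_exists[n dV].
pose P m := `[< exists g : {linear K^^m -> U}, injective g >].
have exP : exists m, P m.
  by exists 0%N; apply/asboolP; exists (lzero _ _) => x y _; apply/ffunP=> -[].
have Pn m : P m -> (m <= n)%N.
  move=> /asboolP[g inj_g].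
  have [|//] := @isdim_inj _ _ m n (lcomp f g) _ (iso_refl _) dV.
  by move=> x y; rewrite !lE => /inj_f/inj_g.
have [m /asboolP[g inj_g] mmax] := ex_maxnP exP Pn.
apply: (@fg_surj _ _ _ g); last exact: fg_free.
move=> y.
apply: contrapT => ny.
suff /mmax : P m.+1 by rewrite ltnn.
have [h [h' [hh' h'h]]] := ffunS_iso m (K^o : lmodType K).
apply/asboolP; exists (lcomp (lcase (lmul y) g) h').
suff inj2 : injective (lcase (lmul y) g).
  by move=> u v; rewrite !lE -!(lcaseE (lmul y) g) => /inj2/(can_inj h'h).
apply: lin_inj => -[c x]; rewrite lcaseE lmulE /= => e.
have [c0|c0] := eqVneq (c : K) 0.
  by move: e; rewrite c0 scale0r add0r -(linear0 g) => /inj_g ->.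
case: ny; exists (- (c : K)^-1 *: x); rewrite linearZ /= scaleNr.
move/eqP: e; rewrite addrC addr_eq0 => /eqP->; rewrite scalerN opprK scalerA.
by rewrite mulVf // scale1r.
Qed.

Lemma vs_retract U V (f : {linear U -> V}) : injective f -> fin_gen V ->
  exists r : {linear V -> U}, cancel f r.
Proof.
move=> inj_f fV; have [W [p s]] := ses_inj inj_f; have [_ _ sp] := s.
have [t pt] := proj_section (vs_proj (fg_surj sp fV)) sp.
by have [r fr _] := ses_retract s pt; exists r.
Qed.

End VectorSpaces.

(** * Modules over finite dimensional algebras *)

(** [io] is the structure map of [K] into the centre of [R]. It need not be injective, since corner
    rings may be zero. *)
Record fdalg (K : fieldType) (R : pzRingType) (io : K -> R) : Prop := FdAlg {
  fdD : forall a b, io (a + b) = io a + io b;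
  fdM : forall a b, io (a * b) = io a * io b;
  fd1 : io 1 = 1;
  fdC : forall c x, io c * x = x * io c;
  fd_span : exists n (s : 'I_n -> R), forall x, exists c : 'I_n -> K,
    x = \sum_k io (c k) * s k
}.

Lemma fd_op (K : fieldType) (R : pzRingType) (io : K -> R) :
  fdalg io -> fdalg (io : K -> R^c).
Proof.
case=> iD iM i1 iC [n [s sP]]; split=> //.
- by move=> a b; rewrite mulrC; apply: iM.
- by move=> c x; exact: esym (iC c x).
exists n, s => x; have [c ->] := sP x; exists c.
by apply: eq_bigr => k _; apply: iC.
Qed.

Section FdAlgebra.
Variables (K : fieldType) (R : pzRingType) (io : K -> R) (fd : fdalg io).
Implicit Types M N P X L T : lmodType R.

Fact res_actA M a b (x : M) : io a *: (io b *: x) = io (a * b) *: x.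
Proof. by rewrite scalerA fdM. Qed.
Fact res_act1 M (x : M) : io 1 *: x = x.
Proof. by rewrite fd1 // scale1r. Qed.
Fact res_actDr M a (x y : M) : io a *: (x + y) = io a *: x + io a *: y.
Proof. exact: scalerDr. Qed.
Fact res_actDl M a b (x : M) : io (a + b) *: x = io a *: x + io b *: x.
Proof. by rewrite fdD // scalerDl. Qed.
Definition res_act M : action K M :=
  Action (@res_actA M) (@res_act1 M) (@res_actDr M) (@res_actDl M).
Definition res M : lmodType K := boxmod (res_act M).

Fact resL_subproof M N (f : {linear M -> N}) :
  linear (fun x : res M => bx (res_act N) (f (unb x))).
Proof.
by move=> a x y; rewrite unbD unbZ /= linearP bxD; congr (_ + _).
Qed.
Definition resL M N (f : {linear M -> N}) : {linear res M -> res N} :=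
  mkL (resL_subproof f).

Lemma resLE M N (f : {linear M -> N}) x :
  resL f x = bx (res_act N) (f (unb x)).
Proof. exact: mkLE. Qed.

Lemma res_inj M N (f : {linear M -> N}) : injective f -> injective (resL f).
Proof.
by move=> inj_f x y; rewrite !resLE => /(congr1 unb)/inj_f/(@unb_inj _ _ _).
Qed.

Lemma res_surj M N (f : {linear M -> N}) : surj f -> surj (resL f).
Proof.
move=> sf y; have [x fx] := sf (unb y); exists (bx _ x).
by rewrite resLE bxK fx unbK.
Qed.

Lemma res_ses L X M (i : {linear L -> X}) (p : {linear X -> M}) :
  ses i p -> ses (resL i) (resL p).
Proof.
move=> s; have [inj_i _ sp] := s; split=> [|y|]; [exact: res_inj| |exact: res_surj].
rewrite resLE; split=> [/(congr1 unb) e|[x <-]].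
  have [x ix] := ses_ker s e; exists (bx _ x).
  by rewrite resLE bxK ix unbK.
by rewrite resLE bxK (ses0 _ s).
Qed.

Lemma fg_res M : fin_gen M -> fin_gen (res M).
Proof.
move=> /fin_genP[n [p sp]]; apply: fg_surj (res_surj sp) _ => {p sp M}.
elim: n => [|n IH].
  apply: (@fg_surj _ (zmod0 K) _ (lzero _ _)); last exact: fg_free.
  by move=> y; exists 0; rewrite lE -(unbK y); congr bx; apply/esym/zero_ffun0.
have [f [g [fg gf]]] := ffunS_iso n (R^o : lmodType R).
apply: (@fg_surj _ _ _ (resL f)); first by apply: res_surj => y; exists (g y).
apply: fg_ext (res_ses (ses_prod _ _)) _ IH.
have [m [s sP]] := fd_span fd; apply/fin_genP.
exists m, (comb (fun k => bx (res_act (R^o : lmodType R)) (s k))) => y.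
have [c cE] := sP (unb y); exists [ffun k => c k].
apply: unb_inj; rewrite combE cE.
rewrite unb_sum.
by apply: eq_bigr => k _; rewrite unbZ bxK ffunE.
Qed.

Lemma res_fg M : fin_gen (res M) -> fin_gen M.
Proof.
move=> /fin_genP[n [q sq]]; apply/fin_genP.
exists n, (comb (fun k => unb (q (fbase K k)))) => y.
have [x qx] := sq (bx _ y); exists [ffun k => io (x k)].
rewrite combE -[RHS](bxK (res_act M)) -qx [in RHS]free_comb unb_sum.
by apply: eq_bigr => k _; rewrite ffunE unbZ.
Qed.

(** Noetherianity, read off from finite [K]-dimension after restriction of scalars. *)
Lemma fg_sub M N (f : {linear M -> N}) : injective f -> fin_gen N -> fin_gen M.
Proof.
by move=> inj_f /fg_res fN; apply/res_fg; apply: vs_sub (res_inj inj_f) fN.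
Qed.

Definition hasdim M n := isdim (res M) n.

Lemma hasdim_exists M : fin_gen M -> exists n, hasdim M n.
Proof. by move=> /fg_res; apply: basis_exists. Qed.

Lemma hasdim0 M : hasdim M 0 <-> zero_module M.
Proof.
split=> [[a [a' [aa' _]]] x|M0]; last first.
  by apply: iso_zero (@zero_ffun0 _ _) => x; rewrite -(unbK x) (M0 (unb x)).
apply: (can_inj (bxK (res_act M))); apply: (can_inj aa').
by rewrite (zero_ffun0 (a _)) (zero_ffun0 (a (bx _ 0))).
Qed.

Lemma hasdim_inj M N m n (f : {linear M -> N}) : injective f ->
  hasdim M m -> hasdim N n -> (m <= n)%N /\ (m = n -> surj f).
Proof.
move=> inj_f dM dN; have [mn s] := isdim_inj (res_inj inj_f) dM dN.
split=> // /s sf y; have [x] := sf (bx _ y); rewrite resLE => /(congr1 unb) e.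
by exists (unb x).
Qed.

Lemma hasdim_surj M N m n (f : {linear M -> N}) : surj f ->
  hasdim M m -> hasdim N n -> (n <= m)%N /\ (n = m -> injective f).
Proof.
move=> sf dM dN; have [nm s] := isdim_surj (res_surj sf) dM dN.
split=> // /s inj_f x y fxy; apply: (can_inj (bxK (res_act M))); apply: inj_f.
by rewrite !resLE !bxK fxy.
Qed.

Lemma fin_pd2 M N : fin_pd M -> fin_pd N ->
  exists n, [/\ fin_gen M, fin_gen N, PD n M & PD n N].
Proof.
move=> /fin_pdP[fM [m pM]] /fin_pdP[fN [n pN]]; exists (maxn m n); split=> //.
  exact: PD_le (leq_maxl m n) pM.
exact: PD_le (leq_maxr m n) pN.
Qed.

Lemma fin_pd_ses L P M (i : {linear L -> P}) (p : {linear P -> M}) :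
  projective P -> fin_gen P -> ses i p -> fin_pd M -> fin_pd L.
Proof.
move=> pP fP s /fin_pdP[fM [n pM]]; have [inj_i _ _] := s.
apply/fin_pdP; split; first exact: fg_sub inj_i fP.
by exists n.-1; apply: PD_ker pP s pM.
Qed.

Lemma fin_pd_ext L X M (i : {linear L -> X}) (p : {linear X -> M}) :
  ses i p -> fin_pd L -> fin_pd M -> fin_pd X.
Proof.
move=> s /fin_pd2 h /h[n [fL fM pL pM]]; apply/fin_pdP.
by split; [exact: fg_ext s fL fM | exists n; exact: PD_ext s pL pM].
Qed.

Lemma fin_pd_quot L X M (i : {linear L -> X}) (p : {linear X -> M}) :
  ses i p -> fin_pd L -> fin_pd X -> fin_pd M.
Proof.
move=> s /fin_pd2 h /h[n [_ fX pL pX]]; have [_ _ sp] := s; apply/fin_pdP.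
by split; [exact: fg_surj sp fX | exists n.+1; exact: PD_quot s pL pX].
Qed.

Lemma fin_pd_sub L X M (i : {linear L -> X}) (p : {linear X -> M}) :
  ses i p -> fin_pd X -> fin_pd M -> fin_pd L.
Proof.
move=> s /fin_pd2 h /h[n [fX _ pX pM]]; have [inj_i _ _] := s; apply/fin_pdP.
by split; [exact: fg_sub inj_i fX | exists n; exact: PD_sub s pX pM].
Qed.

Lemma fin_pd_summand M N : direct_summand M N -> fin_pd N -> fin_pd M.
Proof.
move=> h /fin_pdP[fN [n pN]]; apply/fin_pdP; split; first exact: fg_summand h fN.
by exists n; apply: PD_summand h pN.
Qed.

Lemma fin_pd_iso M N : iso_modules M N -> fin_pd N -> fin_pd M.
Proof. by move=> /iso_summand; apply: fin_pd_summand. Qed.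

Lemma fin_pd_prod M N : fin_pd M -> fin_pd N -> fin_pd (M * N)%type.
Proof. exact/fin_pd_ext/ses_prod. Qed.

Lemma fin_pd_proj M : fin_gen M -> projective M -> fin_pd M.
Proof. by move=> fM pM; apply/fin_pdP; split=> //; exists 0%N. Qed.

Lemma fin_pd_free n : fin_pd {ffun 'I_n -> R^o}.
Proof. exact: fin_pd_proj (fg_free _ n) (proj_free n). Qed.

Lemma fin_pd_zero M : zero_module M -> fin_pd M.
Proof.
by move=> M0; apply: fin_pd_iso (fin_pd_free 0); apply: iso_zero M0 (@zero_ffun0 _ _).
Qed.

Lemma fin_pd_ffun n M : fin_pd M -> fin_pd {ffun 'I_n -> M}.
Proof.
move=> pM; elim: n => [|n IH].
  exact/fin_pd_zero/zero_ffun0.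
exact: fin_pd_iso (iso_sym (ffunS_iso n M)) (fin_pd_prod pM IH).
Qed.

(** The class used is that of modules stably isomorphic to one in [fin_pd]. By Schanuel's lemma it
    is closed under all syzygies, including those of infinitely generated resolutions. *)
Lemma strong_ext T : (forall M, fin_pd M -> E1 M T) ->
  forall M, fin_pd M -> ext_pos_eq0 M T.
Proof.
move=> eT M pM.
apply: (@ext_pos_class R (fun M => exists2 M', fin_pd M' & stab M M') T);
    last by exists M => //; apply/stab_iso/iso_refl.
- by move=> X [X' pX' st]; apply: E1_stab pX'.1 st (eT _ pX').
- move=> L P X i p [X' pX' st] pP s; have [fX' _] := pX'.
  have [n [L' [i' [p' s']]]] := fg_ses fX'; exists L'.
    exact: fin_pd_ses (proj_free n) (fg_free _ n) s' pX'.
  exact: schanuel st pP (proj_free n) s s'.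
Qed.

Local Notation RR := (R^o : lmodType R).

Fact rmul_subproof (r : R) :
  linear (fun x : res RR => bx (res_act RR) ((unb x : R) * r)).
Proof.
move=> a x y; rewrite unbD unbZ /= mulrDl bxD; congr (_ + _).
by rewrite -bxZ /=; congr bx; rewrite /GRing.scale /= mulrA.
Qed.
Definition rmul r : {linear res RR -> res RR} := mkL (rmul_subproof r).
Lemma rmulE r x : rmul r x = bx (res_act RR) ((unb x : R) * r).
Proof. exact: mkLE. Qed.

Definition dual_fun r (phi : homT (res RR) K^o) : homT (res RR) K^o :=
  toH (lcomp (homL phi) (rmul r)).
Lemma dual_funE r phi x : homL (dual_fun r phi) x = homL phi (rmul r x).
Proof. by rewrite toHE lE. Qed.

Fact dual_actA a b phi : dual_fun a (dual_fun b phi) = dual_fun (a * b) phi.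
Proof.
by apply: homP => x; rewrite !dual_funE !rmulE bxK mulrA.
Qed.
Fact dual_act1 phi : dual_fun 1 phi = phi.
Proof. by apply: homP => x; rewrite dual_funE rmulE mulr1 unbK. Qed.
Fact dual_actDr a phi psi :
  dual_fun a (phi + psi) = dual_fun a phi + dual_fun a psi.
Proof. by apply: homP => x; rewrite homLD !dual_funE homLD. Qed.
Fact dual_actDl a b phi :
  dual_fun (a + b) phi = dual_fun a phi + dual_fun b phi.
Proof.
by apply: homP => x; rewrite homLD !dual_funE !rmulE mulrDr bxD linearD.
Qed.
Definition dual_act : action R (homT (res RR) K^o) :=
  Action dual_actA dual_act1 dual_actDr dual_actDl.

(* The dual of the right regular module. *)
Definition dualR : lmodType R := boxmod dual_act.

Fact dual_ev_subproof (r : R) :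
  linear (fun x : res dualR => homL (unb (unb x)) (bx (res_act RR) r)).
Proof.
move=> a x y; have -> : unb (unb (a *: x + y)) =
  dual_fun (io a) (unb (unb x)) + unb (unb y) by [].
rewrite homLD dual_funE; congr (_ + _); rewrite -linearZ; congr (homL _ _).
by rewrite rmulE bxK -bxZ /= -(fdC fd).
Qed.
Definition dual_ev r : {linear res dualR -> K^o} := mkL (dual_ev_subproof r).
Lemma dual_evE r x : dual_ev r x = homL (unb (unb x)) (bx (res_act RR) r).
Proof. exact: mkLE. Qed.

Section Coev.
Variables (X : lmodType R) (psi : {linear res X -> K^o}).

Fact coev_fun_subproof (x : X) :
  linear (fun r : res RR => psi (bx (res_act X) ((unb r : R) *: x))).
Proof.
move=> a r s; rewrite unbD unbZ /= scalerDl bxD linearD; congr (_ + _).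
rewrite -linearZ -bxZ; congr (psi (bx _ _)).
by rewrite /= [in LHS]/GRing.scale /= scalerA.
Qed.

Fact coev_subproof :
  linear (fun x : X => bx dual_act (toH (mkL (coev_fun_subproof x)))).
Proof.
move=> a x y; apply: unb_inj; apply: homP => r.
rewrite unbD unbZ !bxK homLD dual_funE !toHE rmulE !mkLE.
by rewrite bxK scalerDr bxD linearD scalerA.
Qed.
Definition coev : {linear X -> dualR} := mkL coev_subproof.
Lemma coevE x r :
  homL (unb (coev x)) r = psi (bx (res_act X) ((unb r : R) *: x)).
Proof. by rewrite (mkLE coev_subproof) bxK toHE (mkLE (coev_fun_subproof x)). Qed.
End Coev.

(** Adjunction between restriction to [K] and coinduction: Hom_R(X, [dualR]) = Hom_K(X, K). The form
    [psi] is recovered by evaluating at 1. *)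
Lemma coev_onto X (f : {linear X -> dualR}) :
  exists psi : {linear res X -> K^o}, forall x, f x = coev psi x.
Proof.
exists (lcomp (dual_ev 1) (resL f)) => x; apply: unb_inj; apply: homP => r.
rewrite coevE lE dual_evE resLE !bxK linearZ_LR.
have -> : unb ((unb r : R) *: f x) = dual_fun (unb r) (unb (f x)) by [].
by rewrite dual_funE rmulE bxK mul1r unbK.
Qed.

Lemma dualR_fg : fin_gen dualR.
Proof.
apply: res_fg; have [n [s sP]] := fd_span fd.
apply: (@vs_sub _ _ _ (ltuple (fun k => dual_ev (s k)))); last exact: fg_free.
apply: lin_inj => x /ffunP x0; apply: unb_inj; apply: unb_inj.
rewrite !unb0; apply: homP => r; rewrite homL0.
have [c cE] := sP (unb r); rewrite -(unbK r) cE.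
rewrite (big_morph (bx (res_act RR)) (@bxD _ _ _) (@bx0 _ _ _)) linear_sum big1 //.
move=> k _; have := x0 k; rewrite ltupleE dual_evE ffunE => e.
by rewrite (bxZ (res_act RR) (c k) (s k)) linearZ_LR e scaler0.
Qed.

(** By the adjunction, extending an R-linear map to [dualR] amounts to extending a linear form,
    which a [K]-linear retraction does. *)
Lemma dualR_inj M : fin_gen M -> E1 M dualR.
Proof.
move=> fM; have [n [L [i [p s]]]] := fg_ses fM.
apply: (E1_pres (proj_free n) s) => f.
have [inj_i _ _] := s; have [psi fE] := coev_onto f.
have [r rK] := vs_retract (res_inj inj_i) (fg_res (fg_free R n)).
exists (coev (lcomp psi r)) => x; rewrite fE.
apply: unb_inj; apply: homP => a; rewrite !coevE lE; congr (psi _).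
by rewrite -linearZ -[RHS]rK resLE bxK.
Qed.

Lemma dualR_cogen M : fin_gen M ->
  exists n (f : {linear M -> {ffun 'I_n -> dualR}}), injective f.
Proof.
move=> fM; have [n [a [a' [aa' _]]]] := hasdim_exists fM.
exists n, (ltuple (fun k => coev (lcomp (lproj k) a))).
apply: lin_inj => x /ffunP x0; apply: (can_inj (bxK (res_act M))).
apply: (can_inj aa'); rewrite bx0 linear0; apply/ffunP=> k.
have := x0 k; rewrite ltupleE ffunE => /(congr1 unb) /(congr1 (@homL _ _ _)).
move=> /(congr1 (fun h : {linear _ -> _} => h (bx (res_act RR) (1 : R)))).
by rewrite coevE bxK scale1r lE lprojE unb0 homL0 ffunE.
Qed.

End FdAlgebra.

(** * Special approximations and strong tilting modules *)

Section Tilting.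
Variable R : pzRingType.
Implicit Types M N X Y Z C I T : lmodType R.

Lemma image_fact M N (f : {linear M -> N}) : exists I
  (e : {linear M -> I}) (i : {linear I -> N}),
  [/\ surj e, injective i & forall x, i (e x) = f x].
Proof.
have [I [i [inj_i iP]]] := ex_sub (submod_im f).
have [x|e ie] := factor_inj (h := f) inj_i; first by apply/iP; exists x.
exists I, e, i; split=> // y; have /iP[x fx] : exists z, i z = i y by exists y.
by exists x; apply: inj_i; rewrite ie.
Qed.

(** The right Ext-orthogonal class of [fin_pd]. Degree one is enough: [strong_ext] recovers the
    higher degrees. *)
Definition perp N := forall Z, fin_pd Z -> E1 Z N.

Definition approx M X (phi : {linear X -> M}) := fin_pd X /\
  forall Y (f : {linear Y -> M}), fin_pd Y ->
    exists g : {linear Y -> X}, forall y, phi (g y) = f y.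

(** An Ext-injective cogenerator of [fin_pd]: the working form of a strong tilting module. It
    becomes one as soon as projective dimensions on [fin_pd] are bounded
    ([strong_cogen_tilting]). *)
Definition strong_cogen T :=
  [/\ fin_pd T, perp T & forall M, fin_pd M ->
      exists n (f : {linear M -> {ffun 'I_n -> T}}), injective f].

Fixpoint lpow X (g : {linear X -> X}) k : {linear X -> X} :=
  if k is k'.+1 then lcomp g (lpow g k') else lid X.

Lemma lpowD X (g : {linear X -> X}) j k x :
  lpow g (j + k) x = lpow g j (lpow g k x).
Proof.
elim: j => [|j IH]; first by rewrite add0n /= lE.
by rewrite addSn /= !lE IH.
Qed.

Lemma add_ffun T n : in_add T {ffun 'I_n -> T}.
Proof. by exists n, (lid _), (lid _) => x; rewrite !lE. Qed.

Lemma add_summand T M N : direct_summand M N -> in_add T N -> in_add T M.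
Proof. by move=> h [n s]; exists n; apply: summand_trans h s. Qed.

Lemma add_self T : in_add T T.
Proof.
exists 1%N, (linj ord0), (lproj ord0) => x.
by rewrite lprojE linjE eqxx.
Qed.

Lemma add_zero T M : zero_module M -> in_add T M.
Proof. by move=> M0; exists 0%N, (lzero _ _), (lzero _ _) => x; rewrite (M0 x) !lE. Qed.

(** A finite coresolution of [X] by add(T) as a recursion on cosyzygies; [cores_seq] unrolls it into
    the sequence that [has_add_coresolution] asks for. *)
Fixpoint cores T s X : Prop :=
  if s is s'.+1 then
    exists C X' (i : {linear X -> C}) (p : {linear C -> X'}),
      [/\ in_add T C, ses i p & cores T s' X']
  else in_add T X.

Section ConsCores.
Variables (T X X' C0 : lmodType R) (C : nat -> lmodType R).
Variables (i : {linear X -> C0}) (p : {linear C0 -> X'}).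
Variables (eps : {linear X' -> C 0%N}) (d : forall j, {linear C j -> C j.+1}).
Definition ccons_obj j := if j is j'.+1 then C j' else C0.
Definition ccons_diff j : {linear ccons_obj j -> ccons_obj j.+1} :=
  match j with 0%N => lcomp eps p | j'.+1 => d j' end.
End ConsCores.

Lemma cores_seq T s X : cores T s X ->
  exists (C : nat -> lmodType R) (eps : {linear X -> C 0%N})
         (d : forall j, {linear C j -> C j.+1}),
    [/\ forall j, in_add T (C j), forall j, (s < j)%N -> zero_module (C j),
        injective eps, exact_at eps (d 0%N) & forall j, exact_at (d j) (d j.+1)].
Proof.
elim: s X => [|s IH] X /=.
  move=> aX; pose C (j : nat) : lmodType R := if j is 0%N then X else zmod0 R.
  have z0 j (x : C j.+1) : x = 0 by exact: zmod0P.
  exists C, (lid X), (fun j => lzero _ _); split.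
  - by case=> //= _; apply: add_zero => x; apply: zmod0P.
  - by case=> // j _ x; apply: z0.
  - by move=> x y; rewrite !lE.
  - by move=> y; rewrite lE; split=> [_|//]; exists y; rewrite lE.
  - move=> j y; split=> _; first by exists 0; rewrite lE (z0 _ y).
    by rewrite lE.
move=> [C0 [X' [i [p [aC0 sip /IH[C [eps [d [aC zC inj_e ex0 ex]]]]]]]]].
have [inj_i _ sp] := sip.
exists (ccons_obj C0 C), i, (ccons_diff p eps d); split=> //.
- by case=> //= j.
- by case=> //= j sj; apply: zC.
- move=> y /=; rewrite lE; split=> [|[x <-]]; last by rewrite (ses0 _ sip) linear0.
  by rewrite -[X in _ = X](linear0 eps) => /inj_e/(ses_ker sip).
- case=> [|j] y /=; last exact: ex.
  rewrite ex0; split=> [[x <-]|[x <-]]; last by exists (p x); rewrite lE.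
  by have [z <-] := sp x; exists z; rewrite lE.
Qed.

End Tilting.

Section AuslanderReiten.
Variables (K : fieldType) (R : pzRingType) (io : K -> R) (fd : fdalg io).
Implicit Types M N X Y Z C E I J L T : lmodType R.

Section Approximations.
Hypothesis CF : fin_pd_contravariantly_finite R.

(* Minimality is enforced by the K-dimension; the powers of an endomorphism g *)
(* over M stabilize (Fitting), and their common image is an approximation.    *)
Lemma min_approx M : fin_gen M ->
  exists X (phi : {linear X -> M}), [/\ approx phi, surj phi &
    forall g : {linear X -> X}, (forall x, phi (g x) = phi x) ->
      exists2 w : {linear X -> X}, cancel g w & cancel w g].
Proof.
move=> fM.
pose Pd n := `[< exists X (phi : {linear X -> M}), approx phi /\ hasdim fd X n >].
have exP : exists n, Pd n.
  have [X [phi [pX aX]]] := CF fM; have [n dX] := hasdim_exists fd pX.1.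
  by exists n; apply/asboolP; exists X, phi.
have [n /asboolP[X [phi [ap dX]]] nmin] := ex_minnP exP.
exists X, phi; split=> // [y|g phig].
  have [m [p sp]] := (fin_genP M).1 fM.
  have [g gE] := ap.2 _ p (fin_pd_free R m).
  by have [x <-] := sp y; exists (g x).
have phipow k x : phi (lpow g k x) = phi x.
  by elim: k => [|k IH] /=; rewrite !lE // phig.
suff inj_g : injective g.
  have [_ sg] := hasdim_inj inj_g dX dX.
  by have [w] := lin_bij inj_g (sg erefl); exists w.
pose Qd d := `[< exists k I (e : {linear X -> I}) (i : {linear I -> X}),
  [/\ surj e, injective i, forall x, i (e x) = lpow g k.+1 x & hasdim fd I d] >].
have exQ : exists d, Qd d.
  have [I [e [i [se inj_i ie]]]] := image_fact (lpow g 1).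
  have [d dI] := hasdim_exists fd (fg_surj se ap.1.1).
  by exists d; apply/asboolP; exists 0%N, I, e, i.
have [d /asboolP[k [I [e [i [se inj_i ie dI]]]]] dmin] := ex_minnP exQ.
(* [u] is the power [g^(k+1)] restricted to its own image [I]. Minimality of [d] makes it
   bijective. *)
pose u := lcomp e i.
have [J [e' [i' [se' inj_i' ie']]]] := image_fact u.
have [c dJ] := hasdim_exists fd (fg_surj se' (fg_surj se ap.1.1)).
have dc : (d <= c)%N.
  apply: dmin; apply/asboolP; exists (k.+1 + k)%N, J, (lcomp e' e), (lcomp i i').
  split=> [y|x y|x|//].
  - by have [x <-] := se' y; have [z <-] := se x; exists z; rewrite lE.
  - by rewrite !lE => /inj_i/inj_i'.
  - by rewrite (lcompE i i') (lcompE e' e) ie' -addnS lpowD -!ie (lcompE e i).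
have [cd scd] := hasdim_inj inj_i' dJ dI.
have ecd : c = d by apply/eqP; rewrite eqn_leq cd dc.
have su : surj u.
  by move=> y; have [x <-] := scd ecd y; have [z <-] := se' x; exists z; rewrite ie'.
have [_ inj_u] := hasdim_surj su dI dI.
have [v uv vu] := lin_bij (inj_u erefl) su.
(* [I] is a summand of [X] because [v \o e] retracts [i], and it approximates [M] because powers of
   [g] are maps over [M]. Minimality of [n] then gives [I] the dimension of [X], so [e], and with it
   [g], is injective. *)
have apI : approx (lcomp phi i).
  split=> [|Y f pY]; first apply: fin_pd_summand ap.1.
    by exists i, (lcomp v e) => x; rewrite lE -[e _](lcompE e i) uv.
  have [h hE] := ap.2 _ f pY; exists (lcomp e h) => y.
  by rewrite !lE ie phipow hE.
have nd : (n <= d)%N by apply: nmin; apply/asboolP; exists I, (lcomp phi i).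
have [dn] := hasdim_inj inj_i dI dX.
have edn : d = n by apply/eqP; rewrite eqn_leq dn nd.
subst n => _; have [_ inj_e] := hasdim_surj se dX dI.
apply: lin_inj => x gx; apply: (inj_e erefl); apply: inj_i.
by rewrite !ie -addn1 !lpowD /= !lE gx !linear0.
Qed.

(** Wakamatsu's lemma. Pushing a presentation of [Z] out along [kap \o f] gives [E] in [fin_pd]. The
    map [phi] extends to [E] by zero on the free module and lifts to [h : E -> X]. On [X] this lift
    is invertible by minimality, and its inverse corrects [h] into an extension of [f]. *)
Lemma wakamatsu M X L (phi : {linear X -> M}) (kap : {linear L -> X}) :
  approx phi -> ses kap phi ->
  (forall g : {linear X -> X}, (forall x, phi (g x) = phi x) ->
      exists2 w : {linear X -> X}, cancel g w & cancel w g) ->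
  perp L.
Proof.
move=> ap s mn Z pZ; have [inj_k _ _] := s.
have [n [N [i [p s']]]] := fg_ses pZ.1; apply: (E1_pres (proj_free n) s') => f.
have [E [a [b [q [saq ab qb gen univ]]]]] := pushout (lcomp kap f) s'.
have pE : fin_pd E := fin_pd_ext saq ap.1 pZ.
have [l|psi [psia psib]] := univ _ phi (lzero _ _).
  by rewrite !lE (ses0 _ s).
have [h hE] := ap.2 _ psi pE.
have [x|w hw wh] := mn (lcomp h a); first by rewrite lE hE psia.
have phiw x : phi (w x) = phi x by rewrite -[in RHS](wh x) lcompE hE psia.
have [y|k kE] := ses_lift (h := lcomp w (lcomp h b)) s.
  by rewrite !lE phiw hE psib lE.
exists k => l; apply: inj_k; rewrite kE !lE -ab !lE.
by rewrite -(lcompE h a) hw.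
Qed.

Definition special N X L (phi : {linear X -> N}) (kap : {linear L -> X}) :=
  [/\ fin_pd X, ses kap phi & perp L].

Lemma special_exists N : fin_gen N ->
  exists X L (phi : {linear X -> N}) (kap : {linear L -> X}), special phi kap.
Proof.
move=> /min_approx[X [phi [ap sphi mn]]]; have [L [kap s]] := ses_surj sphi.
exists X, L, phi, kap; split=> //; first exact: ap.1.
exact: wakamatsu ap s mn.
Qed.

(** The special approximation [X] of [dualR] is an extension of one module of [perp] by another,
    hence lies in [perp]. An embedding of [M] into a power of [dualR] lifts to a power of [X], again
    injectively. *)
Lemma strong_cogen_exists : exists T, strong_cogen T.
Proof.
have [X [L [phi [kap [pX s pL]]]]] := special_exists (dualR_fg fd).
exists X; split=> // [Z pZ|M pM].
  have [n [N [i [p s']]]] := fg_ses pZ.1.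
  by apply: (E1_ext (proj_free n) s' s (pL _ pZ)); apply: dualR_inj pZ.1.
have [n [f inj_f]] := dualR_cogen fd pM.1.
have /choice[g gE] k : exists g : {linear M -> X}, forall x, phi (g x) = f x k.
  have [g gE] := E1_lift (lcomp (lproj k) f) (pL _ pM) s; exists g => x.
  by rewrite gE lE lprojE.
exists n, (ltuple g); apply: lin_inj => x /ffunP gx; apply: inj_f.
rewrite linear0; apply/ffunP=> k; rewrite -gE.
by have := gx k; rewrite ltupleE !ffunE => ->; rewrite linear0.
Qed.

Definition special_pd d N := exists X L (phi : {linear X -> N}) (kap : {linear L -> X}),
  special phi kap /\ PD d X.

Lemma special_pd_le c d N : (c <= d)%N -> special_pd c N -> special_pd d N.
Proof.
move=> cd [X [L [phi [kap [sp pX]]]]]; exists X, L, phi, kap; split=> //.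
exact: PD_le cd pX.
Qed.

(** Pulling back along [X'' -> N''] gives an extension [E] of [X''] by [N']. A syzygy of [X''] lies
    in [fin_pd] and [L'] in [perp], so the class of [E] lifts along [f'] to an extension [X] of
    [X''] by [X']. The kernel of [X -> N] is an extension of [L''] by [L']. *)
Lemma horseshoe d N' N N'' (u : {linear N' -> N}) (w : {linear N -> N''}) :
  ses u w -> special_pd d N' -> special_pd d N'' -> special_pd d N.
Proof.
move=> s [X' [L' [f' [k' [[fX' s' pL'] pX']]]]].
move=> [X'' [L'' [f'' [k'' [[fX'' s'' pL''] pX'']]]]].
have [E [e1 [e2 [be eE e0]]]] := pullback w f''.
have [c sc _] := pull_ses be eE e0 s.
have [c' sc' _] : exists2 c' : {linear L'' -> E}, ses c' e1 &
    forall x, e2 (c' x) = k'' x.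
  apply: (pull_ses (b := f'') (f := w)) => // [x y fw|z z2 z1].
    by have [z z1 z2] := eE y x (esym fw); exists z.
  exact: e0.
have [n [L [l [t slt]]]] := fg_ses fX''.1; have [_ _ se2] := sc.
have fL := fin_pd_ses fd (proj_free n) (fg_free _ n) slt fX''.
have [r rE] := @proj_free R n _ _ e2 t se2.
have [x|m mE] := ses_lift (h := lcomp r l) sc; first by rewrite lE rE (ses0 _ slt).
have [la laE] := E1_lift m (pL' _ fL) s'.
have [X [a [b [q [saq ab qb gen univ]]]]] := pushout la slt.
have [x|th [tha thb]] := univ _ (lcomp c f') r; first by rewrite lE laE mE lE.
have qth x : q x = e2 (th x).
  have [x' [y ->]] := gen x; rewrite !linearD tha thb qb rE lE.
  by rewrite (ses0 _ saq) (ses0 _ sc).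
have [inj_a _ _] := saq; have [inj_k' _ sf'] := s'; have [inj_c _ _] := sc.
have st : ses (lcomp a k') th.
  split=> [x y|x|z].
  - by rewrite !lE => /inj_a/inj_k'.
  - split=> [thx|[y <-]]; last by rewrite lE tha lE (ses0 _ s') linear0.
    have [|x' ax] := ses_ker (x := x) saq; first by rewrite qth thx linear0.
    have /(ses_ker s')[y ky] : f' x' = 0.
      by apply: inj_c; rewrite linear0 -(lcompE c) -tha ax.
    by exists y; rewrite lE ky.
  - have [_ _ sq] := saq; have [x qx] := sq (e2 z).
    have [|n' cn] := ses_ker (x := z - th x) sc; first by rewrite linearB -qth qx subrr.
    have [x' fx] := sf' n'; exists (a x' + x).
    by rewrite linearD tha lE fx cn subrK.
have [_ _ se1] := sc'; have [_ _ sth] := st.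
have [|L0 [k0 s0]] := @ses_surj _ _ _ (lcomp e1 th).
  by move=> y; have [z <-] := se1 y; have [x <-] := sth z; exists x; rewrite lE.
have [a0 [b0 [s1 _ _]]] := ses_comp st sc' s0.
exists X, L0, (lcomp e1 th), k0; split; last exact: PD_ext saq pX' pX''.
split=> //; first exact: fin_pd_ext saq fX' fX''.
move=> Z pZ; have [m' [N0 [i0 [p0 s2]]]] := fg_ses pZ.1.
exact: (E1_ext (proj_free m') s2 s1 (pL' _ pZ) (pL'' _ pZ)).
Qed.

Lemma coker_dim L M N (i : {linear L -> M}) (p : {linear M -> N}) m n :
  ses i p -> ~ zero_module L -> hasdim fd M m -> hasdim fd N n -> (n < m)%N.
Proof.
move=> s nL dM dN; have [inj_i _ sp] := s; have [nm e] := hasdim_surj sp dM dN.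
rewrite ltn_neqAle nm andbT; apply/eqP => /e inj_p; apply: nL => x.
by apply: inj_i; apply: inj_p; rewrite (ses0 _ s) !linear0.
Qed.

Lemma ker_dim L M N (i : {linear L -> M}) (p : {linear M -> N}) l m :
  ses i p -> ~ zero_module N -> hasdim fd L l -> hasdim fd M m -> (l < m)%N.
Proof.
move=> s nN dL dM; have [inj_i _ sp] := s; have [lm e] := hasdim_inj inj_i dL dM.
rewrite ltn_neqAle lm andbT; apply/eqP => /e si; apply: nN => y.
by have [x <-] := sp y; have [z <-] := si x; rewrite (ses0 _ s).
Qed.

(* By induction on the dimension of M: a nonzero image of M contains a nonzero *)
(* image of a proper submodule or quotient of M, or else is isomorphic to M.   *)
Lemma special_pd_image M : fin_gen M -> exists d, forall N (h : {linear M -> N}),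
  fin_gen N -> ~ (forall x, h x = 0) ->
  exists L (j : {linear L -> N}),
    [/\ injective j, ~ zero_module L, fin_gen L & special_pd d L].
Proof.
move=> fM; have [m dM] := hasdim_exists fd fM.
elim: m {-2}m (leqnn m) M fM dM => [|m IH] k km M fM dM.
  move: km; rewrite leqn0 => /eqP k0; subst k; move/hasdim0: dM => M0.
  by exists 0%N => N h _ []; move=> x; rewrite (M0 x) linear0.
have [[M' [M'' [i [p [s nM' nM'']]]]]|simp] := pselect (exists M' M''
    (i : {linear M' -> M}) (p : {linear M -> M''}),
    [/\ ses i p, ~ zero_module M' & ~ zero_module M'']).
  have [inj_i _ sp] := s; have fM' := fg_sub fd inj_i fM; have fM'' := fg_surj sp fM.
  have [m' dM'] := hasdim_exists fd fM'; have [m'' dM''] := hasdim_exists fd fM''.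
  have lt1 := ker_dim s nM'' dM' dM; have lt2 := coker_dim s nM' dM dM''.
  have [d1 h1] := IH m' (leq_trans lt1 km) _ fM' dM'.
  have [d2 h2] := IH m'' (leq_trans lt2 km) _ fM'' dM''.
  exists (maxn d1 d2) => N h fN nh.
  have [hi|hi] := pselect (forall x, h (i x) = 0).
    have [h' hE] := ses_desc s hi.
    have [|L [j [inj_j nL fL gL]]] := h2 _ h' fN.
      by move=> h0; apply: nh => x; rewrite -hE.
    by exists L, j; split=> //; apply: special_pd_le gL; apply: leq_maxr.
  have [|L [j [inj_j nL fL gL]]] := h1 _ (lcomp h i) fN.
    by move=> h0; apply: hi => x; rewrite -lcompE.
  by exists L, j; split=> //; apply: special_pd_le gL; apply: leq_maxl.
(* Every submodule of [M] is now zero or everything, so a nonzero [h] is injective and [M] itself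
   serves as [L]. *)
have [X [L [phi [kap sp]]]] := special_exists fM.
have [_ [d pX]] := (fin_pdP X).1 (let: And3 h _ _ := sp in h).
exists d => N h fN nh; exists M, h; split=> //; last by exists X, L, phi, kap.
  have [I [e [i [se inj_i ie]]]] := image_fact h.
  have [M' [k' s]] := ses_surj se; apply: lin_inj => x hx.
  apply: contrapT => nx; apply: simp; exists M', I, k', e; split=> // [M'0|I0].
    have [|y ky] := ses_ker (x := x) s; first by apply: inj_i; rewrite ie hx linear0.
    by apply: nx; rewrite -ky (M'0 y) linear0.
  by apply: nh => y; rewrite -ie (I0 (e y)) linear0.
by move=> M0; apply: nh => x; rewrite (M0 x) linear0.
Qed.

(** A nonzero element of [N] is a nonzero map from the regular module, so [special_pd_image] at the
    regular module yields one bound for a nonzero submodule of every nonzero [N]. [horseshoe] and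
    induction on the dimension do the rest. *)
Lemma special_pd_all : exists d, forall N, fin_gen N -> special_pd d N.
Proof.
have [d dP] := special_pd_image (fg_reg R); exists d => N fN.
have [n dN] := hasdim_exists fd fN.
elim: n {-2}n (leqnn n) N fN dN => [|n IH] k kn N fN dN.
  move: kn; rewrite leqn0 => /eqP k0; subst k.
  move/hasdim0: dN => N0.
  exists N, (zmod0 R), (lid N), (lzero _ _); split; last first.
    by apply: PD_le (leq0n d) _; apply: proj_iso proj0; apply: iso_zero N0 (@zmod0P _).
  split; [exact: fin_pd_zero | exact: ses_lid |].
  by move=> Z pZ L X i p s f; exists (lzero _ _) => x; rewrite lE; apply/esym/zmod0P.
have [N0|/existsNP[x x0]] := pselect (zero_module N).
  exact: (IH 0%N (leq0n n) N fN ((hasdim0 fd N).2 N0)).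
have [|L [j [inj_j nL fL gL]]] := dP N (lmul x) fN.
  by move=> /(_ 1); rewrite lmulE scale1r.
have [N'' [w s]] := ses_inj inj_j; have [_ _ sw] := s.
have fN'' := fg_surj sw fN; have [n'' dN''] := hasdim_exists fd fN''.
have nn : (n'' <= n)%N by rewrite -ltnS; apply: leq_trans (coker_dim s nL dN dN'') kn.
exact: horseshoe s gL (IH n'' nn _ fN'' dN'').
Qed.

(* A module of finite projective dimension is a direct summand of its special *)
(* approximation.                                                             *)
Lemma findim_bound : exists d, forall M, fin_pd M -> PD d M.
Proof.
have [d dP] := special_pd_all; exists d => M pM.
have [X [L [phi [kap [[pX s pL] dX]]]]] := dP _ pM.1.
have [r rk] := E1_split (pL _ pM) s; have [t tE _] := ses_section s rk.
by apply: PD_summand dX; exists t, phi.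
Qed.

End Approximations.

(** Embed into powers of [T] repeatedly; cokernels stay in [fin_pd]. By [E1_shift] the j-th cokernel
    is Ext-orthogonal to modules of dimension at most [j], so at j = d the next embedding splits. *)
Lemma strong_cores T d : strong_cogen T -> (forall M, fin_pd M -> PD d M) ->
  forall X, fin_pd X -> cores T d X.
Proof.
move=> [pT eT emb] bd.
suff H t j X : (t + j = d)%N -> fin_pd X ->
    (forall N, fin_pd N -> PD j N -> E1 N X) -> cores T t X.
  by move=> X pX; apply: (H d 0%N) => // [|N _ pN]; [rewrite addn0 | apply: E1_proj].
elim: t j X => [|t IH] j X tj pX eX; have [n [f inj_f]] := emb _ pX;
    have [X' [p s]] := ses_inj inj_f;
    have pX' := fin_pd_quot s pX (fin_pd_ffun n pT).
  have e : E1 X' X by apply: eX => //; rewrite -[j]add0n tj; apply: bd.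
  have [r fr] := E1_split e s; apply: (@add_summand _ _ _ {ffun 'I_n -> T}).
    by exists f, r.
  exact: add_ffun.
exists {ffun 'I_n -> T}, X', f, p; split=> //; first exact: add_ffun.
apply: (IH j.+1) => // [|N pN dN]; first by rewrite addnS -addSn.
have [m [L [i [q s']]]] := fg_ses pN.1.
apply: (E1_shift (proj_free m) s' s (E1_ffun (eT _ pN))); apply: eX.
  exact: (fin_pd_ses fd (proj_free m) (fg_free _ m) s' pN).
exact: PD_ker (proj_free m) s' dN.
Qed.

Lemma strong_cogen_tilting T d : strong_cogen T ->
  (forall M, fin_pd M -> PD d M) -> strong_tilting T.
Proof.
move=> sT bd; have [pT eT _] := sT.
have sE := strong_ext fd eT; split=> //; split=> //; first exact: sE.
have [C [eps [dd h]]] :=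
  cores_seq (strong_cores sT bd (fin_pd_proj (fg_reg R) proj_reg)).
by exists d, C, eps, dd.
Qed.

End AuslanderReiten.

(** * Square-free modules and endomorphism rings *)

Section SquareFree.
Variable R : pzRingType.
Implicit Types M N T : lmodType R.

(* Stronger than basic_module, where N ranges over indecomposable modules. *)
Definition sqfree M := forall N, direct_summand (N * N)%type M -> zero_module N.

Lemma sqfree_basic M : sqfree M -> basic_module M.
Proof. by move=> sM N [nN _] /sM. Qed.

Lemma add_prod T M N : in_add T M -> in_add T N -> in_add T (M * N)%type.
Proof.
move=> [m hM] [n hN]; exists (m + n)%N.
exact: summand_trans (summand_prod hM hN) (iso_summand (ffunD_iso m n T)).
Qed.

Lemma add_ffun_in T M n : in_add T M -> in_add T {ffun 'I_n -> M}.
Proof.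
move=> aM; elim: n => [|n IH]; first exact/add_zero/zero_ffun0.
exact: add_summand (iso_summand (iso_sym (ffunS_iso n M))) (add_prod aM IH).
Qed.

Lemma ffun_iso n M N : iso_modules M N ->
  iso_modules {ffun 'I_n -> M} {ffun 'I_n -> N}.
Proof.
move=> [f [g [fg gf]]].
exists (ltuple (fun k => lcomp f (lproj k))), (ltuple (fun k => lcomp g (lproj k))).
by split=> x; apply/ffunP=> k; rewrite !(ltupleE, lE, lprojE) ?fg ?gf.
Qed.

Lemma add_trans T T' M : in_add T M -> in_add T' T -> in_add T' M.
Proof. by move=> [n h] aT; apply: add_summand h (add_ffun_in n aT). Qed.

End SquareFree.

(** The condition in [iso_End], with the isomorphism named. *)
Definition is_End (R B : pzRingType) (T : lmodType R) (phi : B -> {linear T -> T}) :=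
  [/\ forall a b x, phi (a + b) x = phi a x + phi b x,
      forall x, phi 1 x = x,
      forall a b x, phi (a * b) x = phi a (phi b x),
      forall a b, phi a =1 phi b -> a = b
    & forall f : {linear T -> T}, exists a, phi a =1 f].

(* The regular module is square-free: x y and y x are orthogonal idempotents *)
(* with isomorphic images.                                                   *)
Definition sqfree_ring (A : pzRingType) := forall x y : A,
  x * y * (x * y) = x * y -> y * x * (y * x) = y * x ->
  x * y * (y * x) = 0 -> y * x * (x * y) = 0 -> x * y = 0.

Lemma sqfree_ring_op A : sqfree_ring A -> sqfree_ring A^c.
Proof. by move=> sA x y h1 h2 h3 h4; apply: (sA y x). Qed.

Section SquareFreeEnd.
Variables (R B : pzRingType) (T : lmodType R) (phi : B -> {linear T -> T}).
Hypothesis E : is_End phi.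

Lemma is_End0 x : phi 0 x = 0.
Proof.
have [aD _ _ _ _] := E; apply: (@addIr _ (phi 0 x)).
by rewrite -aD !add0r.
Qed.

(** Let [N] be the image of [x * y]. Since [x * y] and [y * x] are orthogonal, [y] carries [N] to a
    second independent copy in [T], and [x] brings it back. *)
Lemma sqfree_End : sqfree T -> sqfree_ring B.
Proof.
have [aD a1 aM inj _] := E => sT x y h1 h2 h3 h4.
have p0 b c z : b * c = 0 -> phi b (phi c z) = 0 by rewrite -aM => ->; apply: is_End0.
have [N [f [i [sf inj_i fi]]]] := image_fact (phi (x * y)).
have iN n : phi (x * y) (i n) = i n by have [t <-] := sf n; rewrite fi -aM h1.
suff N0 : zero_module N.
  by apply: inj => t; rewrite -fi (N0 (f t)) linear0 is_End0.
apply: sT; exists (lcase i (lcomp (phi y) i)), (lpair f (lcomp f (phi x))) => -[m n].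
have fE t u : phi (x * y) t = i u -> f t = u by rewrite -fi => /inj_i.
rewrite lpairE !lcompE lcaseE lcompE /=; congr (_, _); apply: fE.
  rewrite linearD iN -[i n]iN -!aM.
  have -> : x * y * y * (x * y) = x * y * (y * x) * y by rewrite !mulrA.
  by rewrite h3 mul0r is_End0 addr0.
rewrite !linearD -!aM -(mulrA (x * y) x y) h1 iN -[i m]iN -aM.
have -> : x * y * x * (x * y) = x * (y * x * (x * y)) by rewrite !mulrA.
by rewrite h4 mulr0 is_End0 add0r.
Qed.

(** Take [x] and [y] moving the second copy of [N] to the first and the first to the second; [x * y]
    and [y * x] are then the projections onto the two copies. *)
Lemma sqfree_of_ring : sqfree_ring B -> sqfree T.
Proof.
have [aD a1 aM inj su] := E => sB N [i [p ip]].
have [x xE] := su (lcomp (lcomp i linl) (lcomp lsnd p)).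
have [y yE] := su (lcomp (lcomp i linr) (lcomp lfst p)).
have xyE t : phi (x * y) t = i ((p t).1, 0) by rewrite aM xE yE !lE ip.
have yxE t : phi (y * x) t = i (0, (p t).2) by rewrite aM xE yE !lE ip.
suff xy0 : x * y = 0.
  move=> n; have := xyE (i (n, 0)); rewrite xy0 is_End0 ip => /esym e.
  by have := ip (n, 0); rewrite e linear0 => -[].
have i0 : i (0, 0) = 0 by exact: linear0.
apply: (sB x y); apply: inj => t; rewrite ?is_End0 aM !(xyE, yxE) ip //.
Qed.

End SquareFreeEnd.

Lemma end_mulE (R : pzRingType) (T : lmodType R) (f g : endT T) x :
  homL (f * g) x = homL f (homL g x).
Proof. by rewrite -[f * g]/(end_mul f g) toHE lE. Qed.

Lemma end_oneE (R : pzRingType) (T : lmodType R) x : homL (1 : endT T) x = x.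
Proof. by rewrite -[1 : endT T]/(end_one T) toHE lE. Qed.

Lemma is_End_endT (R : pzRingType) (T : lmodType R) :
  @is_End R (endT T) T (fun f => homL f).
Proof.
split=> [a b x|x|a b x|a b|f].
- exact: homLD.
- exact: end_oneE.
- exact: end_mulE.
- exact: homP.
- by exists (toH f) => x; apply: toHE.
Qed.

Section RegularEnd.
Variable A : pzRingType.
Fact rmulo_subproof (a : A) : linear (fun x : A^o => (x : A) * a : A^o).
Proof. by move=> b x y; rewrite mulrDl /GRing.scale /= mulrA. Qed.
Definition rmulo (a : A^c) : {linear A^o -> A^o} := mkL (rmulo_subproof a).
Lemma rmuloE a x : rmulo a x = (x : A) * (a : A). Proof. exact: mkLE. Qed.

Lemma is_End_reg : @is_End A A^c A^o rmulo.
Proof.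
split=> [a b x|x|a b x|a b e|f].
- by rewrite !rmuloE mulrDr.
- by rewrite rmuloE mulr1.
- by rewrite !rmuloE mulrA.
- by have := e 1; rewrite !rmuloE !mul1r.
- by exists (f 1 : A) => x; rewrite rmuloE [RHS]lmul_ext.
Qed.

Lemma sqfree_ring_basic : sqfree_ring A -> basic_module (A^o : lmodType A).
Proof.
move=> sA; apply: sqfree_basic; apply: (sqfree_of_ring is_End_reg).
exact: sqfree_ring_op.
Qed.
End RegularEnd.

Section Fd.
Variables (K : fieldType) (R : pzRingType) (io : K -> R) (fd : fdalg io).
Implicit Types M N X Z E J T U : lmodType R.

(** The base ring is [K]. In a descending chain of ideals of a field either every member contains 1,
    or some member lacks 1 and is therefore zero. *)
Lemma fd_artin : artin_algebra R.
Proof.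
have zm : zmod_morphism io.
  move=> a b; apply/eqP; rewrite eq_sym subr_eq -(fdD fd).
  by rewrite subrK.
have mm : monoid_morphism io by split; [exact: fd1 fd | exact: fdM fd].
pose f : {rmorphism K -> R} := HB.pack io
  (GRing.isZmodMorphism.Build K R io zm) (GRing.isMonoidMorphism.Build K R io mm).
exists K, f; split; [|exact: fdC fd|].
  move=> J tJ dJ; have unit n x : J n x -> x != 0 -> J n 1.
    move=> Jx x0; have [_ _ m] := tJ n; have := m x^-1 x 1 Jx.
    by rewrite mulr1 mulVf.
  have dJm n m x : (n <= m)%N -> J m x -> J n x.
    by move=> /subnK <-; elim: (m - n)%N => // k IH; rewrite addSn => /dJ.
  have [h|/existsNP[n nJ]] := pselect (forall n, J n 1).
    exists 0%N => m _ x _; have [_ _ mm'] := tJ m.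
    by have := mm' x 1 1 (h m); rewrite !mulr1.
  exists n => m nm x Jx; have [x0|/(unit _ _ Jx) //] := eqVneq x 0.
  by rewrite x0; have [] := tJ m.
have [n [s sP]] := fd_span fd; have [l [nl lE']] := ex_seq s; exists l => x.
have [c ->] := sP x; subst n; exists c.
by apply: eq_bigr => k _; rewrite lE'.
Qed.

(** Among the summands [T'] of [T] with [T] in add(T'), take one of minimal dimension. If
    [N * N * Z] is [T'], then [N * Z] is another candidate, smaller unless [N] is zero. *)
Lemma sqfree_reduce T : fin_gen T ->
  exists T', [/\ sqfree T', direct_summand T' T & in_add T' T].
Proof.
move=> fT; pose Pd n := `[< exists T',
  [/\ hasdim fd T' n, direct_summand T' T & in_add T' T] >].
have exP : exists n, Pd n.
  have [n dT] := hasdim_exists fd fT; exists n; apply/asboolP; exists T.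
  by split=> //; [exact: iso_summand (iso_refl T) | exact: add_self].
have [n /asboolP[T' [dT' sT' aT']] nmin] := ex_minnP exP.
exists T'; split=> // N hN; apply: contrapT => nN.
have [Z iso] := direct_summand_compl hN.
have hT'' : direct_summand (N * Z)%type T'.
  apply: summand_trans (summand_prod (summandl N N) (iso_summand (iso_refl Z))) _.
  exact: iso_summand (iso_sym iso).
have fT' := fg_summand sT' fT.
have [m dm] := hasdim_exists fd (fg_summand hT'' fT').
have aN : in_add (N * Z)%type N := add_summand (summandl N Z) (add_self _).
have aZ : in_add (N * Z)%type Z := add_summand (summandr N Z) (add_self _).
have aT'' : in_add (N * Z)%type T'.
  by apply: add_summand (iso_summand iso) _; do 2 apply: add_prod => //.
have nm : (n <= m)%N.
  apply: nmin; apply/asboolP; exists (N * Z)%type; split=> //.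
    exact: summand_trans hT'' sT'.
  exact: add_trans aT' aT''.
have [f [g [fg gf]]] := iso.
pose h : {linear (N * Z)%type -> T'} := lcomp g (lprod linl (lid Z)).
have inj_h : injective h.
  by move=> [a b] [c d]; rewrite !lE => /(can_inj gf) [-> ->].
have [mn] := hasdim_inj inj_h dm dT'.
have emn : m = n by apply/eqP; rewrite eqn_leq mn nm.
move=> /(_ emn) sh; apply: nN => x; have [z] := sh (g ((0, x), 0)).
by rewrite !lE => /(can_inj gf) [_ <-].
Qed.

Lemma strong_cogen_add T T' : direct_summand T' T -> in_add T' T ->
  strong_cogen T -> strong_cogen T'.
Proof.
move=> h aT [pT eT emb]; split=> [|M pM|M pM].
- exact: fin_pd_summand h pT.
- exact: E1_summand2 h (eT _ pM).
have [n [f inj_f]] := emb _ pM; have [m [i [r ir]]] := add_ffun_in n aT.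
by exists m, (lcomp i f) => x y; rewrite !lE => /(can_inj ir)/inj_f.
Qed.

Lemma strong_cogen_prod U T : fin_pd U -> perp U -> strong_cogen T ->
  strong_cogen (U * T)%type.
Proof.
move=> pU eU [pT eT emb]; split=> [|M pM|M pM].
- exact: fin_pd_prod.
- exact: E1_prod2 (eU _ pM) (eT _ pM).
have [n [f inj_f]] := emb _ pM.
exists n, (ltuple (fun k => lcomp linr (lcomp (lproj k) f))).
apply: lin_inj => x /ffunP fx; apply: inj_f; rewrite linear0; apply/ffunP=> k.
by have := fx k; rewrite ltupleE !ffunE !lE lprojE => -[].
Qed.

Section HomK.
Variables X N : lmodType R.

Fact hscale_subproof (c : K) (f : homT X N) :
  linear (fun x => io c *: homL f x).
Proof.
move=> a x y; rewrite linearP scalerDr !scalerA; congr (_ *: _ + _).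
exact: fdC fd _ _.
Qed.
Definition hscale c f : homT X N := toH (mkL (hscale_subproof c f)).
Lemma hscaleE c f x : homL (hscale c f) x = io c *: homL f x.
Proof. by rewrite toHE (mkLE (hscale_subproof c f)). Qed.

Fact hscaleA a b f : hscale a (hscale b f) = hscale (a * b) f.
Proof. by apply: homP => x; rewrite !hscaleE scalerA (fdM fd). Qed.
Fact hscale1 f : hscale 1 f = f.
Proof. by apply: homP => x; rewrite hscaleE (fd1 fd) scale1r. Qed.
Fact hscaleDr a f g : hscale a (f + g) = hscale a f + hscale a g.
Proof. by apply: homP => x; rewrite homLD !hscaleE homLD scalerDr. Qed.
Fact hscaleDl a b f : hscale (a + b) f = hscale a f + hscale b f.
Proof. by apply: homP => x; rewrite homLD !hscaleE (fdD fd) scalerDl. Qed.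
Definition hom_actK := Action hscaleA hscale1 hscaleDr hscaleDl.
Definition homK : lmodType K := boxmod hom_actK.

Fact hev_subproof (x : X) :
  linear (fun f : homK => bx (res_act fd N) (homL (unb f) x)).
Proof.
move=> a f g; have -> : unb (a *: f + g) = hscale a (unb f) + unb g by [].
by rewrite homLD hscaleE bxD.
Qed.
Definition hev x : {linear homK -> res fd N} := mkL (hev_subproof x).
Lemma hevE x f : hev x f = bx (res_act fd N) (homL (unb f) x).
Proof. exact: mkLE. Qed.

Lemma homK_fg : fin_gen X -> fin_gen N -> fin_gen homK.
Proof.
move=> /fin_genP[n [p sp]] fN.
apply: (@vs_sub _ _ _ (ltuple (fun k => hev (p (fbase R k))))); last first.
  exact/fg_ffun/fg_res.
apply: lin_inj => f /ffunP f0; apply: unb_inj; rewrite unb0; apply: homP => x.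
rewrite homL0; have [z <-] := sp x.
have h : lcomp (homL (unb f)) p =1 lzero _ _.
  apply: ext_free => k; rewrite !lE; have := f0 k.
  by rewrite ltupleE hevE ffunE => /(congr1 unb).
by have := h z; rewrite !lE.
Qed.
End HomK.

Lemma endT_fd T : fin_gen T -> fdalg (fun c => hscale c (1 : endT T) : endT T).
Proof.
move=> fT; have E c x : homL (hscale c (1 : endT T)) x = io c *: x.
  by rewrite hscaleE end_oneE.
split.
- by move=> a b; apply: homP => x; rewrite homLD !E (fdD fd) scalerDl.
- by move=> a b; apply: homP => x; rewrite end_mulE !E (fdM fd) scalerA.
- by apply: homP => x; rewrite E (fd1 fd) scale1r end_oneE.
- by move=> c f; apply: homP => x; rewrite !end_mulE !E linearZ_LR.
have /fin_genP[n [p sp]] := homK_fg fT fT.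
exists n, (fun k => unb (p (fbase K k)) : endT T) => f.
have [c pc] := sp (bx _ f); exists c.
rewrite -[LHS](bxK (hom_actK T T)) -pc [in LHS]free_comb unb_sum.
apply: eq_bigr => k _; apply: homP => x.
by rewrite end_mulE E unbZ /= hscaleE.
Qed.

End Fd.

(** * The duality Hom(-, T) *)

Definition is_act (R B : pzRingType) (T : lmodType R) (phi : B -> {linear T -> T}) :=
  [/\ forall a b x, phi (a + b) x = phi a x + phi b x,
      forall x, phi 1 x = x
    & forall a b x, phi (a * b) x = phi a (phi b x)].

Lemma is_End_act (R B : pzRingType) (T : lmodType R) (phi : B -> {linear T -> T}) :
  is_End phi -> is_act phi.
Proof. by case. Qed.

Section HomFunctor.
Variables (R B : pzRingType) (T : lmodType R) (phi : B -> {linear T -> T}).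
Hypothesis H : is_act phi.
Implicit Types M N X Y L : lmodType R.

Definition post X b (f : homT X T) : homT X T := toH (lcomp (phi b) (homL f)).
Lemma postE X b (f : homT X T) x : homL (post b f) x = phi b (homL f x).
Proof. by rewrite toHE lE. Qed.

Fact post_A X a b (f : homT X T) : post a (post b f) = post (a * b) f.
Proof. by have [_ _ m] := H; apply: homP => x; rewrite !postE m. Qed.
Fact post_1 X (f : homT X T) : post 1 f = f.
Proof. by have [_ o _] := H; apply: homP => x; rewrite !postE o. Qed.
Fact post_Dr X a (f g : homT X T) : post a (f + g) = post a f + post a g.
Proof. by apply: homP => x; rewrite homLD !postE homLD linearD. Qed.
Fact post_Dl X a b (f : homT X T) : post (a + b) f = post a f + post b f.
Proof. by have [d _ _] := H; apply: homP => x; rewrite homLD !postE d. Qed.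
Definition post_act X : action B (homT X T) :=
  Action (@post_A X) (@post_1 X) (@post_Dr X) (@post_Dl X).
(* Hom(X, T), with B acting through its action on T. *)
Definition DX X : lmodType B := boxmod (post_act X).

Definition dL X (f : DX X) : {linear X -> T} := homL (unb f).
Definition dB X (f : {linear X -> T}) : DX X := bx (post_act X) (toH f).
Lemma dBE X f x : dL (dB f : DX X) x = f x.
Proof. exact: toHE. Qed.
Lemma dP X (f g : DX X) : (forall x, dL f x = dL g x) -> f = g.
Proof. by move=> fg; apply: unb_inj; apply: homP. Qed.
Lemma dD X (f g : DX X) x : dL (f + g) x = dL f x + dL g x.
Proof. by rewrite /dL unbD homLD. Qed.
Lemma dZ X b (f : DX X) x : dL (b *: f) x = phi b (dL f x).
Proof. by rewrite /dL unbZ postE. Qed.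
Lemma d0 X x : dL (0 : DX X) x = 0.
Proof. by rewrite /dL unb0 homL0. Qed.

Lemma d_sum X n (F : 'I_n -> DX X) x :
  dL (\sum_k F k) x = \sum_k dL (F k) x.
Proof. exact: (big_morph (fun f => dL f x) (fun f g => dD f g x) (d0 x)). Qed.

Fact Dmap_subproof X Y (g : {linear X -> Y}) :
  linear (fun f : DX Y => dB (lcomp (dL f) g) : DX X).
Proof.
by move=> b f f'; apply: dP => x; rewrite dD dZ !dBE !lE dD dZ.
Qed.
Definition Dmap X Y (g : {linear X -> Y}) : {linear DX Y -> DX X} :=
  mkL (Dmap_subproof g).
Lemma DmapE X Y (g : {linear X -> Y}) f x : dL (Dmap g f) x = dL f (g x).
Proof. by rewrite (mkLE (Dmap_subproof g)) dBE lE. Qed.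

Lemma D_ses L X M (i : {linear L -> X}) (p : {linear X -> M}) :
  ses i p -> E1 M T -> ses (Dmap p) (Dmap i).
Proof.
move=> s e; have [_ _ sp] := s; split=> [f g fg|f|f].
- apply: dP => y; have [x <-] := sp y.
  by rewrite -!DmapE fg.
- split=> [fi|[g <-]]; last by apply: dP => x; rewrite !DmapE (ses0 _ s) linear0 d0.
  have [x|g gE] := ses_desc (h := dL f) s; first by rewrite -DmapE fi d0.
  by exists (dB g); apply: dP => x; rewrite DmapE dBE gE.
- have [g gE] := e _ _ _ _ s (dL f); exists (dB g).
  by apply: dP => x; rewrite DmapE dBE gE.
Qed.

Lemma D_summand M N : direct_summand M N -> direct_summand (DX M) (DX N).
Proof.
move=> [i [p ip]]; exists (Dmap p), (Dmap i) => f; apply: dP => x.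
by rewrite !DmapE ip.
Qed.

Lemma D_ffun n M : iso_modules (DX {ffun 'I_n -> M}) {ffun 'I_n -> DX M}.
Proof.
apply: (@ffun_biprod _ _ _ _ (fun k => Dmap (lproj k)) (fun k => Dmap (linj k))).
  move=> k l f; apply: dP => x; rewrite !DmapE lprojE linjE eq_sym.
  by case: ifP => _; rewrite ?linear0 ?d0.
move=> f; apply: dP => x; rewrite d_sum [in RHS](linj_proj x) linear_sum.
by apply: eq_bigr => k _; rewrite !DmapE lprojE.
Qed.

Fact sharp_A a b x : phi a (phi b x) = phi (a * b) x.
Proof. by have [_ _ m] := H. Qed.
Fact sharp_1 x : phi 1 x = x.
Proof. by have [_ o _] := H. Qed.
Fact sharp_Dr a x y : phi a (x + y) = phi a x + phi a y.
Proof. exact: linearD. Qed.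
Fact sharp_Dl a b x : phi (a + b) x = phi a x + phi b x.
Proof. by have [d _ _] := H. Qed.
Definition sharp_act : action B T := Action sharp_A sharp_1 sharp_Dr sharp_Dl.
(* T regarded as a module over the ring B acting on it. *)
Definition sharp : lmodType B := boxmod sharp_act.

Fact sharpD_subproof :
  linear (fun t : sharp => dB (lmul (unb t)) : DX (R^o : lmodType R)).
Proof.
move=> b x y; apply: dP => r; rewrite dD dZ !dBE !lmulE unbD unbZ /=.
by rewrite scalerDr linearZ_LR.
Qed.
Lemma sharp_D : iso_modules sharp (DX (R^o : lmodType R)).
Proof.
have [||g fg gf] := @lin_bij _ _ _ (mkL sharpD_subproof).
- move=> x y; rewrite !(mkLE sharpD_subproof) => e; apply: unb_inj.
  have := congr1 (fun f : DX (R^o : lmodType R) => dL f (1 : R)) e.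
  by rewrite /= !dBE !lmulE !scale1r.
- move=> f; exists (bx sharp_act (dL f (1 : R))).
  rewrite (mkLE sharpD_subproof); apply: dP => r.
  by rewrite dBE lmulE [RHS]lmul_ext.
by exists (mkL sharpD_subproof), g.
Qed.

Fact ract_subproof (r : R) :
  linear (fun t : sharp => bx sharp_act (r *: unb t)).
Proof.
move=> b x y; rewrite unbD unbZ scalerDr bxD; congr (_ + _).
by rewrite -bxZ /= linearZ_LR.
Qed.
Definition ract (r : R) : {linear sharp -> sharp} := mkL (ract_subproof r).
Lemma ractE r t : ract r t = bx sharp_act (r *: unb t).
Proof. exact: mkLE. Qed.

Lemma ract_act : is_act ract.
Proof.
split=> [a b x|x|a b x]; rewrite !ractE.
- by rewrite scalerDl bxD.
- by rewrite scale1r unbK.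
- by rewrite bxK scalerA.
Qed.

End HomFunctor.

Section Duality.
Variables (R B : pzRingType) (T : lmodType R) (phi : B -> {linear T -> T}).
Hypothesis E : is_End phi.
Let H := is_End_act E.
Local Notation DX := (DX H).
Implicit Types M X C : lmodType R.

Fact D_T_subproof : linear (fun b : B^o => dB H (phi (b : B))).
Proof.
have [d _ m] := H; move=> c a b; apply: dP => x.
by rewrite dD dZ !dBE d m.
Qed.
Lemma D_T : iso_modules (DX T) (B^o : lmodType B).
Proof.
have [_ _ _ inj su] := E; apply: iso_sym.
have [||g fg gf] := @lin_bij _ _ _ (mkL D_T_subproof).
- move=> x y; rewrite !(mkLE D_T_subproof) => e; apply: inj => t.
  by have := congr1 (fun f => dL f t) e; rewrite /= !dBE.
- move=> f; have [b be] := su (dL f); exists b.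
  by rewrite (mkLE D_T_subproof); apply: dP => t; rewrite dBE be.
by exists (mkL D_T_subproof), g.
Qed.

Lemma D_add M : in_add T M -> exists n, direct_summand (DX M) {ffun 'I_n -> B^o}.
Proof.
move=> [n h]; exists n; apply: summand_trans (D_summand H h) _.
apply: iso_summand; apply: iso_trans (D_ffun H n T) _.
exact: ffun_iso D_T.
Qed.

Lemma D_add_fin_pd M : in_add T M -> fin_pd (DX M).
Proof. by move=> /D_add[n h]; apply: fin_pd_summand h (fin_pd_free B n). Qed.

(** Hom(-, T) turns the coresolution of [X] by add(T) into a resolution of [DX X] by summands of
    free modules. Exactness holds because all cosyzygies lie in [fin_pd]. *)
Lemma D_fin_pd s X : strong_cogen T -> fin_pd X -> cores T s X -> fin_pd (DX X).
Proof.
move=> sT; have [pT eT _] := sT.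
elim: s X => [|s IH] X pX /=; first by move=> /D_add_fin_pd.
move=> [C [X' [i [p [[n h] sip cX']]]]].
have pC : fin_pd C := fin_pd_summand h (fin_pd_ffun n pT).
have pX' := fin_pd_quot sip pX pC.
apply: fin_pd_quot (D_ses H sip (eT _ pX')) (IH _ pX' cX') _.
by apply: D_add_fin_pd; exists n.
Qed.

(* Double centralizer property: R = End_B(T). *)
Lemma is_End_ract : strong_cogen T -> is_End (ract H).
Proof.
move=> [pT eT emb]; have [a1 a2 a3] := ract_act H.
have pR : fin_pd (R^o : lmodType R) := fin_pd_proj (fg_reg R) proj_reg.
have [n [i inj_i]] := emb _ pR; have [X [p s]] := ses_inj inj_i.
have pX := fin_pd_quot s pR (fin_pd_ffun n pT).
have [m [j inj_j]] := emb _ pX; have [_ _ _ inj su] := E.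
pose t := i (1 : R).
have iE (r : R^o) : i r = (r : R) *: t by rewrite [LHS]lmul_ext.
split=> // [a b e|th].
  apply: (inj_i); rewrite !iE; apply/ffunP=> k; rewrite !ffunE.
  by have := e (bx _ (t k)); rewrite !ractE bxK => /(congr1 unb).
pose th' x := unb (th (bx (sharp_act H) x)).
have thphi b x : th' (phi b x) = phi b (th' x).
  by rewrite /th' (bxZ (sharp_act H) b) linearZ_LR unbZ.
have thD x y : th' (x + y) = th' x + th' y by rewrite /th' bxD linearD unbD.
have th0 : th' 0 = 0 by rewrite /th' bx0 linear0 unb0.
(* [R] embeds in [T^n] by 1 |-> t, with cokernel embedded in [T^m], so [R] is the kernel of
   [h : T^n -> T^m]. The entries of [h] lie in [B], so they commute with [th']. Hence [h] kills the
   image of [t] too, and that image is [r0 *: t]. *)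
pose h := lcomp j p.
have /choice[b bE] (kl : 'I_n * 'I_m) :
    exists b, forall x, phi b x = h (linj kl.1 x) kl.2.
  have [b be] := su (lcomp (lproj kl.2) (lcomp h (linj kl.1))).
  by exists b => x; rewrite be !lE lprojE.
have hE x l : h x l = \sum_k phi (b (k, l)) (x k).
  rewrite [in LHS](linj_proj x) linear_sum sum_ffunE.
  by apply: eq_bigr => k _; rewrite bE.
have [|r0 ir] := ses_ker (x := [ffun k => th' (t k)]) s.
  apply: inj_j; rewrite linear0 -(lcompE j p); apply/ffunP=> l.
  have e : h t l = 0 by rewrite /h lE (ses0 _ s) linear0 ffunE.
  rewrite hE ffunE -[RHS]th0 -[X in _ = th' X]e [in RHS]hE.
  rewrite (big_morph th' thD th0); apply: eq_bigr => k _.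
  by rewrite ffunE thphi.
exists r0 => x; rewrite ractE; apply: unb_inj; rewrite bxK.
(* Extending 1 |-> x from [R] to [T^n] writes [x] as a [B]-combination of the coordinates of [t],
   where [th'] is already known. *)
have [g gE] := eT _ pX _ _ _ _ s (lmul (unb x)).
have /choice[c cE] k : exists b, forall y, phi b y = g (linj k y).
  by have [b' be] := su (lcomp g (linj k)); exists b' => y; rewrite be lE.
have gS z : g z = \sum_k phi (c k) (z k).
  by rewrite [in LHS](linj_proj z) linear_sum; apply: eq_bigr => k _; rewrite cE.
have xE : unb x = \sum_k phi (c k) (t k).
  by rewrite -gS /t gE lmulE scale1r.
transitivity (th' (unb x)); last by rewrite /th' unbK.
rewrite {2}xE (big_morph th' thD th0).
transitivity (\sum_k phi (c k) (th' (t k))); last by apply: eq_bigr => k _; rewrite thphi.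
transitivity (g [ffun k => th' (t k)]); last by rewrite gS; apply: eq_bigr => k _; rewrite ffunE.
by rewrite -ir gE lmulE.
Qed.

End Duality.

(** * T as a module over its endomorphism ring, and duality back to R *)

Section Biduality.
Variables (R B : pzRingType) (T : lmodType R) (phi : B -> {linear T -> T}).
Hypothesis E : is_End phi.
Let H := is_End_act E.
Let H' := ract_act H.
Local Notation Ts := (sharp H).
Local Notation D' := (DX H').
Implicit Types M X Y Z C D L S : lmodType B.

Lemma dual_reg : iso_modules (D' (B^o : lmodType B)) T.
Proof.
apply: iso_sym; apply: iso_trans (sharp_D H').
have lin1 : linear (fun t : T => bx (sharp_act H') (bx (sharp_act H) t)).
  move=> a x y; rewrite bxD bxD; congr (_ + _).
  by rewrite -bxZ /= ractE bxK.
have lin2 : linear (fun t : sharp H' => unb (unb t : Ts)).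
  move=> a x y; have -> : unb (unb (a *: x + y) : Ts) =
    unb (ract H a (unb x : Ts)) + unb (unb y : Ts) by [].
  by rewrite ractE bxK.
exists (mkL lin1), (mkL lin2); split=> t; rewrite (mkLE lin1) (mkLE lin2) ?bxK //.
by rewrite !unbK.
Qed.

Lemma dual_free n : iso_modules (D' {ffun 'I_n -> B^o}) {ffun 'I_n -> T}.
Proof. exact: iso_trans (D_ffun H' n _) (ffun_iso n dual_reg). Qed.

(* T-duals of free B-modules are reflexive, because B is all of End(T). *)
Lemma dual_eval q (h : {linear D' {ffun 'I_q -> B^o} -> T}) :
  exists x, forall f, h f = unb (dL f x).
Proof.
pose g (l : 'I_q) (t : Ts) : {linear {ffun 'I_q -> B^o} -> Ts} :=
  lcomp (lmul t) (lproj l).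
have gE l t x : g l t x = (x l : B) *: t by rewrite lE lmulE lprojE.
have lin l : linear (fun t : T => h (dB H' (g l (bx (sharp_act H) t)))).
  move=> a x y; rewrite -linearP; congr (h _); apply: dP => z.
  rewrite dD dZ !dBE !gE ractE bxD scalerDr; congr (_ + _).
  by rewrite unbZ /= -linearZ_LR.
have [_ _ _ _ su] := E.
have /choice[b bE] l : exists b, forall t, phi b t = mkL (lin l) t by exact: su.
exists [ffun l => b l] => f; rewrite free_comb unb_sum.
have fE : f = \sum_l dB H' (g l (dL f (fbase B l))).
  apply: dP => x; rewrite [LHS]free_comb d_sum.
  by apply: eq_bigr => l _; rewrite dBE gE.
rewrite {1}fE linear_sum; apply: eq_bigr => l _.
by rewrite ffunE unbZ /= bE (mkLE (lin l)) unbK.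
Qed.

Lemma dual_sep q (x : {ffun 'I_q -> B^o}) :
  (forall f : {linear {ffun 'I_q -> B^o} -> Ts}, f x = 0) -> x = 0.
Proof.
move=> f0; have [_ _ _ inj _] := E; apply/ffunP=> l; rewrite ffunE.
apply: inj => t; rewrite (is_End0 E).
have := f0 (lcomp (lmul (bx (sharp_act H) t)) (lproj l)).
by rewrite lE lmulE lprojE => /(congr1 unb); rewrite unbZ unb0.
Qed.

Section Strong.
Variables (K : fieldType) (ioR : K -> R) (ioB : K -> B).
Hypotheses (fdR : fdalg ioR) (fdB : fdalg ioB) (sT : strong_cogen T).

(** Hom(-, T) turns a free presentation into an embedding in a power of [Ts], the dual of the
    regular module. For Z = T, whose dual is [B], this is the coresolution of [B]. *)
Lemma sharp_cores n (Z : lmodType R) :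
  fin_pd Z -> PD n Z -> cores Ts n (DX H Z).
Proof.
have [pT eT _] := sT; elim: n Z => [|n IH] Z pZ dZ /=.
  have [m h] := fg_proj_free pZ.1 dZ; exists m.
  apply: summand_trans (D_summand H h) _.
  apply: iso_summand; apply: iso_trans (D_ffun H m _) _.
  exact/ffun_iso/iso_sym/sharp_D.
have [m [L [i [p s]]]] := fg_ses pZ.1.
exists (DX H {ffun 'I_m -> R^o}), (DX H L), (Dmap H p), (Dmap H i); split.
- exists m; apply: iso_summand; apply: iso_trans (D_ffun H m _) _.
  exact/ffun_iso/iso_sym/sharp_D.
- exact: D_ses s (eT _ pZ).
apply: IH; first exact: (fin_pd_ses fdR (proj_free m) (fg_free _ m) s pZ).
exact: PD_ker (proj_free m) s dZ.
Qed.

Lemma cores_iso S (X Y : lmodType B) s : iso_modules X Y -> cores S s X -> cores S s Y.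
Proof.
case: s => [|s] iso /=; first exact: add_summand (iso_summand (iso_sym iso)).
move=> [C [X' [i [p [aC [inj_i ex sp] cX']]]]]; have [f [g [fg gf]]] := iso.
exists C, X', (lcomp i g), p; split=> //; split=> // [x y|y].
  by rewrite !lE => /inj_i/(can_inj gf).
rewrite ex; split=> [[x <-]|[x <-]]; last by exists (g x); rewrite lE.
by exists (f x); rewrite lE fg.
Qed.

Lemma sharp_coresolution : has_add_coresolution Ts.
Proof.
have [pT _ _] := sT; have [_ [n dT]] := (fin_pdP T).1 pT.
have [C [eps [d h]]] := cores_seq (cores_iso (D_T E) (sharp_cores pT dT)).
by exists n, C, eps, d.
Qed.

Lemma sharp_fin_pd d : (forall M : lmodType R, fin_pd M -> PD d M) -> fin_pd Ts.
Proof.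
move=> bd; apply: fin_pd_iso (sharp_D H) _.
have pR : fin_pd (R^o : lmodType R) := fin_pd_proj (fg_reg R) proj_reg.
exact: (D_fin_pd E sT pR (strong_cores fdR sT bd pR)).
Qed.

Lemma dual_free_fin_pd q : fin_pd (D' {ffun 'I_q -> B^o}).
Proof.
have [pT _ _] := sT; exact: fin_pd_iso (dual_free q) (fin_pd_ffun q pT).
Qed.

(** Present [Z] by [B^m -> B^n]. If no map [Z -> Ts] is nonzero, the dual map [f] from [T^n] to
    [T^m] is injective with cokernel in [fin_pd]. Evaluation at any [x] in [B^n] then extends along
    [f], where it is evaluation at some [y], so [x] is the image of [y]. *)
Lemma sharp_cogen Z : fin_gen Z -> (forall (h : {linear Z -> Ts}) z, h z = 0) ->
  zero_module Z.
Proof.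
move=> fZ hZ; have [n [L [i [p s]]]] := fg_ses fZ; have [inj_i _ sp] := s.
have fL := fg_sub fdB inj_i (fg_free B n).
have [m [a sa]] := (fin_genP L).1 fL.
pose f := Dmap H' (lcomp i a).
have inj_f : injective f.
  apply: lin_inj => g fg; apply: dP => x; rewrite d0.
  have [y|g' g'E] := ses_desc (h := dL g) s.
    have [w <-] := sa y; have := congr1 (fun u => dL u w) fg.
    by rewrite /= DmapE d0 lE.
  by rewrite -g'E hZ.
have [X [q s']] := ses_inj inj_f; have [_ eT _] := sT.
have eX := eT _ (fin_pd_quot s' (dual_free_fin_pd n) (dual_free_fin_pd m)).
move=> z; have [x <-] := sp z.
have lin : linear (fun g : D' {ffun 'I_n -> B^o} => unb (dL g x)).
  by move=> r g g'; rewrite dD dZ unbD ractE bxK.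
have [h hE] := eX _ _ _ _ s' (mkL lin); have [y yE] := dual_eval h.
suff -> : x = i (a y) by rewrite (ses0 _ s).
apply/subr0_eq/dual_sep => g; rewrite linearB; apply/eqP; rewrite subr_eq0; apply/eqP.
have := hE (dB H' g); rewrite yE (mkLE lin) DmapE !dBE lE => e.
by apply: unb_inj; rewrite e.
Qed.

Hypothesis cog : forall Z : lmodType R, fin_gen Z ->
  (forall (h : {linear Z -> T}) z, h z = 0) -> zero_module Z.

(** The cokernel of the map from the dual of [X] to that of [B^q] is the dual of [L], so [h] extends
    to the dual of [B^q], where [dual_eval] applies. *)
Lemma dual_reflexive q L X (j : {linear L -> {ffun 'I_q -> B^o}})
    (p : {linear {ffun 'I_q -> B^o} -> X}) :
  ses j p -> E1 X Ts -> fin_pd (D' L) ->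
  forall h : {linear D' X -> T}, exists x, forall f, h f = unb (dL f x).
Proof.
move=> s eX pL h; have [_ eT _] := sT.
have [h' h'E] := eT _ pL _ _ _ _ (D_ses H' s eX) h.
have [y yE] := dual_eval h'; exists (p y) => f.
by rewrite -h'E yE DmapE.
Qed.

(** Ext^1(M, Ts) is the cokernel [Z] of restriction from the dual of [B^m] to that of the syzygy
    [L]. A map [Z -> T] is evaluation at some point of [L] on which all maps from [B^m] vanish, so
    it is zero, and [cog] gives Z = 0. The induction also needs the dual of [M] in [fin_pd], which
    exactness then provides. *)
Lemma sharp_strong_dual n M : fin_gen M -> PD n M -> E1 M Ts /\ fin_pd (D' M).
Proof.
elim: n M => [|n IH] M fM dM.
  split; first exact: E1_proj.
  have [m h] := fg_proj_free fM dM.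
  exact: fin_pd_summand (D_summand H' h) (dual_free_fin_pd m).
have [m [L [i [p s]]]] := fg_ses fM; have [inj_i _ _] := s.
have fL := fg_sub fdB inj_i (fg_free B m).
have dL' : PD n L := PD_ker (proj_free m) s dM.
have [eL pL] := IH _ fL dL'.
(* Reflexivity of [L] asks for the dual of its own syzygy [L'] in [fin_pd], so the induction
   hypothesis is used two syzygies deep. *)
have [m' [L' [i' [p' s']]]] := fg_ses fL; have [inj_i' _ _] := s'.
have fL' := fg_sub fdB inj_i' (fg_free B m').
have [_ pL'] : E1 L' Ts /\ fin_pd (D' L').
  by apply: IH fL' (PD_le (leq_pred n) (PD_ker (proj_free m') s' dL')).
have eM : E1 M Ts.
  apply: (E1_pres (proj_free m) s) => f.
  have [Z [q [sq qP]]] := ex_quo (submod_im (Dmap H' i)).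
  have Z0 : zero_module Z.
    apply: cog => [|h z]; first exact: fg_surj sq pL.1.
    have [x xE] := dual_reflexive s' eL pL' (lcomp h q).
    have [y <-] := sq z; rewrite -(lcompE h q) xE.
    suff -> : x = 0 by rewrite linear0 unb0.
    apply: inj_i; rewrite linear0; apply: dual_sep => g.
    have := xE (Dmap H' i (dB H' g)); rewrite DmapE dBE lE.
    have /qP-> : exists y, Dmap H' i y = Dmap H' i (dB H' g) by exists (dB H' g).
    by rewrite linear0 => e; apply: unb_inj; rewrite -e unb0.
  have [g ge] : exists g, Dmap H' i g = dB H' f by apply/qP.
  by exists (dL g) => x; rewrite -DmapE ge dBE.
split=> //; apply: (fin_pd_sub fdR (D_ses H' s eM)) pL.
exact: dual_free_fin_pd.
Qed.

Lemma sharp_tilting d : (forall M : lmodType R, fin_pd M -> PD d M) ->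
  strong_tilting Ts.
Proof.
move=> bd; have pTs := sharp_fin_pd bd.
have sE := strong_ext fdB (T := Ts).
have e M : fin_pd M -> E1 M Ts.
  by move=> /fin_pdP[fM [n dM]]; have [] := sharp_strong_dual fM dM.
split; last exact: sE; split=> //; [exact: sE | exact: sharp_coresolution].
Qed.

End Strong.
End Biduality.

(** * Corner rings *)

(* j identifies S with the corner ring (j 1) G (j 1). *)
Record corner_map (S G : pzRingType) (j : S -> G) : Prop := CornerMap {
  cmD : forall a b, j (a + b) = j a + j b;
  cmM : forall a b, j (a * b) = j a * j b;
  cm_inj : injective j;
  cm_onto : forall g, exists s, j s = j 1 * g * j 1
}.

Section CornerFunctor.
Variables (S G : pzRingType) (j : S -> G) (cm : corner_map j).
Implicit Types M N Q X Y Z L I C : lmodType G.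
Local Notation e := (j 1).

Lemma cm_e a : e * j a = j a. Proof. by rewrite -(cmM cm) mul1r. Qed.
Lemma cm_er a : j a * e = j a. Proof. by rewrite -(cmM cm) mulr1. Qed.
Lemma cm0 : j 0 = 0.
Proof. by apply: (@addIr _ (j 0)); rewrite -(cmD cm) !add0r. Qed.

Section Fix.
Variable M : lmodType G.
Definition fix_pred : {pred M} := fun x => e *: x == x.
Fact fix_closed : zmod_closed fix_pred.
Proof.
split=> [|x y]; first by rewrite unfold_in scaler0.
by rewrite !unfold_in scalerBr => /eqP-> /eqP->.
Qed.
HB.instance Definition _ := GRing.isZmodClosed.Build M fix_pred fix_closed.
Record fixT := FixT { fix_val : M; fix_valP : fix_val \in fix_pred }.
HB.instance Definition _ := [isSub for fix_val].
HB.instance Definition _ := [Choice of fixT by <:].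
HB.instance Definition _ := [SubChoice_isSubZmodule of fixT by <:].

Fact fix_act_subproof s (x : fixT) : j s *: fix_val x \in fix_pred.
Proof. by rewrite unfold_in scalerA cm_e. Qed.
Definition fix_fun s x := FixT (fix_act_subproof s x).
Fact fix_actA a b x : fix_fun a (fix_fun b x) = fix_fun (a * b) x.
Proof. by apply: val_inj; rewrite /= scalerA (cmM cm). Qed.
Fact fix_act1 x : fix_fun 1 x = x.
Proof. by apply: val_inj; apply/eqP; exact: (fix_valP x). Qed.
Fact fix_actDr a x y : fix_fun a (x + y) = fix_fun a x + fix_fun a y.
Proof. by apply: val_inj; rewrite /= scalerDr. Qed.
Fact fix_actDl a b x : fix_fun (a + b) x = fix_fun a x + fix_fun b x.
Proof. by apply: val_inj; rewrite /= (cmD cm) scalerDl. Qed.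
Definition fix_act : action S fixT :=
  Action fix_actA fix_act1 fix_actDr fix_actDl.
(* The S-module eM. *)
Definition FF : lmodType S := boxmod fix_act.

Definition fv (x : FF) : M := fix_val (unb x).
Lemma fvP x : e *: fv x = fv x.
Proof. by apply/eqP; exact: (fix_valP (unb x)). Qed.
Lemma fv_inj : injective fv.
Proof. by move=> x y xy; apply: unb_inj; apply: val_inj. Qed.
Lemma fvD x y : fv (x + y) = fv x + fv y. Proof. by []. Qed.
Lemma fvZ s x : fv (s *: x) = j s *: fv x. Proof. by []. Qed.
Lemma fv0 : fv 0 = 0. Proof. by []. Qed.

Lemma fv_sum n (F : 'I_n -> FF) : fv (\sum_k F k) = \sum_k fv (F k).
Proof. exact: (big_morph fv fvD fv0). Qed.

Fact fB_subproof (m : M) : e *: m \in fix_pred.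
Proof. by rewrite unfold_in scalerA cm_e. Qed.
Definition fB m : FF := bx fix_act (FixT (fB_subproof m)).
Lemma fBE m : fv (fB m) = e *: m. Proof. by []. Qed.
Lemma fvK x : fB (fv x) = x.
Proof. by apply: fv_inj; rewrite fBE fvP. Qed.
End Fix.
Arguments fv {M} x.

Section Fmap.
Variables (M N : lmodType G) (g : {linear M -> N}).
Fact Fmap_subproof : linear (fun x : FF M => fB (g (fv x))).
Proof.
move=> s x y; apply: fv_inj; rewrite fvD fvZ !fBE fvD fvZ linearP.
by rewrite scalerDr !scalerA cm_e cm_er.
Qed.
Definition Fmap : {linear FF M -> FF N} := mkL Fmap_subproof.
Lemma FmapE x : fv (Fmap x) = g (fv x).
Proof. by rewrite (mkLE Fmap_subproof) fBE -linearZ_LR fvP. Qed.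
End Fmap.

Lemma F_ses L X M (i : {linear L -> X}) (p : {linear X -> M}) :
  ses i p -> ses (Fmap i) (Fmap p).
Proof.
move=> s; have [inj_i _ sp] := s; split=> [x y xy|y|y].
- by apply: fv_inj; apply: inj_i; rewrite -!FmapE xy.
- split=> [py|[x <-]]; last by apply: fv_inj; rewrite !FmapE (ses0 _ s).
  have [|x ix] := ses_ker (x := fv y) s; first by rewrite -FmapE py fv0.
  by exists (fB x); apply: fv_inj; rewrite FmapE fBE linearZ_LR ix fvP.
- have [x px] := sp (fv y); exists (fB x); apply: fv_inj.
  by rewrite FmapE fBE linearZ_LR px fvP.
Qed.

Lemma F_summand M N : direct_summand M N -> direct_summand (FF M) (FF N).
Proof.
move=> [i [p ip]]; exists (Fmap i), (Fmap p) => x.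
by apply: fv_inj; rewrite !FmapE ip.
Qed.

Lemma F_ffun n M : iso_modules (FF {ffun 'I_n -> M}) {ffun 'I_n -> FF M}.
Proof.
apply: (@ffun_biprod _ _ _ _ (fun k => Fmap (linj k)) (fun k => Fmap (lproj k))).
  move=> k l x; apply: fv_inj; rewrite !FmapE lprojE linjE.
  by case: ifP.
move=> x; apply: fv_inj; rewrite fv_sum [RHS]linj_proj.
by apply: eq_bigr => k _; rewrite !FmapE lprojE.
Qed.

Local Notation GG := (G^o : lmodType G).

Section FinPd.
Variables (K : fieldType) (ioG : K -> G) (fdG : fdalg ioG).
Hypotheses (fgF : fin_gen (FF GG)) (prF : projective (FF GG)).
Hypothesis killF : forall N, fin_gen N -> zero_module (FF N) -> fin_pd N.

Lemma F_fg M : fin_gen M -> fin_gen (FF M).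
Proof.
move=> fM; have [n [L [i [p s]]]] := fg_ses fM.
have [_ _ sp] := F_ses s; apply: fg_surj sp _.
exact: fg_iso (iso_sym (F_ffun n GG)) (fg_ffun n fgF).
Qed.

Lemma F_proj_free n : projective (FF {ffun 'I_n -> G^o}).
Proof. by apply: proj_iso (F_ffun n GG) _; apply: proj_ffun. Qed.

Arguments F_proj_free : clear implicits.

Lemma F_PD n M : fin_gen M -> PD n M -> PD n (FF M).
Proof.
elim: n M => [|n IH] M fM dM.
  have [m h] := fg_proj_free fM dM.
  exact: proj_summand (F_summand h) (F_proj_free m).
have [m [L [i [p s]]]] := fg_ses fM; have [inj_i _ _] := s.
apply: PDS (F_proj_free m) (F_ses s) _; apply: IH.
  exact: (fg_sub fdG inj_i (fg_free G m)).
exact: (PD_ker (proj_free m) s dM).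
Qed.

Lemma ses_image M N (f : {linear M -> N}) : exists L I C
  (i : {linear L -> M}) (p : {linear M -> I}) (i' : {linear I -> N})
  (p' : {linear N -> C}), [/\ ses i p, ses i' p' & forall x, i' (p x) = f x].
Proof.
have [I [p [i' [sp inj_i' ip]]]] := image_fact f.
have [L [i s]] := ses_surj sp; have [C [p' s']] := ses_inj inj_i'.
by exists L, I, C, i, p, i', p'.
Qed.

(* A map that F inverts has kernel and cokernel killed by F. *)
Lemma F_bij_fin_pd M N (f : {linear M -> N}) : fin_pd M -> fin_gen N ->
  injective (Fmap f) -> surj (Fmap f) -> fin_pd N.
Proof.
move=> pM fN inj_f sf.
have [L [I [C [i [p [i' [p' [s s' ip]]]]]]]] := ses_image f.
have [inj_i _ sp] := s; have [inj_i' _ sp'] := s'.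
have pL : fin_pd L.
  apply: killF (fg_sub fdG inj_i pM.1) _ => x; apply: fv_inj; rewrite fv0.
  apply: inj_i; rewrite linear0 -FmapE -[RHS]fv0; congr fv.
  by apply: inj_f; rewrite linear0; apply: fv_inj; rewrite !FmapE -ip (ses0 _ s) linear0.
have pI := fin_pd_quot s pL pM.
apply: (fin_pd_ext s' pI); apply: killF (fg_surj sp' fN) _ => y.
have [_ _ sp2] := F_ses s'; have [n <-] := sp2 y; have [m <-] := sf n.
by apply: fv_inj; rewrite !FmapE -ip (ses0 _ s').
Qed.

(* The idempotent matrix over S that defines FF M defines over G a projective *)
(* module Q with a map Q -> M which FF inverts.                               *)
Lemma F_proj_fin_pd M : fin_gen M -> projective (FF M) -> fin_pd M.
Proof.
move=> fM pM; have [k [a [b ab]]] := fg_proj_free (F_fg fM) pM.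
pose m l : M := fv (b (fbase S l)).
pose th : {linear {ffun 'I_k -> G^o} -> {ffun 'I_k -> G^o}} :=
  comb (fun l => [ffun r => j (a (b (fbase S l)) r)] : {ffun 'I_k -> G^o}).
pose q (s : {ffun 'I_k -> S^o}) : {ffun 'I_k -> G^o} := [ffun r => j (s r)].
have thq s : th (q s) = q (a (b s)).
  apply/ffunP=> r; rewrite /th combE sum_ffunE ffunE [in RHS](free_comb b s).
  rewrite linear_sum sum_ffunE.
  rewrite (big_morph j (cmD cm) cm0); apply: eq_bigr => l _.
  by rewrite !ffunE linearZ_LR ffunE /GRing.scale /= (cmM cm).
have th_th y : th (th y) = th y.
  have h : lcomp th th =1 th.
    apply: ext_free => l; rewrite lE /th comb_fbase.
    by rewrite -[comb _]/th -/(q (a (b (fbase S l)))) thq ab.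
  by have := h y; rewrite lE.
have [Q [p [i [sp inj_i ip]]]] := image_fact th.
have pi x : p (i x) = x.
  by apply: inj_i; rewrite ip; have [y <-] := sp x; rewrite ip th_th.
have pQ : fin_pd Q by apply: fin_pd_summand (fin_pd_free G k); exists i, p.
pose be := comb m.
have beq s : be (q s) = fv (b s).
  rewrite /be combE (free_comb b s) fv_sum.
  by apply: eq_bigr => l _; rewrite ffunE fvZ.
have /choice[sg sgE] (x : FF Q) : exists s, i (fv x) = q s.
  have xe : e *: i (fv x) = i (fv x) by rewrite -linearZ_LR fvP.
  have xth : th (i (fv x)) = i (fv x) by rewrite -ip pi.
  have /choice[s sE] r : exists s, j s = i (fv x) r.
    have [s sE] := cm_onto cm (i (fv x) r); exists s; rewrite sE.
    have -> : e * i (fv x) r = i (fv x) r by rewrite -[in RHS]xe ffunE.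
    rewrite -xth /th combE sum_ffunE mulr_suml; apply: eq_bigr => l _.
    by rewrite !ffunE /GRing.scale /= -mulrA cm_er.
  by exists [ffun r => s r]; apply/ffunP=> r; rewrite !ffunE sE.
apply: (F_bij_fin_pd (f := lcomp be i)) => //.
  apply: lin_inj => x /(congr1 fv); rewrite FmapE lE sgE beq fv0 => b0.
  apply: fv_inj; rewrite fv0; apply: inj_i; rewrite linear0 sgE.
  have -> : q (sg x) = th (q (sg x)) by rewrite -sgE -[in RHS](pi (fv x)) ip th_th -ip pi.
  rewrite thq; have -> : b (sg x) = 0 by apply: fv_inj.
  by rewrite linear0; apply/ffunP=> r; rewrite !ffunE cm0.
move=> y; pose x := p (q (a y)).
have ix : i x = q (a y) by rewrite ip thq ab.
have ex : e *: x = x.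
  apply: inj_i; rewrite linearZ_LR ix; apply/ffunP=> r.
  by rewrite !ffunE; apply: cm_e.
exists (fB x); apply: fv_inj; rewrite FmapE fBE ex lE ix beq ab //.
Qed.

(** The functor [FF] is exact and keeps projectives, which gives one direction. For the other, pass
    to syzygies of [M] until [FF] of the syzygy is projective, and apply [F_proj_fin_pd]. *)
Lemma corner_fin_pd M : fin_gen M -> (fin_pd M <-> fin_pd (FF M)).
Proof.
move=> fM; split=> [/fin_pdP[_ [n dM]]|/fin_pdP[_ [n dM]]].
  by apply/fin_pdP; split; [exact: F_fg | exists n; exact: F_PD].
elim: n M fM dM => [|n IH] M fM dM; first exact: F_proj_fin_pd.
have [m [L [i [p s]]]] := fg_ses fM; have [inj_i _ _] := s.
apply: (fin_pd_quot s _ (fin_pd_free G m)); apply: IH.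
  exact: (fg_sub fdG inj_i (fg_free G m)).
exact: (PD_ker (F_proj_free m) (F_ses s) dM).
Qed.

End FinPd.

(** * The right adjoint of the corner functor and transfer of contravariant finiteness *)

Section Adjoint.
Variable N : lmodType S.

Definition pre_fun (g : G) (f : homT (FF GG) N) : homT (FF GG) N :=
  toH (lcomp (homL f) (Fmap (rmulo (g : G^c)))).
Lemma pre_funE g f x : homL (pre_fun g f) x = homL f (Fmap (rmulo (g : G^c)) x).
Proof. by rewrite toHE lE. Qed.
Fact pre_A a b f : pre_fun a (pre_fun b f) = pre_fun (a * b) f.
Proof.
apply: homP => x; rewrite !pre_funE; congr (homL _ _); apply: fv_inj.
by rewrite !FmapE !rmuloE mulrA.
Qed.
Fact pre_1 f : pre_fun 1 f = f.
Proof.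
apply: homP => x; rewrite pre_funE; congr (homL _ _); apply: fv_inj.
by rewrite FmapE rmuloE mulr1.
Qed.
Fact pre_Dr a f g : pre_fun a (f + g) = pre_fun a f + pre_fun a g.
Proof. by apply: homP => x; rewrite homLD !pre_funE homLD. Qed.
Fact pre_Dl a b f : pre_fun (a + b) f = pre_fun a f + pre_fun b f.
Proof.
apply: homP => x; rewrite homLD !pre_funE -linearD; congr (homL _ _); apply: fv_inj.
by rewrite fvD !FmapE !rmuloE mulrDr.
Qed.
Definition pre_act : action G (homT (FF GG) N) := Action pre_A pre_1 pre_Dr pre_Dl.
(* The right adjoint of FF. *)
Definition RA : lmodType G := boxmod pre_act.

Definition rL (f : RA) : {linear FF GG -> N} := homL (unb f).
Definition rB (f : {linear FF GG -> N}) : RA := bx pre_act (toH f).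
Lemma rBE f x : rL (rB f) x = f x. Proof. exact: toHE. Qed.
Lemma rP (f g : RA) : (forall x, rL f x = rL g x) -> f = g.
Proof. by move=> fg; apply: unb_inj; apply: homP. Qed.
Lemma rD (f g : RA) x : rL (f + g) x = rL f x + rL g x.
Proof. by rewrite /rL unbD homLD. Qed.
Lemma rZ a (f : RA) x : rL (a *: f) x = rL f (Fmap (rmulo (a : G^c)) x).
Proof. by rewrite /rL unbZ pre_funE. Qed.
Lemma r0 x : rL 0 x = 0.
Proof. by rewrite /rL unb0 homL0. Qed.

Definition fone : FF GG := fB (1 : GG).
Lemma foneE : fv fone = e.
Proof. by rewrite fBE /GRing.scale /= mulr1. Qed.

Fact ev_subproof : linear (fun f : FF RA => rL (fv f) fone).
Proof.
move=> s f g; rewrite fvD fvZ rD rZ; congr (_ + _).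
rewrite -linearZ_LR; congr (rL _ _); apply: fv_inj.
by rewrite FmapE rmuloE fvZ foneE /GRing.scale /= cm_e cm_er.
Qed.
Definition ev : {linear FF RA -> N} := mkL ev_subproof.
Lemma evE f : ev f = rL (fv f) fone. Proof. exact: mkLE. Qed.

Lemma FG_scale (x : FF GG) s : j s = (fv x : G) * e ->
  Fmap (rmulo (e : G^c)) x = s *: fone.
Proof.
move=> sE; apply: fv_inj; rewrite FmapE rmuloE fvZ foneE sE.
by rewrite /GRing.scale /= -mulrA cm_e.
Qed.

Lemma FG_coord (x : FF GG) : exists s, j s = (fv x : G) * e.
Proof.
have [s sE] := cm_onto cm (fv x : G); exists s; rewrite sE; congr (_ * _).
exact: (@fvP GG x).
Qed.

(** An element of [FF RA] is fixed by e, so it sees [x] in eG only through [x * e], which lies in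
    eGe. Its value at e therefore determines it, so that the counit [ev] is bijective. *)
Lemma ev_coord (f : FF RA) (x : FF GG) s : j s = (fv x : G) * e -> rL (fv f) x = s *: ev f.
Proof.
move=> sE; rewrite evE -linearZ_LR -(FG_scale sE).
by rewrite -{1}(fvP f) rZ.
Qed.

Lemma ev_inj : injective ev.
Proof.
apply: lin_inj => f f0; apply: fv_inj; rewrite fv0; apply: rP => x.
have [s sE] := FG_coord x.
by rewrite (ev_coord f sE) f0 scaler0 r0.
Qed.

Lemma ev_surj : surj ev.
Proof.
move=> n; have [sg sgE] := choice FG_coord.
have lin : linear (fun x : FF GG => sg x *: n).
  move=> a x y; rewrite scalerA -scalerDl; congr (_ *: _); apply: (cm_inj cm).
  rewrite (cmD cm) (cmM cm) !sgE fvD fvZ mulrDl; congr (_ + _).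
  by rewrite mulrA.
exists (fB (rB (mkL lin))); rewrite evE fBE rZ rBE (mkLE lin).
have -> : sg (Fmap (rmulo (e : G^c)) fone) = 1.
  by apply: (cm_inj cm); rewrite sgE FmapE rmuloE foneE !cm_e.
by rewrite scale1r.
Qed.

Section Adj.
Variables (Z : lmodType G) (f : {linear FF Z -> N}).
Fact adj_subproof : linear (fun z : Z => rB (lcomp f (Fmap (lmul z)))).
Proof.
move=> a x y; apply: rP => t; rewrite rD rZ !rBE !lE -linearD; congr (f _).
apply: fv_inj; rewrite fvD !FmapE !lmulE rmuloE.
by rewrite scalerDr scalerA.
Qed.
Definition adj : {linear Z -> RA} := mkL adj_subproof.
Lemma adjE z x : rL (adj z) x = f (Fmap (lmul z) x).
Proof. by rewrite (mkLE adj_subproof) rBE lE. Qed.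
End Adj.
End Adjoint.

Section RAmap.
Variables (N N' : lmodType S) (h : {linear N -> N'}).
Fact RAmap_subproof : linear (fun f : RA N => rB (lcomp h (rL f))).
Proof. by move=> a x y; apply: rP => t; rewrite rD rZ !rBE !lE rD rZ linearD. Qed.
Definition RAmap : {linear RA N -> RA N'} := mkL RAmap_subproof.
Lemma RAmapE f x : rL (RAmap f) x = h (rL f x).
Proof. by rewrite (mkLE RAmap_subproof) rBE lE. Qed.
End RAmap.

Section Transfer.
Variables (K : fieldType) (ioG : K -> G) (ioS : K -> S).
Hypotheses (fdG : fdalg ioG) (fdS : fdalg ioS).
Hypothesis ioj : forall c, j (ioS c) = ioG c * e.
Hypothesis fgF : fin_gen (FF GG).
Hypothesis equivF : forall M, fin_gen M -> (fin_pd M <-> fin_pd (FF M)).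

Lemma RA_fg (N : lmodType S) : fin_gen N -> fin_gen (RA N).
Proof.
move=> fN; apply: (res_fg (fd := fdG)).
have lin : linear (fun f : homK fdS (FF GG) N =>
    bx (res_act fdG (RA N)) (bx (pre_act N) (unb f))).
  move=> c f g; apply: unb_inj; apply: unb_inj; apply: homP => x.
  have -> : unb (unb (c *: bx (res_act fdG (RA N)) (bx (pre_act N) (unb f)) +
      bx (res_act fdG (RA N)) (bx (pre_act N) (unb g)))) =
    pre_fun (ioG c) (unb f) + unb g by [].
  have -> : unb (unb (bx (res_act fdG (RA N)) (bx (pre_act N) (unb (c *: f + g))))) =
    hscale fdS c (unb f) + unb g by [].
  rewrite !homLD hscaleE pre_funE -linearZ_LR; congr (homL _ _ + _).
  apply: fv_inj; rewrite FmapE rmuloE fvZ ioj -(fdC fdG).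
  by rewrite /GRing.scale /= -mulrA; congr (_ * _); exact: (@fvP GG x).
apply: (@fg_surj _ _ _ (mkL lin)); last exact: homK_fg.
move=> f; exists (bx (hom_actK fdS (FF GG) N) (unb (unb f))).
by rewrite (mkLE lin) bxK !unbK.
Qed.

(** Pull an approximation [psi : Y -> FF M] back along the unit from [M] to [RA (FF M)]. As [FF]
    after [RA] is the identity, [FF X] is [Y], hence [X] is in [fin_pd]; the factorizations come
    from the adjunction. *)
Lemma CF_of_corner : fin_pd_contravariantly_finite S -> fin_pd_contravariantly_finite G.
Proof.
move=> CF M fM; have fFM := F_fg fgF fM; have [Y [psi [pY aY]]] := CF _ fFM.
have [X [e1 [e2 [be eE e0]]]] := pullback (adj (lid (FF M))) (RAmap psi).
have inj_e : injective (lpair e1 e2).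
  by apply: lin_inj => z; rewrite lE => -[]; apply: e0.
have fX : fin_gen X := fg_sub fdG inj_e (fg_prod fM (RA_fg pY.1)).
have adjid z x : rL (adj (lid (FF M)) z) x = Fmap (lmul z) x by rewrite adjE lE.
have pX : fin_pd X.
  apply/(equivF fX); pose th := lcomp (ev Y) (Fmap e2).
  have inj_th : injective th.
    apply: lin_inj => x; rewrite lE -[RHS](linear0 (ev Y)) => /ev_inj x0.
    have x2 : e2 (fv x) = 0 by rewrite -FmapE x0 fv0.
    apply: fv_inj; rewrite fv0; apply: e0 => //.
    have := be (fv x); rewrite x2 linear0.
    move=> /(congr1 (fun f => fv (rL f fone))).
    by rewrite adjid r0 fv0 FmapE lmulE foneE -linearZ_LR fvP.
  have s_th : surj th.
    move=> y; have [f fy] := ev_surj y; have [|z z1 z2] := eE (fv (psi y)) (fv f).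
      apply: rP => x; rewrite adjid RAmapE; have [s sE] := FG_coord x.
      rewrite (ev_coord f sE) fy linearZ_LR; apply: fv_inj.
      by rewrite FmapE lmulE fvZ sE -scalerA fvP.
    exists (fB z); rewrite lE -fy; congr (ev _ _); apply: fv_inj.
    by rewrite FmapE fBE linearZ_LR z2 fvP.
  by have [g h1 h2] := lin_bij inj_th s_th; apply: fin_pd_iso pY; exists th, g.
exists X, e1; split=> // Z h pZ.
have [g gE] := aY _ (Fmap h) ((equivF pZ.1).1 pZ).
have [z|k kE] := factor_inj (h := lpair h (adj g)) inj_e.
  have [|x x1 x2] := eE (h z) (adj g z); last by exists x; rewrite !lE x1 x2.
  apply: rP => x; rewrite adjid RAmapE adjE gE; apply: fv_inj.
  by rewrite !FmapE !lmulE linearZ_LR.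
by exists k => z; have := kE z; rewrite !lE => -[].
Qed.

(** An approximation of [RA N], restricted to the corner and composed with the counit, approximates
    [N], because [RA] also preserves [fin_pd]. *)
Lemma CF_to_corner : fin_pd_contravariantly_finite G -> fin_pd_contravariantly_finite S.
Proof.
move=> CF N fN; have [X [xi [pX aX]]] := CF _ (RA_fg fN).
exists (FF X), (lcomp (ev N) (Fmap xi)); split=> [|Z h pZ].
  exact: (equivF pX.1).1 pX.
have [u uK Ku] := lin_bij (@ev_inj Z) (@ev_surj Z).
have pRZ : fin_pd (RA Z).
  apply/(equivF (RA_fg pZ.1)); apply: fin_pd_iso pZ; by exists (ev Z), u.
have [g gE] := aX _ (RAmap h) pRZ; exists (lcomp (Fmap g) u) => z.
rewrite !lE !evE !FmapE gE RAmapE; congr (h _).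
by rewrite -evE Ku.
Qed.

End Transfer.
End CornerFunctor.

(** * Triangular corners *)

Lemma dual_basis (S : pzRingType) (W : lmodType S) n (w : 'I_n -> W)
    (la : 'I_n -> {linear W -> S^o}) :
  (forall x, x = \sum_k (la k x : S) *: w k) -> fin_gen W /\ projective W.
Proof.
move=> xE; have h : direct_summand W {ffun 'I_n -> S^o}.
  exists (ltuple la), (comb w) => x; rewrite combE [RHS]xE.
  by apply: eq_bigr => k _; rewrite ltupleE.
split; first exact: fg_summand h (fg_free S n).
by apply: proj_summand h _; apply: proj_free.
Qed.

Lemma iso_quotients (R : pzRingType) (M N N' : lmodType R)
    (p : {linear M -> N}) (p' : {linear M -> N'}) : surj p -> surj p' ->
  (forall x, p x = 0 <-> p' x = 0) -> iso_modules N N'.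
Proof.
move=> sp sp' pp; have [x /pp //|f fE] := factor_surj (h := p') sp.
have [x /pp //|g gE] := factor_surj (h := p) sp'.
exists f, g; split=> y; first by have [x <-] := sp y; rewrite fE gE.
by have [x <-] := sp' y; rewrite gE fE.
Qed.

Section Triangular.
Variables (S G : pzRingType) (j : S -> G) (cm : corner_map j).
Local Notation e := (j 1).
Hypothesis tri : forall g, e * g = e * g * e.
Local Notation GG := (G^o : lmodType G).
Local Notation FF := (FF cm).
Implicit Types M N X Y L : lmodType G.

Lemma tri_iso : iso_modules (FF GG) (S^o : lmodType S).
Proof.
apply: iso_sym; pose f := lmul (fone cm).
have fvf a : fv (f a) = j a by rewrite lmulE fvZ foneE; apply: (cm_er cm).
have inj_f : injective f.
  by move=> a b ab; apply: (cm_inj cm); rewrite -!fvf ab.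
have sf : surj f.
  move=> x; have [s sE] := FG_coord x; exists s; apply: fv_inj.
  have h : e * (fv x : G) = fv x by exact: (@fvP _ _ _ cm GG x).
  by rewrite fvf sE -h -tri.
by have [g h1 h2] := lin_bij inj_f sf; exists f, g.
Qed.

Lemma tri_fg : fin_gen (FF GG).
Proof. exact: fg_iso (iso_sym tri_iso) (fg_reg S). Qed.

Lemma tri_proj : projective (FF GG).
Proof. exact: proj_iso tri_iso proj_reg. Qed.

(* Since e G (1 - e) = 0, the compression g |-> e g e is a ring morphism G -> S. *)
Fact rho_ex g : exists s, j s = e * g * e.
Proof. exact: cm_onto cm g. Qed.
Definition rho g : S := projT1 (cid (rho_ex g)).
Lemma rhoE g : j (rho g) = e * g * e.
Proof. exact: projT2 (cid (rho_ex g)). Qed.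
Lemma rho_j s : rho (j s) = s.
Proof. by apply: (cm_inj cm); rewrite rhoE (cm_e cm) (cm_er cm). Qed.
Lemma rho1 : rho 1 = 1.
Proof. by apply: (cm_inj cm); rewrite rhoE mulr1 (cm_e cm). Qed.
Lemma rhoM a b : rho (a * b) = rho a * rho b.
Proof.
apply: (cm_inj cm); rewrite (cmM cm) !rhoE mulrA [in LHS]tri.
by rewrite -!mulrA [e * (e * _)]mulrA (cm_e cm).
Qed.
Lemma rhoD a b : rho (a + b) = rho a + rho b.
Proof. by apply: (cm_inj cm); rewrite (cmD cm) !rhoE mulrDr mulrDl. Qed.

Section Inflation.
Variable N : lmodType S.
Fact infl_A a b (x : N) : rho a *: (rho b *: x) = rho (a * b) *: x.
Proof. by rewrite scalerA rhoM. Qed.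
Fact infl_1 (x : N) : rho 1 *: x = x.
Proof. by rewrite rho1 scale1r. Qed.
Fact infl_Dr a (x y : N) : rho a *: (x + y) = rho a *: x + rho a *: y.
Proof. exact: scalerDr. Qed.
Fact infl_Dl a b (x : N) : rho (a + b) *: x = rho a *: x + rho b *: x.
Proof. by rewrite rhoD scalerDl. Qed.
Definition infl_act : action G N := Action infl_A infl_1 infl_Dr infl_Dl.
Definition Infl : lmodType G := boxmod infl_act.

Definition iv (x : Infl) : N := unb x.
Definition ib (x : N) : Infl := bx infl_act x.
Lemma ibK x : iv (ib x) = x. Proof. by []. Qed.
Lemma ivK x : ib (iv x) = x. Proof. exact: unbK. Qed.
Lemma iv_inj : injective iv. Proof. exact: can_inj ivK. Qed.
Lemma ivD x y : iv (x + y) = iv x + iv y. Proof. by []. Qed.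
Lemma ivZ g x : iv (g *: x) = rho g *: iv x. Proof. by []. Qed.
Lemma ib_sum n (F : 'I_n -> N) : ib (\sum_k F k) = \sum_k ib (F k).
Proof. exact: (big_morph ib (@bxD _ _ infl_act) (@bx0 _ _ infl_act)). Qed.

Lemma infl_e x : e *: x = x :> Infl.
Proof. by apply: iv_inj; rewrite ivZ rho_j scale1r. Qed.

Fact F_Infl_subproof : linear (fun x : FF Infl => iv (fv x)).
Proof. by move=> s x y; rewrite fvD fvZ ivD ivZ rho_j. Qed.
Lemma F_Infl : iso_modules (FF Infl) N.
Proof.
have [||g h1 h2] := @lin_bij _ _ _ (mkL F_Infl_subproof).
- by move=> x y; rewrite !(mkLE F_Infl_subproof) => /iv_inj/fv_inj.
- move=> n; exists (fB cm (ib n)); rewrite (mkLE F_Infl_subproof).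
  by rewrite fBE infl_e.
by exists (mkL F_Infl_subproof), g.
Qed.
End Inflation.

Fact Imap_subproof (N N' : lmodType S) (f : {linear N -> N'}) :
  linear (fun x : Infl N => ib (f (iv x))).
Proof.
by move=> g x y; apply: iv_inj; rewrite ivD ivZ linearP.
Qed.
Definition Imap (N N' : lmodType S) (f : {linear N -> N'}) :
  {linear Infl N -> Infl N'} := mkL (Imap_subproof f).
Lemma ImapE (N N' : lmodType S) (f : {linear N -> N'}) x :
  Imap f x = ib (f (iv x)).
Proof. exact: mkLE. Qed.

(** Linearity rests on [tri]: e (g m) = (e g e) (e m). The kernel of the resulting map is the part
    of [M] killed by e ([qF0]). *)
Fact qF_subproof M : linear (fun m : M => ib (fB cm m)).
Proof.
move=> g x y; apply: iv_inj; rewrite ivD ivZ !ibK; apply: fv_inj.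
rewrite fvD fvZ !fBE scalerDr !scalerA rhoE.
by rewrite -mulrA (cm_e cm) -tri.
Qed.
Definition qF M : {linear M -> Infl (FF M)} := mkL (@qF_subproof M).
Lemma qFE M m : qF M m = ib (fB cm m). Proof. exact: mkLE. Qed.
Lemma qF_surj M : surj (qF M).
Proof.
move=> y; exists (fv (iv y)); rewrite qFE; apply: iv_inj.
by rewrite ibK fvK.
Qed.
Lemma qF0 M m : qF M m = 0 <-> e *: m = 0.
Proof.
rewrite qFE; split=> [/(congr1 (fun x => fv (iv x)))|h]; first by rewrite ibK fBE.
by apply: iv_inj; apply: fv_inj; rewrite ibK fBE h.
Qed.

Lemma killed_sub M : submodP (fun m : M => e *: m = 0).
Proof.
split=> [|g x y ex ey]; first by rewrite scaler0.
by rewrite scalerDr ey addr0 scalerA tri -scalerA ex scaler0.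
Qed.

(** The ring eGe itself, made a left G-module by the compression [rho]. *)
Definition UU : lmodType G := Infl (S^o : lmodType S).

Lemma UU_fg : fin_gen UU.
Proof.
apply: (@fg_surj _ GG _ (lmul (ib (1 : S^o)))); last exact: fg_reg.
move=> u; exists (j (iv u)); apply: iv_inj; rewrite lmulE ivZ rho_j ibK.
by rewrite /GRing.scale /= mulr1.
Qed.

Section FindimZero.
Variables (K : fieldType) (ioG : K -> G) (ioS : K -> S).
Hypotheses (fdG : fdalg ioG) (fdS : fdalg ioS).
Hypothesis ioj : forall c, j (ioS c) = ioG c * e.
Hypothesis kill : forall N, fin_gen N -> zero_module (FF N) -> fin_pd N.
Hypothesis findim0 : forall N : lmodType S, fin_pd N -> projective N.

Lemma tri_equiv M : fin_gen M -> (fin_pd M <-> fin_pd (FF M)).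
Proof. exact: (corner_fin_pd fdG tri_fg tri_proj kill). Qed.

Lemma CF_findim0 : fin_pd_contravariantly_finite S.
Proof.
move=> M /fin_genP[n [p sp]]; exists {ffun 'I_n -> S^o}, p.
split=> [|Y f /findim0 pY]; first exact: fin_pd_free.
exact: pY _ _ p f sp.
Qed.

Lemma CF_tri : fin_pd_contravariantly_finite G.
Proof. exact: (CF_of_corner fdG fdS ioj tri_fg tri_equiv) CF_findim0. Qed.

Lemma UU_fin_pd : fin_pd UU.
Proof.
apply/(tri_equiv UU_fg); apply: fin_pd_iso (F_Infl _) _.
exact: fin_pd_proj (fg_reg S) proj_reg.
Qed.

(** For [M] in [fin_pd] the module [FF M] is projective, so the corner of any extension of [M]
    splits. Inflating the retraction and composing with [qF X] extends [f], as maps into [UU] factor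
    through [qF]. *)
Lemma UU_perp : perp UU.
Proof.
move=> M pM L X i p s f.
have pFM : projective (FF M) := findim0 ((tri_equiv pM.1).1 pM).
have [_ _ sFp] := F_ses cm s; have [t tE] := proj_section pFM sFp.
have [r rE _] := ses_retract (F_ses cm s) tE.
have lin : linear (fun y : FF L => iv (f (fv y))).
  by move=> a x y; rewrite fvD fvZ linearP ivD ivZ rho_j.
exists (lcomp (Imap (lcomp (mkL lin) r)) (qF X)) => x.
rewrite !lE qFE ImapE ibK lE (_ : fB cm (i x) = Fmap cm i (fB cm x)).
  by rewrite rE (mkLE lin) fBE linearZ_LR infl_e ivK.
by apply: fv_inj; rewrite FmapE !fBE linearZ_LR.
Qed.

End FindimZero.
End Triangular.

(** * The endomorphism ring of the first strong tilting module *)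

Section EndStep.
Variables (S G : pzRingType) (j : S -> G) (cm : corner_map j).
Local Notation e := (j 1).
Hypothesis tri : forall g, e * g = e * g * e.
Local Notation FG := (FF cm).
Variables (K : fieldType) (ioG : K -> G) (ioS : K -> S).
Hypotheses (fdG : fdalg ioG) (fdS : fdalg ioS).
Hypothesis ioj : forall c, j (ioS c) = ioG c * e.
Hypothesis kill : forall N : lmodType G,
  fin_gen N -> zero_module (FG N) -> fin_pd N.
Hypothesis findim0 : forall N : lmodType S, fin_pd N -> projective N.
Variables (T0 : lmodType G) (sT0 : strong_cogen T0) (d : nat).
Hypothesis bd : forall M : lmodType G, fin_pd M -> PD d M.

Local Notation U := (UU cm tri).
Local Notation ibU := (@ib _ _ _ cm tri (S^o : lmodType S)).
Definition T1 : lmodType G := (U * T0)%type.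
Local Notation B1 := (endT T1).

Lemma sT1 : strong_cogen T1.
Proof.
apply: strong_cogen_prod sT0; first exact: UU_fin_pd fdG kill.
exact: UU_perp fdG kill findim0.
Qed.

Definition rU (a : S) : {linear U -> U} := Imap cm tri (rmulo (a : S^c)).
Lemma rUE a u : rU a u = ibU ((iv u : S) * a).
Proof. by rewrite ImapE rmuloE. Qed.

Lemma ivZU g (u : U) : iv (g *: u) = rho cm g * (iv u : S) :> S.
Proof. by []. Qed.
Lemma UE (u : U) : u = j (iv u) *: ibU (1 : S).
Proof. by apply: iv_inj; rewrite [RHS]ivZU rho_j mulr1. Qed.

(** S acts on [U] by right multiplications, which are all its endomorphisms; this accounts for the
    opposite ring. The idempotent [jB 1] is the projection of [T1] onto [U]. *)
Definition jB (a : S^c) : B1 := toH (lcomp linl (lcomp (rU a) lfst)).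
Lemma jBE a (t : T1) : homL (jB a) t = (ibU ((iv t.1 : S) * (a : S)), 0) :> T1.
Proof. by rewrite toHE !lE rUE. Qed.
Lemma jB1E (t : T1) : homL (jB 1) t = (t.1, 0) :> T1.
Proof. by rewrite jBE mulr1 ivK. Qed.

Lemma cmB : corner_map jB.
Proof.
split=> [a b|a b|a b ab|g].
- apply: homP => t; rewrite homLD !jBE mulrDr.
  by rewrite /GRing.add /= /add_pair /= addr0.
- apply: homP => t; rewrite end_mulE !jBE /= ibK.
  by rewrite mulrA.
- have := congr1 (fun f => iv (homL f ((ibU (1 : S), 0) : T1)).1) ab.
  by rewrite /= !jBE /= !ibK !mul1r.
pose h : {linear U -> U} := lcomp lfst (lcomp (homL g) linl).
exists (iv (h (ibU (1 : S)))); apply: homP => t.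
rewrite !end_mulE jBE !jB1E; congr (_, _).
have -> : (homL g (t.1, 0)).1 = h t.1 by rewrite /h !lE.
rewrite [in RHS](UE t.1) linearZ_LR; apply: iv_inj; rewrite [RHS]ivZU rho_j.
by rewrite ibK.
Qed.

Local Notation FB := (FF cmB).
Definition ioB : K -> B1 := fun c => hscale fdG c (1 : B1).
Lemma fdB : fdalg ioB.
Proof. by have [pT _ _] := sT1; exact (endT_fd fdG pT.1). Qed.

Lemma ioBE c (t : T1) : homL (ioB c) t = ioG c *: t.
Proof. by rewrite hscaleE end_oneE. Qed.

Lemma ioj_B c : jB (ioS c) = ioB c * jB 1.
Proof.
apply: homP => t; rewrite end_mulE ioBE jBE jB1E.
have -> : ioG c *: ((t.1, 0) : T1) = (ioG c *: t.1, 0) :> T1.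
  by rewrite [LHS]/GRing.scale /= /scale_pair /= scaler0.
congr (_, _); apply: iv_inj; rewrite ibK [RHS]ivZU -(fdC fdS); congr (_ * _).
by apply: (cm_inj cm); rewrite rhoE ioj -tri (fdC fdG).
Qed.

Lemma FT1_proj : exists n (a : {linear FG T1 -> {ffun 'I_n -> S^o}})
  (b : {linear {ffun 'I_n -> S^o} -> FG T1}), cancel a b.
Proof.
have [pT _ _] := sT1; have pF := (tri_equiv tri fdG kill pT.1).1 pT.
have [n [a [b ab]]] := fg_proj_free pF.1 (findim0 pF).
by exists n, a, b.
Qed.

Lemma e_scale_pair (t : T1) : t.2 = 0 -> e *: t = t.
Proof.
case: t => u v /= ->; rewrite [LHS]/GRing.scale /= /scale_pair /= scaler0.
by rewrite infl_e.
Qed.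

(** This corner is Hom(T1, U) = Hom_S(eT1, S), the dual of a finitely generated projective module.
    The dual basis comes from a retraction of [S^n] onto eT1. *)
Lemma FB_reg : fin_gen (FB (B1^o : lmodType B1)) /\
  projective (FB (B1^o : lmodType B1)).
Proof.
have [n [a [b ab]]] := FT1_proj.
pose w k : FB (B1^o : lmodType B1) := @fB _ _ _ cmB (B1^o : lmodType B1) (toH (lcomp linl
  (lcomp (Imap cm tri (lcomp (lproj k) a)) (qF cm tri T1))) : B1).
have wE k t : homL (fv (w k) : B1) t = (ibU (a (fB cm t) k), 0) :> T1.
  rewrite fBE [_ *: _]/(jB 1 * _ : B1) end_mulE jB1E toHE !lE /=.
  by rewrite ImapE qFE ibK lE lprojE.
have lin k : linear (fun x : FB (B1^o : lmodType B1) =>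
    (iv (homL (fv x : B1) (fv (b (fbase S k)))).1 : (S^c)^o)).
  move=> s x y; rewrite fvD fvZ homLD [_ *: (fv x)]/(jB s * _ : B1) end_mulE jBE.
  by rewrite /= ivD ibK.
apply: (@dual_basis _ _ n w (fun k => mkL (lin k))) => x.
apply: fv_inj; apply: homP => t.
have xE z : homL (fv x : B1) z = ((homL (fv x : B1) z).1, 0) :> T1.
  have := @fvP _ _ _ cmB _ x => /(congr1 (fun f : B1 => homL f z)).
  by rewrite /= [_ *: _]/(jB 1 * _ : B1) end_mulE jB1E.
have xe z : homL (fv x : B1) z = homL (fv x : B1) (e *: z).
  by rewrite linearZ_LR e_scale_pair // xE.
rewrite xe -(fBE cm t) -(ab (fB cm t)) (free_comb b (a (fB cm t))).
rewrite !fv_sum homL_sum linear_sum; apply: eq_bigr => k _.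
have fvBZ s (y : FB (B1^o : lmodType B1)) : fv (s *: y) = jB s * (fv y : B1) :> B1.
  by [].
rewrite [in RHS]fvBZ end_mulE wE jBE (mkLE (lin k)) [in LHS]fvZ linearZ_LR xE.
rewrite [LHS]/GRing.scale /= /scale_pair /= scaler0; congr (_, _).
by apply: iv_inj; rewrite ivZ rho_j !ibK.
Qed.

Let EB := is_End_endT T1.
Let HB := is_End_act EB.
Local Notation D := (DX HB).

Lemma killed_fin_pd (M X : lmodType G) (i : {linear X -> M}) : fin_pd M ->
  injective i -> (forall x, e *: i x = 0) -> fin_pd X.
Proof.
move=> pM inj_i ei; apply: kill (fg_sub fdG inj_i pM.1) _ => x.
apply: fv_inj; rewrite fv0; apply: inj_i; rewrite linear0 -(ei (fv x)).
by rewrite -linearZ_LR fvP.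
Qed.

(* A B1-module N killed by the corner is D X for a G-module X killed by e:    *)
(* present N by D h, with h : T1^n -> T1^m, and let X be the e-killed part of  *)
(* ker h.                                                                     *)
Lemma FB_kill (N : lmodType B1) :
  fin_gen N -> zero_module (FB N) -> fin_pd N.
Proof.
move=> fN FN0; have [pT eT emb] := sT1.
have N0 (x : N) : jB 1 *: x = 0.
  exact: (congr1 (@fv _ _ _ cmB N) (FN0 (fB cmB x))).
have [n [p sp]] := (fin_genP N).1 fN.
pose Tn : lmodType G := {ffun 'I_n -> T1}.
have [al [al' [aa' a'a]]] : iso_modules (D Tn) {ffun 'I_n -> B1^o}.
  exact: iso_trans (D_ffun HB n T1) (ffun_iso n (D_T EB)).
pose pi : {linear D Tn -> N} := lcomp p al.
have spi : surj pi by move=> y; have [x <-] := sp y; exists (al' x); rewrite lE a'a.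
have [L [l sl]] := ses_surj spi; have [inj_l _ _] := sl.
have fDn : fin_gen (D Tn).
  by apply: fg_iso (fg_free B1 n); exists al', al.
have [m [q sq]] := (fin_genP L).1 (fg_sub fdB inj_l fDn).
pose Tm : lmodType G := {ffun 'I_m -> T1}.
have [be [be' [bb' b'b]]] : iso_modules (D Tm) {ffun 'I_m -> B1^o}.
  exact: iso_trans (D_ffun HB m T1) (ffun_iso m (D_T EB)).
pose ka : {linear D Tm -> D Tn} := lcomp l (lcomp q be).
have kaP f : pi f = 0 <-> exists g, ka g = f.
  split=> [/(ses_ker sl)[y <-]|[g <-]]; last by rewrite /ka (lcompE l) (ses0 _ sl).
  by have [z <-] := sq y; exists (be' z); rewrite !lE b'b.
(* [ka] is precomposition with a map [h], whose coordinates are the images of the coordinate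
   projections. *)
pose h : {linear Tn -> Tm} := ltuple (fun r => dL (ka (dB HB (lproj r)))).
have kaE g z : dL (ka g) z = dL g (h z).
  have gE : g = \sum_r (toH (lcomp (dL g) (linj r)) : B1) *: dB HB (lproj r).
    apply: dP => y; rewrite d_sum.
    rewrite [in LHS](linj_proj y) linear_sum; apply: eq_bigr => r _.
    by rewrite dZ (dBE HB) toHE lE lprojE.
  rewrite {1}gE linear_sum d_sum.
  rewrite [in RHS](linj_proj (h z)) linear_sum; apply: eq_bigr => r _.
  by rewrite linearZ_LR dZ toHE lE ltupleE.
have pTn : fin_pd Tn := fin_pd_ffun n pT.
have pTm : fin_pd Tm := fin_pd_ffun m pT.
(* [Y] is the e-killed part of [Tn], [I] its image under [h], and [X] the kernel of [h] on [Y]. Both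
   [X] and [I] are killed by e, so they and the cokernels [C], [C'] lie in [fin_pd]. *)
have [Y [iY [inj_Y YP]]] := ex_sub (killed_sub tri Tn).
have [I [u [v [su inj_v vu]]]] := image_fact (lcomp h iY).
have [X [x sX]] := ses_surj su; have [inj_x _ _] := sX.
have eY y : e *: iY y = 0 by apply/YP; exists y.
pose iX : {linear X -> Tn} := lcomp iY x.
have inj_iX : injective iX by move=> a b; rewrite !lE => /inj_Y/inj_x.
have pX : fin_pd X by apply: killed_fin_pd pTn inj_iX _ => z; rewrite lE.
have pI : fin_pd I.
  apply: killed_fin_pd pTm inj_v _ => z; have [y <-] := su z.
  by rewrite vu lE -linearZ_LR eY linear0.
have [C [c sC]] := ses_inj inj_iX; have pC := fin_pd_quot sC pX pTn.
have [C' [c' sC']] := ses_inj inj_v; have pC' := fin_pd_quot sC' pI pTm.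
have [_ _ sDX] := D_ses HB sC (eT _ pC).
have hX z : h (iX z) = 0 by rewrite lE -(lcompE h) -vu (ses0 _ sX) linear0.
(* A map that kills [Y] factors through the inflation of the projective module e[Tn], hence through
   a power of [U]. It is thus a combination of elements of [jB 1 *: D Tn], on which [pi]
   vanishes. *)
have vanish (g : {linear Tn -> T1}) : (forall y, g (iY y) = 0) -> pi (dB HB g) = 0.
  move=> gY; have pF := (tri_equiv tri fdG kill pTn.1).1 pTn.
  have [k [a [b ab]]] := fg_proj_free pF.1 (findim0 pF).
  have [z|g' g'E] := factor_surj (h := g) (@qF_surj _ _ _ cm tri Tn).
    by move=> /qF0/YP[y <-].
  pose al_ r : {linear Tn -> U} := lcomp (Imap cm tri (lcomp (lproj r) a)) (qF cm tri Tn).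
  pose y_ r : {linear U -> T1} := lcomp g' (Imap cm tri (lmul (b (fbase S r)))).
  have gE : dB HB g =
      \sum_r (toH (lcomp (y_ r) lfst) : B1) *: dB HB (lcomp linl (al_ r)).
    apply: dP => z; rewrite d_sum.
    rewrite (dBE HB) -g'E qFE -(ab (fB cm z)) (free_comb b (a (fB cm z))).
    rewrite ib_sum linear_sum.
    apply: eq_bigr => r _; rewrite dZ !(dBE HB) !lE !ImapE qFE !ibK lmulE.
    by rewrite lE lprojE.
  rewrite gE linear_sum big1 // => r _; rewrite linearZ_LR.
  have -> : dB HB (lcomp linl (al_ r)) = jB 1 *: dB HB (lcomp linl (al_ r)).
    by apply: dP => z; rewrite dZ jB1E !(dBE HB) !lE.
  by rewrite linearZ_LR N0 scaler0.
have key f : pi f = 0 <-> Dmap HB iX f = 0.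
  split=> [/kaP[g <-]|fX].
    by apply: dP => z; rewrite DmapE kaE hX linear0 d0.
  have fX0 z : dL f (iY (x z)) = 0 by rewrite -(lcompE iY) -DmapE fX d0.
  (* On [Y] the map [f] factors through [I], and that factor extends to [f'] on [Tm] because [C'] is
     in [fin_pd]. Subtracting [f' \o h] leaves a map that kills [Y]. *)
  have [z|fI fIE] := ses_desc (h := lcomp (dL f) iY) sX; first by rewrite lE fX0.
  have [f' f'E] := eT _ pC' _ _ _ _ sC' fI.
  have -> : f = ka (dB HB f') + dB HB (lsub (dL f) (lcomp f' h)).
    by apply: dP => z; rewrite dD kaE !(dBE HB) !lE addrC subrK.
  rewrite linearD vanish ?addr0; first by apply/kaP; exists (dB HB f').
  by move=> y; rewrite !lE -(lcompE h) -vu f'E fIE lE subrr.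
apply: fin_pd_iso (iso_quotients spi sDX key) _.
exact (D_fin_pd EB sT1 pX (strong_cores fdG sT1 bd pX)).
Qed.

Lemma CF_B1 : fin_pd_contravariantly_finite S^c ->
  fin_pd_contravariantly_finite B1.
Proof.
have [fF pF] := FB_reg; apply: (CF_of_corner fdB (fd_op fdS) ioj_B fF).
exact (corner_fin_pd fdB fF pF FB_kill).
Qed.

End EndStep.

(** * Morita reduction from End(T1) to the endomorphism ring of a square-free summand *)

Section Reduct.
Variables (R : pzRingType) (T1 T : lmodType R).
Variables (i : {linear T -> T1}) (p : {linear T1 -> T}).
Hypotheses (ip : cancel i p) (aT : in_add T T1).
Variables (B : pzRingType) (phi : B -> {linear T -> T}).
Hypothesis E : is_End phi.
Local Notation B1 := (endT T1).
Local Notation BB := (B1^o : lmodType B1).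

Definition jT (b : B) : B1 := toH (lcomp i (lcomp (phi b) p)).
Lemma jTE b t : homL (jT b) t = i (phi b (p t)).
Proof. by rewrite toHE !lE. Qed.
Lemma jT1E t : homL (jT 1) t = i (p t).
Proof. by have [_ o _ _ _] := E; rewrite jTE o. Qed.

Lemma cmT : corner_map jT.
Proof.
have [aD a1 aM inj su] := E; split=> [a b|a b|a b ab|g].
- by apply: homP => t; rewrite homLD !jTE aD linearD.
- by apply: homP => t; rewrite end_mulE !jTE ip aM.
- apply: inj => t; have := congr1 (fun f => p (homL f (i t))) ab.
  by rewrite /= !jTE !ip.
have [b bE] := su (lcomp p (lcomp (homL g) i)); exists b; apply: homP => t.
by rewrite !end_mulE jTE !jT1E bE !lE.
Qed.

Local Notation FB := (FF cmT).

Lemma FB_reduct : fin_gen (FB BB) /\ projective (FB BB).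
Proof.
have [n [s [r sr]]] := aT; have [aD a1 aM inj su] := E.
pose w k : FB BB := @fB _ _ _ cmT BB (toH (lcomp i (lcomp (lproj k) s)) : B1).
have wE k t : homL (fv (w k) : B1) t = i (s t k).
  rewrite (_ : fv (w k) = jT 1 * (toH (lcomp i (lcomp (lproj k) s)) : B1)) //.
  by rewrite end_mulE jT1E toHE !lE lprojE ip.
have /choice[la laE] (kx : 'I_n * FB BB) : exists b, forall t,
    phi b t = p (homL (fv kx.2 : B1) (r (linj kx.1 t))).
  have [b bE] := su (lcomp p (lcomp (homL (fv kx.2 : B1)) (lcomp r (linj kx.1)))).
  by exists b => t; rewrite bE !lE.
have lin k : linear (fun x : FB BB => la (k, x) : B^o).
  move=> b x y; apply: inj => t; rewrite aD [in RHS]aM !laE fvD fvZ homLD.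
  rewrite linearD; congr (_ + _).
  by rewrite (_ : _ *: fv x = jT b * (fv x : B1)) // end_mulE jTE ip.
apply: (@dual_basis _ _ n w (fun k => mkL (lin k))) => x.
apply: fv_inj; apply: homP => t.
rewrite fv_sum homL_sum.
have xE z : homL (fv x : B1) z = i (p (homL (fv x : B1) z)).
  have := @fvP _ _ _ cmT _ x => /(congr1 (fun f : B1 => homL f z)).
  by rewrite /= [_ *: _]/(jT 1 * _ : B1) end_mulE jT1E.
rewrite -{1}(sr t) (linj_proj (s t)) !linear_sum; apply: eq_bigr => k _.
rewrite xE -(laE (k, x)).
have fvBZ b (y : FB BB) : fv (b *: y) = jT b * (fv y : B1) :> B1 by [].
by rewrite fvBZ end_mulE wE jTE ip (mkLE (lin k)).
Qed.

(** As [T1] is in add(T), the identity of [T1] is a sum of maps factoring through [T]: the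
    idempotent [jT 1] is full. *)
Lemma FB_reduct_zero (N : lmodType B1) : zero_module (FB N) -> zero_module N.
Proof.
move=> FN x; have [n [s [r sr]]] := aT.
have N0 (y : N) : jT 1 *: y = 0.
  exact: (congr1 (@fv _ _ _ cmT N) (FN (fB cmT y))).
pose u k : B1 := toH (lcomp i (lcomp (lproj k) s)).
pose v k : B1 := toH (lcomp (lcomp r (linj k)) p).
have e1 : 1 = \sum_k v k * (jT 1 * u k).
  apply: homP => t; rewrite end_oneE homL_sum.
  rewrite -{1}(sr t) (linj_proj (s t)) linear_sum; apply: eq_bigr => k _.
  by rewrite !end_mulE jT1E !toHE !lE !ip lprojE.
rewrite -[x]scale1r e1 scaler_suml big1 // => k _.
by rewrite -!scalerA N0 scaler0.
Qed.

Variables (K : fieldType) (ioB : K -> B) (ioB1 : K -> B1).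
Hypotheses (fdB : fdalg ioB) (fdB1 : fdalg ioB1).
Hypothesis ioj : forall c, jT (ioB c) = ioB1 c * jT 1.

Lemma CF_reduct : fin_pd_contravariantly_finite B1 ->
  fin_pd_contravariantly_finite B.
Proof.
have [fF pF] := FB_reduct; apply: (CF_to_corner fdB1 fdB ioj fF).
apply: (corner_fin_pd fdB1 fF pF) => N fN /FB_reduct_zero.
exact: fin_pd_zero.
Qed.

End Reduct.

(** * The infinite sequence of strong tilts *)

Section Assembly.
Variables (S G : pzRingType) (j : S -> G) (cm : corner_map j).
Local Notation e := (j 1).
Hypothesis tri : forall g, e * g = e * g * e.
Variables (K : fieldType) (ioG : K -> G) (ioS : K -> S).
Hypotheses (fdG : fdalg ioG) (fdS : fdalg ioS).
Hypothesis ioj : forall c, j (ioS c) = ioG c * e.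
Hypothesis kill : forall N : lmodType G,
  fin_gen N -> zero_module (FF cm N) -> fin_pd N.
Hypothesis findim0 : forall N : lmodType S, fin_pd N -> projective N.
Hypothesis CFS : fin_pd_contravariantly_finite S^c.
Hypothesis sqG : sqfree_ring G.

Lemma sqfree_basic_artin (R : pzRingType) (ioR : K -> R) : fdalg ioR ->
  sqfree_ring R -> basic_artin_algebra R.
Proof. by move=> fdR sR; split; [exact: fd_artin fdR | exact: sqfree_ring_basic]. Qed.

(* T2, regarded over its endomorphism ring L2, is again strong tilting, because *)
(* every nonzero module over L1^c maps nontrivially to T2; its endomorphism     *)
(* ring is L1^c, and the iteration becomes G, L1, L2, L1, L2, ...               *)
Theorem corner_unlimited : unlimited_strong_tilting G.
Proof.
have CFG := CF_tri tri fdG fdS ioj kill findim0.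
have [T0 sT0] := strong_cogen_exists fdG CFG.
have [d bd] := findim_bound fdG CFG.
pose T1 := T1 cm tri T0; have sT1 := sT1 tri fdG kill findim0 sT0.
have CFB1 := CF_B1 (tri := tri) fdG fdS ioj kill findim0 sT0 bd CFS.
have [pT1 _ _] := sT1.
have [T [sqT sumT aT]] := sqfree_reduce fdG pT1.1.
have sT : strong_cogen T := strong_cogen_add sumT aT sT1.
have [pT _ _] := sT.
(* Right L1-modules are left modules over [L1^c], which is End(T) up to conversion. *)
pose L1 : pzRingType := ((endT T)^c)%type.
have EL1 : @is_End G L1^c T (fun f => homL (f : endT T)) := is_End_endT T.
have fdE := endT_fd fdG pT.1.
have fdL1 := fd_op fdE; have fdR := fd_op fdL1.
have CFR : fin_pd_contravariantly_finite L1^c.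
  have [i [p ip]] := sumT.
  refine (CF_reduct ip aT EL1 fdR (endT_fd fdG pT1.1) _ CFB1) => c.
  apply: homP => t; rewrite end_mulE jTE (jT1E i p EL1) !hscaleE !end_oneE.
  by rewrite linearZ_LR.
have [T2' sT2'] := strong_cogen_exists fdR CFR.
have [d2 bd2] := findim_bound fdR CFR.
have [pT2' _ _] := sT2'.
have [T2 [sqT2 sumT2 aT2]] := sqfree_reduce fdR pT2'.1.
have sT2 : strong_cogen T2 := strong_cogen_add sumT2 aT2 sT2'.
have [pT2 _ emb2] := sT2.
pose L2 : pzRingType := endT T2.
have EL2 : @is_End L1^c L2 T2 (fun f => homL f) := is_End_endT T2.
have fdL2 := endT_fd fdR pT2.1.
(* By [sharp_cogen] a nonzero [Z] maps nontrivially to [T] regarded over End(T); that module has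
   finite projective dimension, so it embeds in a power of [T2]. *)
have cog (Z : lmodType L1^c) : fin_gen Z ->
    (forall (h : {linear Z -> T2}) z, h z = 0) -> zero_module Z.
  move=> fZ hZ; refine (sharp_cogen (E := EL1) fdR sT fZ _) => h z.
  have [n [f inj_f]] := emb2 _ (sharp_fin_pd EL1 fdG sT bd).
  apply: inj_f; rewrite linear0; apply/ffunP=> k; rewrite ffunE.
  by have := hZ (lcomp (lproj k) (lcomp f h)) z; rewrite !lE lprojE.
have st2 := sharp_tilting EL2 fdR fdL2 sT2 cog bd2.
have ER := is_End_ract EL2 sT2.
have sqR : sqfree_ring L1^c := sqfree_End EL1 sqT.
have sqL2 : sqfree_ring L2 := sqfree_End EL2 sqT2.
have sqTs := sqfree_of_ring ER sqR.
have sqL1 : sqfree_ring L1 := sqfree_ring_op sqR.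
pose L i : pzRingType := if i is 0%N then G else if odd i then L1 else L2.
have tG : strong_tilts_left G L1.
  exists T; split; [exact: sqfree_basic| |by exists (fun f => homL (f : endT T))].
  exact (strong_cogen_tilting fdG sT bd).
have t12 : strong_tilts_right L1 L2.
  exists T2; split; [exact: sqfree_basic| |by exists (fun f => homL f)].
  exact (strong_cogen_tilting fdR sT2 bd2).
have t21 : strong_tilts_left L2 L1.
  exists (sharp (is_End_act EL2)); split; [exact: sqfree_basic|exact: st2|].
  by exists (ract (is_End_act EL2)).
exists L; split=> // [[|i]|[|i]|[|i]] //.
- exact (sqfree_basic_artin fdG sqG).
- rewrite /L; case: (odd i.+1).
    exact (sqfree_basic_artin fdL1 sqL1).
  exact (sqfree_basic_artin fdL2 sqL2).
- by rewrite /L /= negbK => ->.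
- by rewrite /L /= => /negPf ->.
Qed.

End Assembly.

(** * Modules supported off the oriented cycles *)

Section Peel.
Variables (K : fieldType) (G : pzRingType) (io : K -> G) (fd : fdalg io).
Variables (V : finType) (u : V -> G) (r : V -> nat).
Hypothesis u_idem : forall v, u v * u v = u v.
Hypothesis u_sum : \sum_v u v = 1.
Implicit Types N P L C : lmodType G.
Implicit Types W : {set V}.

Definition supported W N := forall w, w \notin W -> forall x : N, u w *: x = 0.

Section Step.
Variables (W : {set V}) (v : V).
Hypothesis vW : v \in W.
Hypothesis corner_v : forall x, exists c, u v * x * u v = io c * u v.
Hypothesis closed_v : forall w x, w \notin W -> u w * x * u v = 0.
Hypothesis IH : forall N, fin_gen N -> supported (W :\ v) N -> fin_pd N.

(* The u v-part of N is a K-space; mapping a free G u(v)-module on a basis of *)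
(* it to N leaves a kernel and a cokernel supported off v.                    *)
Lemma peel_step N : fin_gen N -> supported W N -> fin_pd N.
Proof.
move=> fN sN.
have HS : submodP (fun x : res fd N => u v *: unb x = unb x).
  split=> [|a x y ex ey]; first by rewrite unb0 scaler0.
  by rewrite unbD unbZ /= scalerDr ey scalerA -(fdC fd) -scalerA ex.
have [D [iD [inj_D DP]]] := ex_sub HS.
have [k [be [be' [bb' b'b]]]] := basis_exists (vs_sub inj_D (fg_res fd fN)).
pose b l : N := unb (iD (be' (fbase K l))).
have ub l : u v *: b l = b l by apply/DP; exists (be' (fbase K l)).
have iDE (c : {ffun 'I_k -> K^o}) : unb (iD (be' c)) = \sum_l io (c l) *: b l.
  rewrite (free_comb be' c) linear_sum unb_sum.
  by apply: eq_bigr => l _; rewrite linearZ_LR unbZ.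
have [P [pr [ip [spr inj_ip ipE]]]] := image_fact (rmulo (u v : G^c)).
have {}ipE x : ip (pr x) = (x : G) * u v by rewrite ipE rmuloE.
have prip y : pr (ip y) = y.
  by have [x <-] := spr y; apply: inj_ip; rewrite !ipE -mulrA u_idem.
have pP : fin_pd P.
  apply: fin_pd_summand (fin_pd_proj (fg_reg G) proj_reg).
  by exists ip, pr.
have ipu y : (ip y : G) * u v = ip y by rewrite -[in RHS](prip y) ipE.
pose f : {linear {ffun 'I_k -> P} -> N} := lsum (fun l => lcomp (lmul (b l)) ip).
have fE y : f y = \sum_l (ip (y l) : G) *: b l.
  by rewrite /f lsumE; apply: eq_bigr => l _; rewrite lE lmulE.
have [L [J [C [i [p [i' [p' [s s' ii]]]]]]]] := ses_image f.
have [inj_i _ sp] := s; have [inj_i' _ sp'] := s'.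
have pPk := fin_pd_ffun k pP.
have pL : fin_pd L.
  apply: IH => [|w]; first exact (fg_sub fd inj_i pPk.1).
  rewrite !inE negb_and negbK => wv x; apply: inj_i; rewrite linear0 linearZ_LR.
  apply/ffunP=> l; rewrite !ffunE; apply: inj_ip; rewrite linear0 linearZ_LR.
  rewrite -(ipu (i x l)) [LHS]/GRing.scale /= mulrA.
  (* At [v] itself, the components of a kernel element compress to scalars [c l] that form a
     relation among the basis vectors [b l], so they vanish. *)
  have [/eqP ->|wW] := orP wv; last exact: closed_v.
  have /choice[c cE] l' : exists c, u v * (ip (i x l') : G) * u v = io c * u v.
    exact: corner_v.
  suff c0 : c l = 0.
    rewrite cE c0; suff -> : io 0 = 0 by rewrite mul0r.
    by apply: (@addIr _ (io 0)); rewrite -(fdD fd) !add0r.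
  have : be' [ffun l => c l] = 0.
    apply: inj_D; apply: unb_inj; rewrite linear0 unb0 iDE.
    have fux : u v *: f (i x) = 0 by rewrite -ii (ses0 _ s) linear0 scaler0.
    rewrite -[RHS]fux fE scaler_sumr; apply: eq_bigr => l' _; rewrite ffunE.
    by rewrite -ub scalerA -cE -scalerA ub scalerA.
  rewrite -(linear0 be') => /(can_inj b'b)/ffunP/(_ l).
  by rewrite !ffunE.
have pJ := fin_pd_quot s pL pPk.
apply: (fin_pd_ext s' pJ); apply: IH => [|w]; first exact: fg_surj sp' fN.
rewrite !inE negb_and negbK => wv y; have [n <-] := sp' y.
have [/eqP ->|wW] := orP wv; last by rewrite -linearZ_LR sN // linear0.
have /DP[d dE] : u v *: unb (bx (res_act fd N) (u v *: n)) = unb (bx (res_act fd N) (u v *: n)).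
  by rewrite !bxK scalerA u_idem.
rewrite -linearZ_LR -[u v *: n](bxK (res_act fd N)) -dE -(bb' d) iDE.
have -> : \sum_l io (be d l) *: b l = f [ffun l => pr (io (be d l))].
  by rewrite fE; apply: eq_bigr => l _; rewrite ffunE ipE -scalerA ub.
by rewrite -ii (ses0 _ s').
Qed.
End Step.

Variable W0 : {set V}.
Hypothesis corner_u : forall v, v \in W0 -> forall x,
  exists c, u v * x * u v = io c * u v.
Hypothesis closed_u : forall v w x, v \in W0 -> w != v ->
  u w * x * u v <> 0 -> w \in W0 /\ (r w < r v)%N.

(** Induction on sets [W] that nonzero elements [u w * x * u v] with [v] in [W] never leave. Ranks
    drop along such elements, so removing a vertex of maximal rank keeps [W] closed, and [peel_step]
    restores that vertex. *)
Lemma peel N : fin_gen N -> supported W0 N -> fin_pd N.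
Proof.
suff H n W : (#|W| <= n)%N -> W \subset W0 ->
    (forall v w x, v \in W -> w \notin W -> u w * x * u v = 0) ->
    forall N, fin_gen N -> supported W N -> fin_pd N.
  apply: (H #|W0| W0) => // v w x vW wW; apply: contrapT => nz.
  have [|wW0 _] := closed_u vW _ nz; last by rewrite wW0 in wW.
  by apply: contraNneq wW => ->.
elim: n W => [|n IH] W Wn WW0 clW {}N fN sN.
  apply: fin_pd_zero => x; rewrite -[x]scale1r -u_sum scaler_suml big1 // => v _.
  apply: sN; rewrite leqn0 cards_eq0 in Wn.
  by rewrite (eqP Wn) inE.
have [W_0|[v0 v0W]] := set_0Vmem W.
  by apply: (IH set0) fN _ => // [|||]; rewrite ?cards0 ?sub0set // -?W_0 // => v w x; rewrite inE.
have [v vW0 vmax] := arg_maxnP r v0W; have vW : v \in W by exact: vW0.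
apply: (peel_step (W := W) (v := v)) => //.
- exact/corner_u/(subsetP WW0).
- by move=> w x; apply: clW.
move=> N' fN'; apply: IH => //.
- by rewrite (cardsD1 v) vW in Wn.
- by apply: subset_trans WW0; apply: subsetDl.
move=> v' w x; rewrite !inE negb_and negbK => /andP[v'v v'W] /orP[/eqP ->|wW].
  apply: contrapT => nz; have [|_] := closed_u (subsetP WW0 _ v'W) _ nz.
    by rewrite eq_sym.
  by rewrite ltnNge; move: (vmax _ v'W); rewrite /= => ->.
exact: clW.
Qed.

End Peel.

(** * Corner rings and nested idempotents *)

Section CornerRing.
Variables (K : fieldType) (G : pzRingType) (io : K -> G) (fd : fdalg io).

Section One.
Variable e : idempotent_elt G.
Local Notation e0 := (idem_val e).

Fact ce_subproof g : e0 * g * e0 \in corner_pred e.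
Proof. by rewrite corner_predE !mulrA idem_mul -!mulrA idem_mul. Qed.
Definition ce g : corner e := Corner (ce_subproof g).
Lemma ceE g : corner_val (ce g) = e0 * g * e0. Proof. by []. Qed.
Lemma cval_inj : injective (@corner_val G e). Proof. exact: val_inj. Qed.
Lemma cvalP (x : corner e) : e0 * corner_val x * e0 = corner_val x.
Proof. by apply/eqP; exact: (corner_valP x). Qed.

Lemma cvM (x y : corner e) : corner_val (x * y) = corner_val x * corner_val y.
Proof. by []. Qed.

Lemma cvMo (x y : (corner e)^c) :
  corner_val (x * y : corner e) = corner_val (y : corner e) * corner_val (x : corner e).
Proof. by []. Qed.

Lemma cm_corner : corner_map (@corner_val G e).
Proof. by split=> //; [exact: cval_inj | move=> g; exists (ce g)]. Qed.

Lemma ceD a b : ce (a + b) = ce a + ce b.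
Proof. by apply: cval_inj; rewrite /= mulrDr mulrDl. Qed.

Definition ioc c : corner e := ce (io c).
Lemma iocE c : corner_val (ioc c) = io c * e0.
Proof. by rewrite ceE -(fdC fd) -mulrA idem_mul. Qed.

Lemma fd_corner : fdalg ioc.
Proof.
split.
- by move=> a b; rewrite /ioc (fdD fd) ceD.
- move=> a b; apply: cval_inj; rewrite cvM !iocE (fdM fd).
  by rewrite -[RHS]mulrA [e0 * (_ * _)]mulrA -(fdC fd b e0) -!mulrA idem_mul.
- by apply: cval_inj; rewrite iocE (fd1 fd) mul1r.
- move=> c x; apply: cval_inj; rewrite !cvM !iocE.
  by rewrite -mulrA corner_el mulrA -(fdC fd c) -mulrA corner_er.
have [n [s sP]] := fd_span fd; exists n, (fun k => ce (s k)) => x.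
have [c cE] := sP (corner_val x); exists c; apply: cval_inj.
rewrite (big_morph (@corner_val G e) (fun a b => erefl) (erefl : corner_val (0 : corner e) = 0)).
rewrite -cvalP cE mulr_sumr mulr_suml; apply: eq_bigr => k _.
rewrite cvM iocE ceE !mulrA -(fdC fd _ e0) -[io _ * e0 * e0]mulrA idem_mul.
by [].
Qed.
End One.

Section Two.
Variables (e e' : idempotent_elt G).
Hypotheses (ee' : idem_val e * idem_val e' = idem_val e')
           (e'e : idem_val e' * idem_val e = idem_val e').

Definition cinc (x : (corner e')^c) : (corner e)^c := ce e (corner_val (x : corner e')).
Lemma cincE x : corner_val (cinc x : corner e) = corner_val (x : corner e').
Proof.
by rewrite ceE -(cvalP (x : corner e')) !mulrA ee' -!mulrA e'e !mulrA.
Qed.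

Lemma cm_cinc : corner_map cinc.
Proof.
split=> [a b|a b|a b ab|g].
- exact: ceD.
- by apply: cval_inj; rewrite cincE !cvMo !cincE.
- by apply: cval_inj; rewrite -!cincE ab.
exists (ce e' (corner_val (g : corner e))); apply: cval_inj; rewrite cincE ceE.
by rewrite !cvMo !cincE mulrA.
Qed.

Lemma ioj_cinc c : cinc (ioc e' c) = (ioc e c : (corner e)^c) * cinc 1.
Proof.
apply: cval_inj; rewrite cincE iocE cvMo cincE iocE.
by rewrite mulrA -(fdC fd) -mulrA e'e.
Qed.
End Two.
End CornerRing.

(** * Path algebras modulo relations *)

Section Quiver.
Variable Q : quiver.
Local Notation co := (connect (@arrow_rel Q)).

Lemma arrow_relP (a : arr Q) : arrow_rel (src a) (tgt a).
Proof. by apply/existsP; exists a; rewrite !eqxx. Qed.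

Lemma wf_connect v s : wf_path_rec v s -> co v (raw_end (v, s)).
Proof.
elim: s => [|a s IH] //= /andP[/eqP sa /IH h].
by apply: connect_trans h _; rewrite -sa; apply: connect1; apply: arrow_relP.
Qed.

Lemma qpath_connect (p : qpath Q) : co (path_start p) (path_end p).
Proof.
case: p => -[v s] wp; rewrite /path_start /path_end /=; exact: wf_connect.
Qed.

Lemma cycle_connect v w : arrow_rel w v -> co v w -> on_oriented_cycle v.
Proof.
move=> wv /connectP[[|x s] /= ps lw].
  by apply/existsP; exists w; rewrite lw in wv *; rewrite wv connect0.
case/andP: ps => vx ps; apply/existsP; exists x; rewrite vx /=.
apply: connect_trans (connect1 wv); apply/connectP; by exists s.
Qed.

Lemma closed_path_trivial (p : qpath Q) v : ~~ on_oriented_cycle v ->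
  path_start p = v -> path_end p = v -> p = trivial_path v.
Proof.
case: p => -[w [|a s]] wp nv; rewrite /path_start /path_end /= => wv vid; subst w.
  exact: val_inj.
case/negP: nv; move: (wp); rewrite /wf_path /= => /andP[/eqP sa /wf_connect h].
by apply: (@cycle_connect _ (src a)); [rewrite -vid arrow_relP | rewrite sa].
Qed.

Lemma connect_anti v w : ~~ on_oriented_cycle v -> v != w -> co v w -> co w v -> False.
Proof.
move=> nv vw /connectP[[|x s] /= ps lw] wv; first by rewrite lw eqxx in vw.
case/negP: nv; case/andP: ps => vx ps; apply/existsP; exists x; rewrite vx /=.
by apply: connect_trans wv; apply/connectP; exists s.
Qed.

Lemma cycle_precyclic (v : vert Q) : on_oriented_cycle v -> precyclic v.
Proof. by move=> h; apply/existsP; exists v; rewrite connect0. Qed.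
Lemma cycle_postcyclic (v : vert Q) : on_oriented_cycle v -> postcyclic v.
Proof. by move=> h; apply/existsP; exists v; rewrite connect0 h. Qed.
Lemma precyclic_pred (v w : vert Q) : co v w -> precyclic w -> precyclic v.
Proof.
move=> vw /existsP[x /andP[wx cx]]; apply/existsP; exists x.
by rewrite (connect_trans vw wx).
Qed.
Lemma postcyclic_succ (v w : vert Q) : co v w -> postcyclic v -> postcyclic w.
Proof.
move=> vw /existsP[x /andP[cx xv]]; apply/existsP; exists x.
by rewrite cx (connect_trans xv vw).
Qed.

(** [rk_out] and [rk_in] are the ranks for [peel]. Distinct vertices, one of them off the oriented
    cycles, are never mutually reachable, which makes the counts drop strictly. *)
Definition rk_out v := #|[set w | co v w]|.
Definition rk_in v := #|[set w | co w v]|.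

Lemma rk_out_lt v w : ~~ on_oriented_cycle v -> v != w -> co v w ->
  (rk_out w < rk_out v)%N.
Proof.
move=> nv vw cvw; apply: proper_card; apply/properP; split.
  by apply/subsetP => x; rewrite !inE; apply: connect_trans.
exists v; rewrite !inE ?connect0 //.
by apply/negP => /(connect_anti nv vw cvw).
Qed.

Lemma rk_in_lt v w : ~~ on_oriented_cycle v -> v != w -> co w v ->
  (rk_in w < rk_in v)%N.
Proof.
move=> nv vw cwv; apply: proper_card; apply/properP; split.
  by apply/subsetP => x; rewrite !inE => h; apply: connect_trans h cwv.
exists v; rewrite !inE ?connect0 //.
by apply/negP => h; apply: (connect_anti nv vw h cwv).
Qed.

End Quiver.

Section PathAlg.
Variables (K : fieldType) (Q : quiver).
Local Notation KQ := (path_algebra K Q).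
Local Notation pe := (@path_elt K Q).
Local Notation triv := (@trivial_path Q).
Implicit Types (f g : KQ) (p q : qpath Q).

Definition kc c : KQ := \sum_v pe c (Some (triv v)).
Definition vid v : KQ := pe 1 (Some (triv v)).

Lemma pe_comp c d p q :
  pe c (Some p) * pe d (Some q) = pe (c * d) (path_comp p q).
Proof. exact: pa_mulUU. Qed.

Lemma triv_mul c d w p :
  pe c (Some (triv w)) * pe d (Some p) = if w == path_end p then pe (c * d) (Some p) else 0.
Proof.
by rewrite pe_comp path_comp_triv_l; case: ifP => // _; rewrite path_elt_None.
Qed.

Lemma mul_triv c d v p :
  pe c (Some p) * pe d (Some (triv v)) = if path_start p == v then pe (c * d) (Some p) else 0.
Proof.
by rewrite pe_comp path_comp_triv_r; case: ifP => // _; rewrite path_elt_None.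
Qed.

Lemma kc_mul c d p : kc c * pe d (Some p) = pe (c * d) (Some p).
Proof.
rewrite mulr_suml (bigD1 (path_end p)) //= triv_mul eqxx big1 ?addr0 // => v /negPf h.
by rewrite triv_mul h.
Qed.

Lemma mul_kc c d p : pe d (Some p) * kc c = pe (d * c) (Some p).
Proof.
rewrite mulr_sumr (bigD1 (path_start p)) //= mul_triv eqxx big1 ?addr0 // => v h.
by rewrite mul_triv eq_sym (negPf h).
Qed.

Lemma kcC c f : kc c * f = f * kc c.
Proof.
elim/pa_ind: f => [|f g ef eg|d p]; first by rewrite mulr0 mul0r.
  by rewrite mulrDr mulrDl ef eg.
by rewrite kc_mul mul_kc mulrC.
Qed.

Lemma kcD c d : kc (c + d) = kc c + kc d.
Proof. by rewrite /kc -big_split; apply: eq_bigr => v _; apply: path_eltD. Qed.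
Lemma kcM c d : kc (c * d) = kc c * kc d.
Proof. by rewrite {2}/kc mulr_sumr; apply: eq_bigr => v _; rewrite kc_mul. Qed.
Lemma kc1 : kc 1 = 1. Proof. by []. Qed.
Lemma vid_sum : \sum_v vid v = 1. Proof. by []. Qed.
Lemma pe_kc c p : pe c (Some p) = kc c * pe 1 (Some p).
Proof. by rewrite kc_mul mulr1. Qed.

Lemma vid_mul v w : vid v * vid w = if v == w then vid v else 0.
Proof. by rewrite triv_mul mulr1; case: eqP => // ->. Qed.

Lemma vid_path0 v w f : ~~ connect (@arrow_rel Q) v w -> vid w * f * vid v = 0.
Proof.
move=> nvw; elim/pa_ind: f => [|f g ef eg|c p]; first by rewrite mulr0 mul0r.
  by rewrite mulrDr mulrDl ef eg addr0.
rewrite triv_mul; case: eqP => [we|_]; last by rewrite mul0r.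
rewrite mul_triv; case: eqP => // sv.
by case/negP: nvw; rewrite we -sv; apply: qpath_connect.
Qed.

Lemma vid_corner v f : ~~ on_oriented_cycle v -> exists c, vid v * f * vid v = kc c * vid v.
Proof.
move=> nv; elim/pa_ind: f => [|f g [c ef] [d eg]|c p].
- exists 0; rewrite mulr0 mul0r kc_mul mul0r.
  by rewrite path_elt0.
- by exists (c + d); rewrite mulrDr mulrDl ef eg kcD mulrDl.
rewrite triv_mul; case: eqP => [we|_]; last first.
  by exists 0; rewrite mul0r kc_mul mul0r path_elt0.
rewrite mul_triv; case: eqP => [sv|_]; last first.
  by exists 0; rewrite kc_mul mul0r path_elt0.
exists c; rewrite kc_mul !mulr1 mul1r; congr (pe _ (Some _)).
exact: closed_path_trivial.
Qed.

(** A character of the path algebra ([chiM]): a trivial path factors only into trivial paths. The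
    common kernel over all [v] is the arrow ideal ([pow_chi]). *)
Definition chi v f : K := (f : {malg K[qpath Q]})@_(triv v).

Lemma chiD v f g : chi v (f + g) = chi v f + chi v g.
Proof. exact: mcoeffD. Qed.
Lemma chi0 v : chi v 0 = 0. Proof. exact: mcoeff0. Qed.
Lemma chi_pe v c x : chi v (pe c x) = if x == Some (triv v) then c else 0.
Proof.
rewrite /chi path_elt.unlock; case: x => [p|] /=; last by rewrite mcoeff0.
rewrite mcoeffU; have -> : (Some p == Some (triv v)) = (p == triv v) by [].
by case: eqP => _; rewrite ?mulr1n ?mulr0n.
Qed.

Lemma path_comp_triv p q v :
  (path_comp p q == Some (triv v)) = (p == triv v) && (q == triv v).
Proof.
apply/eqP/andP => [|[/eqP -> /eqP ->]]; last by rewrite path_comp_triv_l eqxx.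
have [pq|pq] := eqVneq (path_start p) (path_end q); last first.
  by rewrite /path_comp (negPf pq).
have [u -> valu] := path_comp_some pq => -[uv].
move: valu; rewrite uv /= => -[vq st]; clear u uv.
case: p q pq vq st => [[a s] wp] [[b t] wq]; rewrite /path_start /path_end /=.
move=> pq vq st; have /eqP := congr1 size st.
rewrite size_cat eq_sym addn_eq0 !size_eq0 => /andP[/eqP s0 /eqP t0].
subst s t; rewrite /= in pq; subst a b.
by split; apply/eqP; apply: val_inj.
Qed.

Lemma chiM v f g : chi v (f * g) = chi v f * chi v g.
Proof.
elim/pa_ind: f => [|f1 f2 e1 e2|c p]; first by rewrite mul0r chi0 mul0r.
  by rewrite mulrDl !chiD e1 e2 mulrDl.
elim/pa_ind: g => [|f1 f2 e1 e2|d q]; first by rewrite mulr0 chi0 mulr0.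
  by rewrite mulrDr !chiD e1 e2 mulrDr.
rewrite pe_comp !chi_pe path_comp_triv.
have E (a b : qpath Q) : (Some a == Some b) = (a == b) by [].
by rewrite !E; case: (p == _); case: (q == _); rewrite ?mulr0 ?mul0r.
Qed.

Lemma powP m f : arrow_ideal_pow m f <->
  forall p, (path_length p < m)%N -> (f : {malg K[qpath Q]})@_p = 0.
Proof.
split=> h p.
  move=> pm; apply: mcoeff_outdom; apply/negP => /h.
  by rewrite leqNgt pm.
by apply: contraTT; rewrite -ltnNge => /h; rewrite -mcoeff_eq0 => ->.
Qed.

Lemma pow0 m : arrow_ideal_pow m (0 : KQ).
Proof. by apply/powP => p _; rewrite mcoeff0. Qed.
Lemma powD m f g : arrow_ideal_pow m f -> arrow_ideal_pow m g -> arrow_ideal_pow m (f + g).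
Proof.
move=> /powP hf /powP hg; apply/powP => p pm.
by rewrite [LHS]mcoeffD hf // hg // addr0.
Qed.
Lemma pow_pe m c p : (m <= path_length p)%N -> arrow_ideal_pow m (pe c (Some p)).
Proof.
move=> mp; apply/powP => q qm; rewrite path_elt.unlock mcoeffU.
by case: eqP => [pq|_]; rewrite ?mulr0n //; rewrite -pq ltnNge mp in qm.
Qed.

Lemma pow_sum m (J : eqType) (s : seq J) (F : J -> KQ) :
  (forall x, x \in s -> arrow_ideal_pow m (F x)) ->
  arrow_ideal_pow m (\sum_(x <- s) F x).
Proof.
move=> h; rewrite big_seq; apply: big_ind => //; [exact: pow0 | exact: powD].
Qed.

Lemma powM m n f g : arrow_ideal_pow m f -> arrow_ideal_pow n g ->
  arrow_ideal_pow (m + n) (f * g).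
Proof.
move=> hf hg; rewrite -[f * g]/(pa_mul f g) pa_mul.unlock.
apply: pow_sum => p /hf mp; apply: pow_sum => q /hg nq.
case pqE: (path_comp p q) => [x|]; last by rewrite path_elt_None; apply: pow0.
apply: pow_pe; move: pqE; rewrite /path_comp; case: ifP => // _.
case: insubP => // y _ vy [yx]; subst y.
by rewrite /path_length vy /= size_cat leq_add.
Qed.

Lemma pow_exp m f : arrow_ideal_pow 1 f -> arrow_ideal_pow m (f ^+ m).
Proof.
move=> f1; elim: m => [|m IH]; first by move=> p _.
by rewrite exprS -add1n; apply: powM.
Qed.

Lemma pow_chi f : (forall v, chi v f = 0) -> arrow_ideal_pow 1 f.
Proof.
move=> h; apply/powP => -[[v [|a s]] wp] //= _.
by rewrite -[RHS](h v) /chi; congr (_ @_ _); apply: val_inj.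
Qed.

End PathAlg.

Section Quotient.
Variables (K : fieldType) (Q : quiver) (I : path_algebra K Q -> Prop).
Hypothesis hI : admissible_ideal I.
Variables (Lambda : pzRingType) (pi : {rmorphism path_algebra K Q -> Lambda}).
Hypothesis hL : is_quotient_map I pi.
Local Notation KQ := (path_algebra K Q).
Local Notation pe := (@path_elt K Q).
Local Notation co := (connect (@arrow_rel Q)).

Definition ioL c : Lambda := pi (kc Q c).
Definition uL v : Lambda := pi (vid K v).

Lemma pi_surj x : exists f, pi f = x. Proof. exact: hL.1. Qed.

Lemma uL_sum : \sum_v uL v = 1.
Proof. by rewrite /uL -(raddf_sum pi) vid_sum; exact: rmorph1. Qed.

Lemma uL_mul v w : uL v * uL w = if v == w then uL v else 0.
Proof. by rewrite -rmorphM vid_mul; case: ifP => // _; rewrite rmorph0. Qed.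

Lemma uL_path0 v w x : ~~ co v w -> uL w * x * uL v = 0.
Proof.
have [f <-] := pi_surj x => h.
by rewrite -!rmorphM vid_path0 // rmorph0.
Qed.

Lemma uL_corner v x : ~~ on_oriented_cycle v -> exists c, uL v * x * uL v = ioL c * uL v.
Proof.
have [f <-] := pi_surj x => nv; have [c cE] := vid_corner f nv.
by exists c; rewrite -!rmorphM cE.
Qed.

Lemma fdL : fdalg ioL.
Proof.
split.
- by move=> a b; rewrite /ioL kcD rmorphD.
- by move=> a b; rewrite /ioL kcM rmorphM.
- by rewrite /ioL kc1 rmorph1.
- by move=> c x; have [f <-] := pi_surj x; rewrite /ioL -!rmorphM kcC.
have [_ [m _ mI] _] := hI.
pose J : finType := (vert Q * (m.-bseq (arr Q)))%type.
(* Paths of length at least [m] vanish in [Lambda], so paths of bounded length span it; pairs in [J]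
   that are not paths contribute zero. *)
pose g (x : J) : Lambda :=
  if insub (x.1, val x.2) : option (qpath Q) is Some p then pi (pe 1 (Some p)) else 0.
exists #|J|, (fun k => g (enum_val k)) => x; have [f <-] := pi_surj x.
have io0 : ioL 0 = 0.
  by rewrite /ioL /kc big1 ?rmorph0 // => v _; rewrite path_elt0.
elim/pa_ind: f => [|f1 f2 [c1 e1] [c2 e2]|c p].
- by exists (fun _ => 0); rewrite rmorph0 big1 // => k _; rewrite io0 mul0r.
- exists (fun k => c1 k + c2 k); rewrite rmorphD e1 e2 -big_split.
  by apply: eq_bigr => k _; rewrite /ioL kcD rmorphD mulrDl.
have [pm|pm] := ltnP (path_length p) m; last first.
  exists (fun _ => 0); rewrite big1 => [|k _]; last by rewrite io0 mul0r.
  by apply/hL.2; apply: mI; apply: pow_pe.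
pose y : J := (path_start p, Bseq (ltnW pm)).
exists (fun k => if enum_val k == y then c else 0).
rewrite (bigD1 (enum_rank y)) //= enum_rankK eqxx big1 ?addr0 => [|k ky]; last first.
  by rewrite (can2_eq (@enum_valK _) (@enum_rankK _)) (negPf ky) io0 mul0r.
have -> : g y = pi (pe 1 (Some p)).
  rewrite /g /=; have -> : (path_start p, (val p).2) = val p by exact/esym/surjective_pairing.
  by rewrite valK.
by rewrite (pe_kc c) rmorphM.
Qed.

(** The characters [chi v] take equal values on X Y and Y X, whose images are orthogonal; as I
    contains no trivial paths, all these values are zero. So X Y is in the arrow ideal, its image in
    [Lambda] is nilpotent, and a nilpotent idempotent is zero. *)
Lemma sqL : sqfree_ring Lambda.
Proof.
have [_ [m m2 mI] I2] := hI.
move=> x y; have [X <-] := pi_surj x; have [Y <-] := pi_surj y.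
move=> idem _; rewrite -!rmorphM => /hL.2/I2 h2 _.
have chi0' v : chi v (X * Y) = 0.
  have /powP/(_ (trivial_path v) isT) e := h2.
  have {}e : chi v (X * Y * (Y * X)) = 0 := e.
  move/eqP: e; rewrite !chiM !mulf_eq0 => /orP[/orP[]|/orP[]] /eqP ->;
    by rewrite ?mulr0 ?mul0r.
have /mI/hL.2 : arrow_ideal_pow m ((X * Y) ^+ m) by apply/pow_exp/pow_chi.
rewrite rmorphXn /= => e; rewrite -e.
case: m m2 mI e => // n _ _ _; elim: n => [|n IH]; first by rewrite expr1.
by rewrite exprS -IH rmorphM idem.
Qed.

End Quotient.

(** * Vertex idempotents *)

Section VertexCorners.
Variables (K : fieldType) (Q : quiver) (I : path_algebra K Q -> Prop).
Hypothesis hI : admissible_ideal I.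
Variables (Lambda : pzRingType) (pi : {rmorphism path_algebra K Q -> Lambda}).
Hypothesis hL : is_quotient_map I pi.
Local Notation co := (connect (@arrow_rel Q)).
Local Notation u := (uL pi).
Local Notation eL P := (idem_map pi (vertex_idem K P)).

Implicit Types P : pred (vert Q).

Lemma eL_sum P : idem_val (eL P) = \sum_(v | P v) u v.
Proof. exact: raddf_sum. Qed.

Lemma eL_u P v : idem_val (eL P) * u v = if P v then u v else 0.
Proof.
rewrite eL_sum mulr_suml; case: ifP => Pv.
  rewrite (bigD1 v) //= uL_mul eqxx big1 ?addr0 // => w /andP[_ /negPf wv].
  by rewrite uL_mul wv.
by rewrite big1 // => w Pw; rewrite uL_mul; case: eqP Pw => // ->; rewrite Pv.
Qed.

Lemma u_eL P v : u v * idem_val (eL P) = if P v then u v else 0.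
Proof.
rewrite eL_sum mulr_sumr; case: ifP => Pv.
  rewrite (bigD1 v) //= uL_mul eqxx big1 ?addr0 // => w /andP[_ /negPf wv].
  by rewrite uL_mul eq_sym wv.
by rewrite big1 // => w Pw; rewrite uL_mul; case: eqP => // vw; rewrite vw Pw in Pv.
Qed.

Lemma eL_eL (P P' : pred (vert Q)) : (forall v, P' v -> P v) ->
  idem_val (eL P) * idem_val (eL P') = idem_val (eL P').
Proof.
move=> PP; rewrite [in RHS]eL_sum [X in _ * X]eL_sum mulr_sumr.
by apply: eq_bigr => v /PP Pv; rewrite eL_u Pv.
Qed.

Lemma eL_eL' (P P' : pred (vert Q)) : (forall v, P' v -> P v) ->
  idem_val (eL P') * idem_val (eL P) = idem_val (eL P').
Proof.
move=> PP; rewrite [in RHS]eL_sum [X in X * _]eL_sum mulr_suml.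
by apply: eq_bigr => v /PP Pv; rewrite u_eL Pv.
Qed.

Lemma eL_path0 (P P' : pred (vert Q)) x : (forall v w, P v -> P' w -> ~~ co w v) ->
  idem_val (eL P) * x * idem_val (eL P') = 0.
Proof.
move=> h; rewrite !eL_sum !mulr_suml big1 // => v Pv.
by rewrite mulr_sumr big1 // => w Pw; apply: (uL_path0 hL); apply: h.
Qed.

Lemma eL_compl P : idem_val (eL P) + idem_val (eL (predC P)) = 1.
Proof. by rewrite !eL_sum -(uL_sum pi) [in RHS](bigID P). Qed.

Local Notation e := (eL (@precyclic Q)).
Local Notation e' := (eL (@critical Q)).
Local Notation e0 := (idem_val e).
Local Notation e0' := (idem_val e').

(** A path that ends in a precyclic vertex starts in one. *)
Lemma tri_precyclic g : e0 * g = e0 * g * e0.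
Proof.
rewrite -[LHS]mulr1 -(eL_compl (@precyclic Q)) mulrDr.
rewrite (@eL_path0 _ (predC (@precyclic Q))) ?addr0 // => v w pv /negP pw.
by apply/negP => wv; apply/pw/(precyclic_pred wv).
Qed.

(** [N] is supported on vertices that are not precyclic; these lie on no oriented cycle and are
    closed under successors, so [peel] applies with [rk_out]. *)
Lemma kill_precyclic (N : lmodType Lambda) : fin_gen N ->
  zero_module (FF (cm_corner e) N) -> fin_pd N.
Proof.
move=> fN N0; have e_N (x : N) : e0 *: x = 0.
  exact: (congr1 (@fv _ _ _ (cm_corner e) N) (N0 (fB (cm_corner e) x))).
apply: (@peel _ _ _ (fdL hI hL) _ u (@rk_out Q) _ (uL_sum pi)
  [set v | ~~ precyclic v]) fN _.
- by move=> v; rewrite uL_mul eqxx.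
- move=> v; rewrite inE => pv x; apply: (uL_corner hL).
  by apply: contra pv; apply: cycle_precyclic.
- move=> v w x; rewrite !inE => pv wv nz.
  have vw : co v w by apply: contrapT => /negP /(uL_path0 hL x).
  split; first by apply: contra pv; apply: precyclic_pred.
  apply: rk_out_lt; rewrite 1?eq_sym //.
  by apply: contra pv; apply: cycle_precyclic.
move=> w; rewrite inE negbK => pw x.
have -> : u w = u w * e0 by rewrite u_eL pw.
by rewrite -scalerA e_N scaler0.
Qed.

Lemma critP (v : vert Q) : critical v -> precyclic v. Proof. by case/andP. Qed.

Local Notation A := (corner e).
Local Notation A' := (corner e').
Local Notation inc := (@cinc Lambda e e').
Let ee' : e0 * e0' = e0' := eL_eL critP.
Let e'e : e0' * e0 = e0' := eL_eL' critP.

Lemma inc1 : corner_val (inc 1 : A) = e0'.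
Proof. by rewrite (cincE ee' e'e). Qed.

(** In the opposite ring the claim reads g e' = e' g e': a path that starts in a critical vertex
    ends in a postcyclic one, so if its end is precyclic it is critical. *)
Lemma tri_critical (g : A^c) : inc 1 * g = inc 1 * g * inc 1.
Proof.
apply: cval_inj; rewrite !cvMo inc1 -[LHS]mul1r -(eL_compl (@critical Q)) mulrDl.
rewrite [X in _ + X](_ : _ = 0) ?addr0 //.
rewrite -(cvalP (g : A)) !mulrA.
have -> : idem_val (eL (predC (@critical Q))) * e0 =
    idem_val (eL [pred v | ~~ critical v && precyclic v]).
  rewrite !eL_sum mulr_suml big_mkcondr; apply: eq_bigr => v _.
  by rewrite -eL_sum u_eL.
rewrite -!mulrA ee' mulrA eL_path0 // => v w /= /andP[cv pv] cw.
apply/negP => wv; case/negP: cv; rewrite /critical pv /=.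
by apply: postcyclic_succ wv _; case/andP: cw.
Qed.

Let uA v : A^c := ce e (u v).
Lemma uAE v : corner_val (uA v : A) = if precyclic v then u v else 0.
Proof. by rewrite ceE eL_u; case: ifP => pv; rewrite ?mul0r // u_eL pv. Qed.

(** The mirror image of [kill_precyclic]: in the opposite ring, vertices that are not postcyclic are
    peeled along predecessors with [rk_in]. The idempotents [uA v] of vertices that are not
    precyclic are zero. *)
Lemma kill_critical (N : lmodType A^c) : fin_gen N ->
  zero_module (FF (cm_cinc ee' e'e) N) -> fin_pd N.
Proof.
move=> fN N0; have e_N (x : N) : inc 1 *: x = 0.
  exact: (congr1 (@fv _ _ _ (cm_cinc ee' e'e) N) (N0 (fB (cm_cinc ee' e'e) x))).
apply: (@peel _ _ _ (fd_op (fd_corner (fdL hI hL) e)) _ uA (@rk_in Q) _ _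
  [set v | ~~ postcyclic v]) fN _.
- move=> v; apply: cval_inj; rewrite cvMo uAE.
  by case: ifP => _; rewrite ?mulr0 // uL_mul eqxx.
- apply: cval_inj; rewrite (big_morph (@corner_val Lambda e)
    (fun a b => erefl) (erefl : corner_val (0 : A) = 0)).
  apply: (etrans _ (esym (eL_sum (@precyclic Q)))); rewrite [in RHS]big_mkcond.
  by apply: eq_bigr => v _; exact: uAE.
- move=> v; rewrite inE => pv x.
  have nv : ~~ on_oriented_cycle v by apply: contra pv; apply: cycle_postcyclic.
  have [c cE] := uL_corner hL (corner_val (x : A)) nv; exists c.
  apply: cval_inj; rewrite !cvMo uAE (iocE (fdL hI hL)).
  case: ifP => pv'; last by rewrite !mul0r.
  by rewrite mulrA cE (fdC (fdL hI hL)) [in RHS](fdC (fdL hI hL)) mulrA u_eL pv'.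
- move=> v w x; rewrite !inE => pv wv nz.
  have nv : ~~ on_oriented_cycle v by apply: contra pv; apply: cycle_postcyclic.
  have cwv : co w v.
    apply: contrapT => /negP h; apply: nz; apply: cval_inj.
    rewrite !cvMo !uAE; case: ifP => _; last by rewrite mul0r.
    case: ifP => _; last by rewrite !mulr0.
    by rewrite mulrA (uL_path0 hL).
  split; first by apply: contra pv; apply: postcyclic_succ.
  by apply: rk_in_lt; rewrite 1?eq_sym.
move=> w; rewrite inE negbK => pw x.
have -> : uA w = uA w * inc 1.
  apply: cval_inj; rewrite cvMo inc1 uAE; case: ifP => pre; last by rewrite mulr0.
  by rewrite eL_u /critical pre pw.
by rewrite -scalerA e_N scaler0.
Qed.

Theorem vertex_corner_unlimited : findim_eq A 0 ->
  fin_pd_contravariantly_finite A'^c -> unlimited_strong_tilting Lambda.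
Proof.
move=> [fd0 _] CF'; have fdLam := fdL hI hL.
have fdA := fd_corner fdLam e; have fdA' := fd_corner fdLam e'.
(* On right modules, contravariant finiteness rises from the corner e' to the corner e;
   [corner_unlimited] then works with the corner e of [Lambda]. *)
have CFA : fin_pd_contravariantly_finite A^c.
  have fF := tri_fg (cm_cinc ee' e'e) tri_critical.
  apply: (CF_of_corner (fd_op fdA) (fd_op fdA') (ioj_cinc fdLam ee' e'e) fF _ CF').
  exact (corner_fin_pd (fd_op fdA) fF
    (tri_proj (cm := cm_cinc ee' e'e) tri_critical) kill_critical).
have CFp (N : lmodType A) : fin_pd N -> projective N.
  by move=> pN; exact: (pd_le_PD (fd0 N pN)).
exact (@corner_unlimited _ _ _ (cm_corner e) tri_precyclic _ _ _ fdLam fdA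
  (iocE fdLam e) kill_precyclic CFp CFA (sqL hI hL)).
Qed.

End VertexCorners.

Theorem corollary6p4 (K : fieldType) (Q : quiver)
    (I : path_algebra K Q -> Prop) (hI : admissible_ideal I)
    (Lambda : pzRingType) (pi : {rmorphism path_algebra K Q -> Lambda})
    (hLambda : is_quotient_map I pi) :
  let e := idem_map pi (vertex_idem K (@precyclic Q)) in
  let e' := idem_map pi (vertex_idem K (@critical Q)) in
  findim_eq (corner e) 0 ->
  fin_pd_contravariantly_finite (corner e')^c ->
  unlimited_strong_tilting Lambda.
Proof. by move=> e e'; apply: (vertex_corner_unlimited hI hLambda). Qed.
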